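(* Let $(X,p)$ be a connected Riemann domain spread over a complex Banach space $E$, and let $Z$ be the connected component of $\pi^{-1}(E)\subset M_b(X)$ which intersects $\delta(X)$, where $\delta(x)=\delta_x$ is evaluation at $x$. Then $\delta:(X,p)\to(Z,\pi)$, $\delta(x)=\delta_x$, is the $H_b$-envelope of holomorphy of $X$.
   Context: A Riemann domain $(X,p)$ over a complex Banach space $E$ is a Hausdorff topological space $X$ with a local homeomorphism $p:X\to E$. For $x\in X$, $\mathrm{dist}_X(x)$ is the supremum of all $r>0$ for which some neighbourhood of $x$ is mapped homeomorphically by $p$ onto the ball $B(p(x),r)$; for $A\subset X$, $\mathrm{dist}_X(A)=\inf_{x\in A}\mathrm{dist}_X(x)$. The set $A$ is $X$-bounded if $p(A)$ is bounded and $\mathrm{dist}_X(A)>0$. $H(X)$ is the space of holomorphic functions $X\to\mathbb C$. $H_b(X)$ (holomorphic functions of bounded type) is the algebra of all $f\in H(X)$ bounded on every $X$-bounded set, a Fréchet algebra with the topology of uniform convergence on $X$-bounded sets. $M_b(X)$ is the set of all nonzero continuous linear multiplicative functionals on $H_b(X)$. For $\varphi\in M_b(X)$ and an $X$-bounded set $B$, write $\varphi\prec B$ if $|\varphi(f)|\le\sup_B|f|$ for all $f\in H_b(X)$; for every $\varphi$ there is such a $B$. For $x\in X$, $\delta_x(f)=f(x)$. The map $\pi:M_b(X)\to E''$ is $\pi(\varphi)(\gamma)=\varphi(\gamma\circ p)$ for $\gamma\in E'$; $E$ is regarded as a subspace of $E''$, and $\pi$ also denotes the restriction of $\pi$ to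 $\pi^{-1}(E)$. Riemann domain structure of $\pi^{-1}(E)$: for $f\in H(X)$ and $y\in X$, $d^nf(y)$ is the $n$-th differential at $p(y)$ of $f\circ(p|_{V_y})^{-1}$, where $V_y$ is a neighbourhood of $y$ on which $p$ is a homeomorphism; it is regarded as an $n$-homogeneous polynomial on $E$, so that $\sum_n \frac{d^nf(y)}{n!}(x)$ is the Taylor series. For $\varphi\in\pi^{-1}(E)$ let $\mathrm{dist}_X(\varphi)=\sup\{\mathrm{dist}_X(B): B\ X\text{-bounded},\ \varphi\prec B\}$. For $x\in E$ with $\|x\|<\mathrm{dist}_X(\varphi)$ put $\varphi^x(f)=\sum_{n=0}^\infty\varphi\big(y\mapsto\frac{d^nf(y)}{n!}(x)\big)$, which defines an element of $\pi^{-1}(E)$ with $\pi(\varphi^x)=\pi(\varphi)+x$. The sets $\{\varphi^x:\|x\|<\varepsilon\}$ with $\varphi\in\pi^{-1}(E)$ and $0<\varepsilon<\mathrm{dist}_X(\varphi)$ form a basis of a Hausdorff topology on $\pi^{-1}(E)$, for which $(\pi^{-1}(E),\pi)$ is a Riemann domain over $E$. A morphism between Riemann domains $(X,p)$, $(Y,q)$ over $E$ is a continuous map $\tau:X\to Y$ with $q\circ\tau=p$. A morphism $\tau:X\to Y$ is an $H_b$-extension of $X$ if for each $f\in H_b(X)$ there is a unique $\tilde f\in H(Y)$ with $\tilde f\circ\tau=f$. It is an $H_b$-envelope of holomorphy of $X$ if it is an $H_b$-extension and for each $H_b$-extension $\nu:X\to Z'$ of $X$ there is a morphism $\mu:Z'\to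 Y$ with $\mu\circ\nu=\tau$. *)

(* Defs.v *)
From HB Require Import structures.
From mathcomp Require Import all_boot all_order all_algebra complex.
From mathcomp Require Import all_classical all_reals all_analysis.

Set Implicit Arguments.
Unset Strict Implicit.
Unset Printing Implicit Defensive.

Import Order.TTheory GRing.Theory Num.Theory numFieldNormedType.Exports.

Local Open Scope classical_set_scope.
Local Open Scope ring_scope.
Local Open Scope complex_scope.

(* The metric topology of C, which the library only provides for abstract
   numFieldTypes. *)
HB.instance Definition _ (R : realType) := GRing.ComAlgebra.copy R[i] R[i]^o.
HB.instance Definition _ (R : realType) := NormedModule.copy R[i] R[i]^o.

Section RiemannDomain.
Context {R : realType} {E : completeNormedModType R[i]} {X : topologicalType}.
Variable p : X -> E.
Implicit Types (x y : X) (U A B : set X) (f : X -> R[i]).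

(* The base point y is only the junk value of the inverse outside V. *)
Definition homeo_onto y U (V : set E) :=
  [/\ set_bij U V p, {within U, continuous p}
    & {within V, continuous 'pinv_(fun=> y) U p}].

Definition is_chart y U :=
  [/\ open U, U y, open (p @` U) & homeo_onto y U (p @` U)].

Definition riemann_domain :=
  hausdorff_space X /\ forall y, exists U, is_chart y U.

Definition dist_pt x : \bar R :=
  ereal_sup [set r%:E | r in [set r : R |
    0 < r /\ exists2 U, nbhs x U & homeo_onto x U (ball (p x) r%:C)]].

Definition dist_set A : \bar R := ereal_inf [set dist_pt x | x in A].

Definition Xbounded A := bounded_set (p @` A) /\ (0 < dist_set A)%E.

(* f o (p|V_y)^-1 *)
Definition local_rep f y : E -> R[i] :=
  f \o 'pinv_(fun=> y) (get (is_chart y)) p.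

Definition holomorphic f := forall y, differentiable (local_rep f y) (p y).

(* d^n f(y)(v) is the n-th Frechet differential of local_rep f y at p(y)
   evaluated at (v, ..., v): since evaluation at a fixed vector commutes with
   differentiation, d^(n+1) g (a)(v) = d[b |-> d^n g (b)(v)](a)(v). *)
Definition dn n f y (v : E) : R[i] :=
  iter n (fun (g : E -> R[i]) (a : E) => 'd g a v) (local_rep f y) (p y).

Definition taylor_term n f (v : E) : X -> R[i] :=
  fun y => dn n f y v / n`!%:R.

Definition bounded_type f :=
  holomorphic f /\ forall B, Xbounded B -> [bounded f x | x in B].

Definition Hb_pred : {pred X -> R[i]} := [pred f | `[< bounded_type f >]].

End RiemannDomain.

Lemma near_eq_differentiable (K : numFieldType) (V W : normedModType K)
    (f g : V -> W) (a : V) :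
  (\forall b \near a, f b = g b) -> differentiable g a -> differentiable f a.
Proof.
move=> fg dg.
have cg := diff_continuous dg.
have H : f \o shift a = cst (f a) + 'd g a +o_ 0 id.
  apply/eqaddoP => e e0.
  have /eqaddoP/(_ e e0) := diff_locally dg.
  have fg0 : \forall h \near 0, f (h + a) = g (h + a).
    by move: fg; rewrite (near_shift 0) /=; apply: filterS => h; rewrite subr0.
  have fga : f a = g a by exact: nbhs_singleton fg.
  apply: filterS2 fg0 => h fgh.
  by rewrite /cst /= !fctE /= fgh fga.
by apply/diff_locallyP; rewrite (diff_unique cg H).
Qed.

Section BoundedType.
Context {R : realType} {E : completeNormedModType R[i]} {X : topologicalType}.
Variable p : X -> E.

Lemma Hb_subring_closed : subring_closed (Hb_pred p).
Proof.
split.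
- apply/asboolP; split=> [y|B _].
    exact: (@differentiable_cst _ _ _ (1 : R[i])).
  by exists 1; split=> // M /ltW M1 x _; rewrite /= normr1.
- move=> f g /asboolP[hf bf] /asboolP[hg bg]; apply/asboolP; split=> [y|B XB].
    exact: (differentiableB (hf y) (hg y)).
  have [M [Mr fM]] := bf _ XB; have [N [Nr gN]] := bg _ XB.
  exists ((M + 1) + (N + 1)); split; first by rewrite !realD.
  move=> L /ltW ML x Bx /=; apply: (le_trans _ ML); apply: (le_trans (ler_normB _ _)).
  by apply: lerD; [apply: fM => //; rewrite ltrDl | apply: gN => //; rewrite ltrDl].
- move=> f g /asboolP[hf bf] /asboolP[hg bg]; apply/asboolP; split=> [y|B XB].
    exact: (differentiableM (hf y) (hg y)).
  have [M [Mr fM]] := bf _ XB; have [N [Nr gN]] := bg _ XB.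
  exists ((M + 1) * (N + 1)); split; first by rewrite realM ?realD.
  move=> L /ltW ML x Bx /=; apply: (le_trans _ ML); rewrite normrM.
  by apply: ler_pM => //; [apply: fM => //; rewrite ltrDl | apply: gN => //; rewrite ltrDl].
Qed.

Lemma Hb_scaler_closed : GRing.scaler_closed (Hb_pred p).
Proof.
move=> a f /asboolP[hf bf]; apply/asboolP; split=> [y|B XB].
  exact: (differentiableZ _ (hf y)).
have [M [Mr fM]] := bf _ XB.
exists (`|a| * (M + 1)); split; first by rewrite realM ?realD ?normr_real.
move=> L /ltW ML x Bx /=; apply: (le_trans _ ML); rewrite normrM.
by apply: ler_wpM2l => //; apply: fM => //; rewrite ltrDl.
Qed.

HB.instance Definition _ :=
  GRing.isSubringClosed.Build (X -> R[i]) (Hb_pred p) Hb_subring_closed.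
HB.instance Definition _ :=
  GRing.isScaleClosed.Build R[i] (X -> R[i]) (Hb_pred p) Hb_scaler_closed.

Record Hb := MkHb { Hb_fun :> X -> R[i]; Hb_funP : Hb_fun \in Hb_pred p }.

HB.instance Definition _ := [isSub for Hb_fun].
HB.instance Definition _ := [Choice of Hb by <:].
HB.instance Definition _ :=
  GRing.SubChoice_isSubComPzRing.Build _ _ Hb (subringClosedP _).
HB.instance Definition _ := [SubZmodule_isSubLmodule of Hb by <:].

(* Uniform convergence on X-bounded sets. *)
HB.instance Definition _ := Topological.copy Hb
  (initial_topology (Hb_fun : Hb -> {family Xbounded p, X -> R[i]})).

(* The norm of R[i] takes its (real) values in R[i]. *)
Definition sup_norm (f : X -> R[i]) (B : set X) : \bar R :=
  ereal_sup [set (complex.Re `|f x|)%:E | x in B].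

Definition dominated (phi : Hb -> R[i]) (B : set X) :=
  forall f : Hb, ((complex.Re `|phi f|)%:E <= sup_norm f B)%E.

Definition Mb : set (Hb -> R[i]) := [set phi : Hb -> R[i] |
  [/\ linear phi, {morph phi : f g / f * g}, phi <> (fun=> 0)
    & continuous phi]].

Record topdual := MkDual { dual_fun :> {linear E -> R[i]};
                           dual_cont : continuous dual_fun }.

Definition bidual_embed (a : E) : topdual -> R[i] := fun gamma => gamma a.

Hypothesis rdp : riemann_domain p.

Lemma chartP y : is_chart p y (get (is_chart p y)).
Proof. by case: rdp => _ /(_ y) /getPex. Qed.

Lemma chart_inv y b (U := get (is_chart p y)) :
  (p @` U) b -> p ('pinv_(fun=> y) U p b) = b.
Proof. by move=> Ub; apply: pinvK; rewrite inE. Qed.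

Lemma dual_comp_bounded_type (gamma : topdual) : gamma \o p \in Hb_pred p.
Proof.
apply/asboolP; split=> [y|B [pB _]].
  apply: (near_eq_differentiable (g := gamma)); last first.
    by apply: linear_differentiable; exact: dual_cont.
  have [oU Uy opU _] := chartP y.
  have : nbhs (p y) (p @` get (is_chart p y)).
    by apply: open_nbhs_nbhs; split=> //; exists y.
  by apply: filterS => b Ub; rewrite /local_rep /= chart_inv.
have gamma0 : {for 0, continuous gamma} by exact: dual_cont.
have /linear_boundedP/pinfty_ex_gt0[r r0 gr] :=
  continuous_linear_bounded 0 gamma0.
have [M [Mr pM]] := pB.
exists (r * (M + 1)); split; first by apply: realM; [exact: gtr0_real | exact: realD].
move=> L /ltW ML x Bx /=; apply: (le_trans _ ML); apply: (le_trans (gr _)).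
by apply: ler_wpM2l; [exact: ltW | apply: pM; [rewrite ltrDl | exists x]].
Qed.

Definition dual_comp (gamma : topdual) : Hb :=
  MkHb (dual_comp_bounded_type gamma).

(* pi(phi) as a function on E': for phi in Mb it lies in E''. *)
Definition pi_bidual (phi : Hb -> R[i]) : topdual -> R[i] :=
  fun gamma => phi (dual_comp gamma).

Definition pi_preim : set (Hb -> R[i]) :=
  Mb `&` [set phi | exists a : E, pi_bidual phi = bidual_embed a].

Definition delta_fun (x : X) : Hb -> R[i] := fun f => f x.

Lemma dist_pt_gt0 x : (0 < dist_pt p x)%E.
Proof.
have [U [oU Ux opU [[Umap Uinj Usurj] cU cV]]] := rdp.2 x.
have : nbhs (p x) (p @` U) by apply: open_nbhs_nbhs; split=> //; exists x.
move=> /nbhs_ballP[e /= e0 eU].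
pose r := complex.Re e.
have er : e = r%:C by rewrite RRe_real // gtr0_real.
have r0 : 0 < r by rewrite -(@ltcR R) -er.
apply: (@lt_le_trans _ _ r%:E); first by rewrite lte_fin.
apply: ereal_sup_ubound; exists r => //; split=> //.
rewrite -er; set B := ball (p x) e.
have UB : U `&` p @^-1` B `<=` U by move=> ? [].
exists (U `&` p @^-1` B).
  have cpx : {for x, continuous p}.
    by move: cU; rewrite continuous_open_subspace //; apply; rewrite inE.
  apply: filterI; first exact: open_nbhs_nbhs.
  by apply: cpx; exact: nbhsx_ballx.
have bijW : set_bij (U `&` p @^-1` B) B p.
  split=> [z []//|z w|b Bb].
    by rewrite !inE => -[Uz _] [Uw _]; apply: Uinj; rewrite inE.
  by have [z Uz pzb] := eU _ Bb; exists z => //; split=> //=; rewrite pzb.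
split=> //; first exact: continuous_subspaceW cU.
apply: (@subspace_eq_continuous _ _ _ ('pinv_(fun=> x) U p)); last first.
  exact: continuous_subspaceW cV.
move=> b; rewrite inE => Bb.
have [z Uz pzb] := eU _ Bb; have Bz : B (p z) by rewrite pzb.
have [_ Winj _] := bijW.
have -> : 'pinv_(fun=> x) U p b = z by rewrite -pzb pinvKV ?inE.
by apply/esym; rewrite -pzb; apply: (pinvKV _ Winj); rewrite inE.
Qed.

Lemma delta_continuous x : continuous (delta_fun x : Hb -> R[i]).
Proof.
have Xx : Xbounded p [set x].
  split; last by rewrite /dist_set image_set1 ereal_inf1; exact: dist_pt_gt0.
  by rewrite image_set1; exists `|p x|; split=> // M /ltW Mx _ /= ->.
move=> f.
have /fam_cvgP/(_ _ Xx) :=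
  @initial_continuous Hb {family Xbounded p, X -> R[i]} Hb_fun f.
have FF : Filter (Hb_fun g @[g --> f]) by apply: fmap_filter; exact: nbhs_filter.
by rewrite (uniform_set1 _ _ FF) => /(_ FF).
Qed.

Lemma delta_pi_preim x : pi_preim (delta_fun x).
Proof.
split; last by exists (p x).
split=> //; last exact: delta_continuous.
by move/(congr1 (@^~ 1)) => /eqP; rewrite /delta_fun /= oner_eq0.
Qed.

Definition spectrum_E := set_type pi_preim.

HB.instance Definition _ := Choice.on spectrum_E.

Definition delta (x : X) : spectrum_E := SigSub (mem_set (delta_pi_preim x)).

Definition proj_E (phi : spectrum_E) : E :=
  xget 0 [set a | pi_bidual (\val phi) = bidual_embed a].

Definition dist_spectrum (phi : spectrum_E) : \bar R :=
  ereal_sup [set dist_set p B | B in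
    [set B | Xbounded p B /\ dominated (\val phi) B]].

(* psi = phi^v; the existence of g says that the functions
   y |-> d^n f(y)(v) / n! belong to H_b(X). *)
Definition is_translate (phi : spectrum_E) (v : E) (psi : spectrum_E) :=
  forall f : Hb, exists g : nat -> Hb,
    (forall n, g n = taylor_term p n f v :> (X -> R[i])) /\
    series (fun n => \val phi (g n)) @ \oo --> (\val psi f : R[i]).

Definition spectrum_ball (phi : spectrum_E) (e : R) : set spectrum_E :=
  [set psi | exists2 v : E, `|v| < e%:C & is_translate phi v psi].

(* These sets are a basis of a topology, which is therefore the topology they
   generate as a subbasis. *)
HB.instance Definition _ := isSubBaseTopological.Build spectrum_E
  [set V | exists phi (e : R),
    [/\ 0 < e, (e%:E < dist_spectrum phi)%E & V = spectrum_ball phi e]] id.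

End BoundedType.

Section Extension.
Context {R : realType} {E : completeNormedModType R[i]}.

Definition rd_morphism (X Y : topologicalType) (p : X -> E) (q : Y -> E)
    (tau : X -> Y) :=
  [/\ riemann_domain p, riemann_domain q, continuous tau & q \o tau = p].

Definition Hb_extension (X Y : topologicalType) (p : X -> E) (q : Y -> E)
    (tau : X -> Y) :=
  rd_morphism p q tau /\
  forall f : Hb p, exists! g : Y -> R[i], holomorphic q g /\ g \o tau = f.

Definition Hb_envelope (X Y : topologicalType) (p : X -> E) (q : Y -> E)
    (tau : X -> Y) :=
  Hb_extension p q tau /\
  forall (Z : topologicalType) (r : Z -> E) (nu : X -> Z),
    Hb_extension p r nu ->
    exists2 mu : Z -> Y, rd_morphism r q mu & mu \o nu = tau.

End Extension.

(* Main.v *)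
Require Import Defs.
From HB Require Import structures.
From mathcomp Require Import all_boot all_order all_algebra complex.
From mathcomp Require Import all_classical all_reals all_analysis.
From mathcomp Require Import ring lra.

Set Implicit Arguments.
Unset Strict Implicit.
Unset Printing Implicit Defensive.

Import Order.TTheory GRing.Theory Num.Theory numFieldNormedType.Exports.

Local Open Scope classical_set_scope.
Local Open Scope ring_scope.
Local Open Scope complex_scope.

(** Let (X, p) be a connected Riemann domain over E. The elements of pi^-1(E) are
    the characters phi of H_b(X) that are continuous and project to a point of E,
    and Z is the component of the evaluations. Two things have to be shown: every f
    of bounded type extends uniquely from X to Z, and every H_b-extension of X maps
    to Z.

    The structure of pi^-1(E) comes from translation. If phi is dominated by an
    X-bounded set B and |v| < dist B, the Taylor polynomials of f converge to
    f (y + v) uniformly for y in B ([taylor_unif]), so phi^v (f) is the limit of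
    phi on these polynomials, and every identity or estimate between values
    f (y + v) passes to phi^v ([dom_limit]). In this way phi^v is a character that
    is dominated by a thickening of B ([tr_character]), it depends holomorphically
    on v ([char_diff]), and comparing Taylor series gives (phi^v)^w = phi^(v+w)
    ([tr_tr]). From this local group law one reads off that the balls form a basis,
    that the topology is Hausdorff and that translations are local inverses of pi
    ([spec_riemann_domain]); that pi is well defined is the Hahn-Banach theorem
    ([dual_separates]). The function phi -> phi (f) is holomorphic on pi^-1(E)
    ([spec_eval_holomorphic]) and restricts to f along delta; since Z is connected
    and delta is open, it is the only holomorphic extension of f to Z, by the
    identity theorem.

    Let now nu : X -> W be another H_b-extension, over r : W -> E. Uniqueness of
    extensions makes W connected ([extension_connected]) and makes the evaluation at
    w of the extension of f a unital homomorphism mu w of H_b(X), which projects to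
    r w because gamma o r extends gamma o p. The point is that mu w is continuous.
    It is so for w in the image of X. If it is continuous at w, and w + v is reached
    from w inside a ball of W, then mu (w + v) (f) is the sum of the Taylor series of
    the extension of f at w, that is, the pointwise limit of mu w applied to Taylor
    polynomials of f; these are continuous functionals of f, and so is their limit by
    the Banach-Steinhaus theorem for H_b(X) ([banach_steinhaus], [ext_dom_step]). As
    the size of v depends on W only, the set of good points is open and closed
    ([ext_domT]). The same expansion shows mu (w + v) = (mu w)^v for small v, so that
    mu is continuous; its values lie in Z because W is connected, and mu o nu = delta.

    The facts on holomorphic functions that are used (Cauchy estimates, convergence
    of the Taylor series with geometric remainder, holomorphy of uniform limits and of
    directional derivatives, the identity theorem) are derived from Cauchy's formula
    on circles, which comes from Goursat's bisection argument, and are transported to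
    E by restriction to complex lines. *)

(** * Real-valued norms and complex derivatives *)

Section RealNorm.
Context {R : realType}.
Implicit Types (V : normedModType R[i]) (z w : R[i]).

(** The norm of a normed space over R[i] takes its values in R[i]; estimates are
    carried out with this copy in R, where the order is total. *)
Definition nrm V (x : V) : R := complex.Re `|x|.

Lemma nrmE V (x : V) : `|x| = (nrm x)%:C.
Proof. by rewrite /nrm RRe_real // normr_real. Qed.

Lemma nrm_ge0 V (x : V) : 0 <= nrm x.
Proof. by rewrite -(@lecR R) -nrmE normr_ge0. Qed.

Lemma nrmD V (x y : V) : nrm (x + y) <= nrm x + nrm y.
Proof. by rewrite -(@lecR R) rmorphD /= -!nrmE ler_normD. Qed.

Lemma nrmN V (x : V) : nrm (- x) = nrm x.
Proof. by rewrite /nrm normrN. Qed.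

Lemma nrmB V (x y : V) : nrm (x - y) <= nrm x + nrm y.
Proof. by rewrite -(nrmN y) nrmD. Qed.

Lemma nrmC V (x y : V) : nrm (x - y) = nrm (y - x).
Proof. by rewrite -nrmN opprB. Qed.

Lemma nrm_tri V (y x z : V) : nrm (x - z) <= nrm (x - y) + nrm (y - z).
Proof. by rewrite -[x - z](subrKA y); exact: nrmD. Qed.

Lemma nrm0 V : nrm (0 : V) = 0.
Proof. by rewrite /nrm normr0. Qed.

Lemma nrm_eq0 V (x : V) : nrm x = 0 -> x = 0.
Proof. by move=> x0; apply/eqP; rewrite -normr_eq0 nrmE x0. Qed.

Lemma nrm_le0 V (x : V) : nrm x <= 0 -> x = 0.
Proof. by move=> x0; apply: nrm_eq0; apply/eqP; rewrite eq_le x0 nrm_ge0. Qed.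

Lemma nrm_gt0 V (x : V) : x != 0 -> 0 < nrm x.
Proof.
rewrite lt_neqAle nrm_ge0 andbT; apply: contra => /eqP x0.
by apply/eqP/nrm_eq0.
Qed.

Lemma nrmZ V (a : R[i]) (x : V) : nrm (a *: x) = nrm a * nrm x.
Proof. by apply: (@complexI R); rewrite rmorphM /= -!nrmE normrZ. Qed.

Lemma nrmM z w : nrm (z * w) = nrm z * nrm w.
Proof. exact: (@nrmZ R[i]). Qed.

Lemma nrm_real (r : R) : nrm (r%:C : R[i]) = `|r|.
Proof.
by rewrite /nrm normc_def /= expr0n addr0 sqrtr_sqr.
Qed.

Lemma nrm1 : nrm (1 : R[i]) = 1.
Proof. by rewrite /nrm normr1. Qed.

Lemma nrmX z n : nrm (z ^+ n) = nrm z ^+ n.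
Proof.
by elim: n => [|n IH]; rewrite ?expr0 ?nrm1 // !exprS nrmM IH.
Qed.

Lemma nrmV z : nrm z^-1 = (nrm z)^-1.
Proof.
have [->|z0] := eqVneq z 0; first by rewrite !(invr0, nrm0).
have nz : nrm z != 0 by rewrite gt_eqF // nrm_gt0.
by apply: (mulfI nz); rewrite -nrmM mulfV // mulfV // nrm1.
Qed.

Lemma nrm_nat n : nrm (n%:R : R[i]) = n%:R.
Proof. by rewrite -(rmorph_nat (real_complex R)) nrm_real ger0_norm. Qed.

Lemma Re_le z : `|complex.Re z| <= nrm z.
Proof. by rewrite -(@lecR R) -nrmE; exact: normc_ge_Re. Qed.

Lemma nrmI z : nrm (z * 'i%C) = nrm z.
Proof.
rewrite nrmM; suff -> : nrm ('i%C : R[i]) = 1 by rewrite mulr1.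
by rewrite /nrm normc_def /= expr0n add0r expr1n sqrtr1.
Qed.

Lemma Im_le z : `|complex.Im z| <= nrm z.
Proof. by rewrite -nrmI -normrN -ReiNIm Re_le. Qed.

Lemma nrm_ReIm z : nrm z <= `|complex.Re z| + `|complex.Im z|.
Proof.
rewrite {1}(complexE z); apply: (le_trans (nrmD _ _)).
by rewrite [_ * _%:C]mulrC nrmI !nrm_real.
Qed.

Lemma ball_nrm V (a b : V) (r : R) : ball a r%:C b <-> nrm (b - a) < r.
Proof. by rewrite -ball_normE /= nrmE ltcR nrmC. Qed.

Lemma gt0_toC (e : R[i]) : 0 < e -> exists2 r : R, 0 < r & e = r%:C.
Proof.
move=> e0; exists (complex.Re e); last by rewrite RRe_real // gtr0_real.
by rewrite -(@ltcR R) RRe_real // gtr0_real.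
Qed.

Lemma nbhs_nrm V (a : V) (A : set V) :
  nbhs a A <-> exists2 r : R, 0 < r & forall b, nrm (b - a) < r -> A b.
Proof.
split=> [/nbhs_ballP[e /= /gt0_toC[r r0 ->]] rA|[r r0 rA]].
  by exists r => // b br; apply/rA/ball_nrm.
apply/nbhs_ballP; exists r%:C => /=; first by rewrite (@ltcR R 0).
by move=> b /ball_nrm /rA.
Qed.

(** Closes estimates that hold up to a fixed multiple of an arbitrary error. *)
Lemma le_eps (x : R) (C : R) : 
  (forall e, 0 < e -> x <= e * C) -> x <= 0.
Proof.
move=> H; rewrite leNgt; apply/negP => x0.
have C0 : 0 < C by have := H 1 ltr01; rewrite mul1r; exact: lt_le_trans.
have /H : 0 < x / 2 / C by rewrite !divr_gt0.
by rewrite divfK ?gt_eqF //; lra.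
Qed.

(** The Frechet derivative with explicit errors; [fder_differentiable] and
    [differentiable_fder] translate to and from the filter-based notion. *)
Definition fder V (g : V -> R[i]) (a : V) (L : V -> R[i]) :=
  forall e : R, 0 < e -> exists2 d : R, 0 < d &
    forall h, nrm h < d -> nrm (g (a + h) - g a - L h) <= e * nrm h.

Definition lin V (L : V -> R[i]) :=
  (forall x y, L (x + y) = L x + L y) /\ (forall c x, L (c *: x) = c * L x).

Definition bounded_lin V (L : V -> R[i]) :=
  lin L /\ exists C : R, forall h, nrm (L h) <= C * nrm h.

Lemma fder_unique V (g : V -> R[i]) a L L' :
  lin L -> lin L' -> fder g a L -> fder g a L' -> L =1 L'.
Proof.
move=> [_ lL] [_ lL'] gL gL' h; apply/eqP; rewrite -subr_eq0; apply/eqP.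
apply: nrm_le0.
apply: (@le_eps _ (2 * nrm h)) => e e0.
have [d d0 Hd] := gL e e0; have [d' d'0 Hd'] := gL' e e0.
have [h0|h0] := eqVneq h 0.
  by rewrite h0 -(scale0r 0) lL lL' !mul0r subr0 scaler0 !nrm0 !mulr0.
have nh := nrm_gt0 h0.
pose t := Num.min d d' / 2 / nrm h.
have m0 : 0 < Num.min d d' by rewrite lt_min d0.
have t0 : 0 < t by rewrite !divr_gt0.
have nth : nrm (t%:C *: h) = Num.min d d' / 2.
  by rewrite nrmZ nrm_real gtr0_norm // divfK // gt_eqF.
have lt1 : nrm (t%:C *: h) < d.
  rewrite nth; apply: (@lt_le_trans _ _ (Num.min d d')); first by lra.
  by rewrite ge_min lexx.
have lt2 : nrm (t%:C *: h) < d'.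
  rewrite nth; apply: (@lt_le_trans _ _ (Num.min d d')); first by lra.
  by rewrite ge_min lexx orbT.
have := Hd _ lt1; have := Hd' _ lt2; rewrite lL lL'.
set x := g _ - _ => H1 H2.
have : nrm (t%:C * (L h - L' h)) <= 2 * e * nrm (t%:C *: h).
  have -> : t%:C * (L h - L' h) = (x - t%:C * L' h) - (x - t%:C * L h).
    by rewrite mulrBr; ring.
  by apply: (le_trans (nrmB _ _)); lra.
rewrite nrmM nrmZ nrm_real gtr0_norm // => H3.
by rewrite -(ler_pM2l t0); lra.
Qed.

Lemma fder_differentiable V (g : V -> R[i]) a :
  differentiable g a -> fder g a ('d g a).
Proof.
move=> dg e e0.
have /eqaddoP/(_ e%:C) := diff_locally dg.
rewrite (@ltcR R 0) => /(_ e0) /nbhs_nrm[r r0 H]; exists r => // h hr.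
have := H h; rewrite subr0 => /(_ hr); rewrite !nrmE -rmorphM lecR.
by rewrite !fctE /= /cst /shift /= opprD addrA (addrC h).
Qed.

Lemma bounded_lin_diff V (g : V -> R[i]) a :
  differentiable g a -> bounded_lin ('d g a).
Proof.
move=> dg; split; first by split=> *; rewrite (linearD, linearZ).
have c0 : {for 0, continuous ('d g a)} by exact: diff_continuous.
have /linear_boundedP/pinfty_ex_gt0[r r0 gr] := continuous_linear_bounded 0 c0.
have [r' r'0 rE] := gt0_toC r0.
by exists r' => h; have := gr h; rewrite !nrmE rE -rmorphM lecR.
Qed.

Lemma differentiable_fder V (g : V -> R[i]) a L :
  bounded_lin L -> fder g a L -> differentiable g a /\ 'd g a = L :> (V -> R[i]).
Proof.
move=> [[LD LZ] [C LC]] gL.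
have lL : linear L by move=> c x y; rewrite LD LZ.
pose M : {linear V -> R[i]} := HB.pack L (GRing.isLinear.Build _ _ _ _ L lL).
have Mc : continuous M.
  apply/bounded_linear_continuous/linear_boundedP.
  exists (`|C|)%:C; split; first by rewrite realE (@lecR R 0) normr_ge0.
  move=> r Cr x; apply: le_trans (_ : _ <= (`|C|)%:C * `|x|) _.
    rewrite !nrmE -rmorphM lecR; apply: (le_trans (LC x)).
    by apply: ler_wpM2r; [exact: nrm_ge0 | exact: ler_norm].
  by apply: ler_wpM2r => //; exact: ltW.
have H : g \o shift a = cst (g a) + M +o_ 0 id.
  apply/eqaddoP => e /gt0_toC[r r0 ->].
  have [d d0 Hd] := gL r r0; apply/nbhs_nrm; exists d => // h.
  rewrite subr0 => /Hd; rewrite !nrmE -rmorphM lecR.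
  by rewrite !fctE /= /cst /shift /= opprD addrA (addrC h).
have dE := diff_unique Mc H; split; last by rewrite dE.
by apply/diff_locallyP; rewrite dE.
Qed.

End RealNorm.

(** * Integration of complex functions on an interval *)

Section ComplexIntegral.
Context {R : realType}.
Implicit Types (F G f : R -> R[i]) (a b x : R) (c z : R[i]).

(** Complex differentiability in one variable. *)
Definition hder (phi : R[i] -> R[i]) z (l : R[i]) := fder phi z (fun w => l * w).

(** Differentiability of a curve with respect to its real parameter. *)
Definition rder F x (l : R[i]) := forall e : R, 0 < e -> exists2 d : R, 0 < d &
  forall h : R, `|h| < d -> nrm (F (x + h) - F x - h%:C * l) <= e * `|h|.

Lemma Re_continuous : continuous (@complex.Re R).
Proof.
move=> z; apply/(@cvgrPdist_lt _ R R[i] (nbhs z)) => e e0.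
apply/nbhs_nrm; exists e => // w wz.
by rewrite -raddfB /=; apply: le_lt_trans (Re_le _) _; rewrite nrmC.
Qed.

Lemma Im_continuous : continuous (@complex.Im R).
Proof.
move=> z; apply/(@cvgrPdist_lt _ R R[i] (nbhs z)) => e e0.
apply/nbhs_nrm; exists e => // w wz.
by rewrite -raddfB /=; apply: le_lt_trans (Im_le _) _; rewrite nrmC.
Qed.

Lemma continuous_nrmP {T : topologicalType} (F : T -> R[i]) (x : T) :
  {for x, continuous F} <->
  forall e : R, 0 < e -> \forall y \near x, nrm (F y - F x) < e.
Proof.
split=> [Fx e e0|H].
  have /(@cvgrPdist_lt _ R[i])/(_ e%:C) := Fx; rewrite (@ltcR R 0) => /(_ e0).
  by apply: filterS => y; rewrite nrmE ltcR nrmC.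
apply/(@cvgrPdist_lt _ R[i]) => e /gt0_toC[r r0 ->].
by have := H r r0; apply: filterS => y; rewrite nrmE ltcR nrmC.
Qed.

Definition cint F a b : R[i] :=
  (\int[lebesgue_measure]_(x in `[a, b]) complex.Re (F x)) +i*
  (\int[lebesgue_measure]_(x in `[a, b]) complex.Im (F x)).

Definition ccont F a b := forall x, a <= x <= b -> {for x, continuous F}.

Lemma ccontM F G a b : ccont F a b -> ccont G a b ->
  ccont (fun x => F x * G x) a b.
Proof.
by move=> HF HG x xab; apply: (@continuousM R[i] R F G); [exact: HF|exact: HG].
Qed.

Lemma ccontD F G a b : ccont F a b -> ccont G a b ->
  ccont (fun x => F x + G x) a b.
Proof.
by move=> HF HG x xab; apply: (@continuousD _ R[i] R F G); [exact: HF|exact: HG].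
Qed.

Lemma ccont_cst c a b : ccont (fun=> c) a b.
Proof. by move=> x _; exact: cvg_cst. Qed.

Lemma ccontZ c F a b : ccont F a b -> ccont (fun x => c * F x) a b.
Proof. by move=> HF; exact: (ccontM (@ccont_cst c a b) HF). Qed.

Lemma ccontB F G a b : ccont F a b -> ccont G a b ->
  ccont (fun x => F x - G x) a b.
Proof.
move=> HF HG; apply: (ccontD HF (G := fun x => - G x)) => x xab.
by apply: (@continuousN _ R[i] R G); exact: HG.
Qed.

Lemma ccontV F a b : (forall x, a <= x <= b -> F x != 0) -> ccont F a b ->
  ccont (fun x => (F x)^-1) a b.
Proof.
by move=> F0 HF x xab; apply: (@continuousV R[i] R F); [exact: F0|exact: HF].
Qed.

Lemma ccontX F n a b : ccont F a b -> ccont (fun x => F x ^+ n) a b.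
Proof.
move=> HF; elim: n => [|n IH]; first exact: ccont_cst.
rewrite (_ : (fun _ => _) = (fun x => F x * F x ^+ n)).
  exact: (ccontM HF IH).
by apply/funext => x; rewrite exprS.
Qed.

Let Rein F a b : ccont F a b ->
  lebesgue_measure.-integrable `[a, b] (EFin \o (fun x => complex.Re (F x))).
Proof.
move=> cF; apply: continuous_compact_integrable; first exact: segment_compact.
apply: continuous_in_subspaceT => x; rewrite inE /= in_itv /= => /cF Fx.
by apply: continuous_comp => //; exact: Re_continuous.
Qed.

Let Imin F a b : ccont F a b ->
  lebesgue_measure.-integrable `[a, b] (EFin \o (fun x => complex.Im (F x))).
Proof.
move=> cF; apply: continuous_compact_integrable; first exact: segment_compact.
apply: continuous_in_subspaceT => x; rewrite inE /= in_itv /= => /cF Fx.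
by apply: continuous_comp => //; exact: Im_continuous.
Qed.

Lemma eq_cint F G a b : (forall x, a <= x <= b -> F x = G x) ->
  cint F a b = cint G a b.
Proof.
by move=> FG; congr (_ +i* _); apply: eq_Rintegral => x;
  rewrite inE /= in_itv /= => /FG ->.
Qed.

Lemma cintD F G a b : ccont F a b -> ccont G a b ->
  cint (fun x => F x + G x) a b = cint F a b + cint G a b.
Proof.
move=> cF cG; rewrite /cint.
have E x : complex.Re (F x + G x) = complex.Re (F x) + complex.Re (G x).
  by rewrite raddfD.
have E' x : complex.Im (F x + G x) = complex.Im (F x) + complex.Im (G x).
  by rewrite raddfD.
under eq_Rintegral do rewrite E.
under [X in _ +i* X]eq_Rintegral do rewrite E'.
by rewrite !RintegralD //; [exact: Imin|exact: Imin|exact: Rein|exact: Rein].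
Qed.

Lemma cintZ c F a b : ccont F a b ->
  cint (fun x => c * F x) a b = c * cint F a b.
Proof.
move=> cF; rewrite /cint; case: c => u v.
have E x : complex.Re ((u +i* v) * F x) =
    u * complex.Re (F x) - v * complex.Im (F x) by case: (F x).
have E' x : complex.Im ((u +i* v) * F x) =
    u * complex.Im (F x) + v * complex.Re (F x) by case: (F x).
have i1 r : lebesgue_measure.-integrable `[a, b]
    (EFin \o (fun x => r * complex.Re (F x))).
  by rewrite (_ : _ \o _ = fun x => r%:E * (EFin \o (fun y => complex.Re (F y))) x)%E //;
    apply: integrableZl => //; exact: Rein.
have i2 r : lebesgue_measure.-integrable `[a, b]
    (EFin \o (fun x => r * complex.Im (F x))).
  by rewrite (_ : _ \o _ = fun x => r%:E * (EFin \o (fun y => complex.Im (F y))) x)%E //;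
    apply: integrableZl => //; exact: Imin.
under eq_Rintegral do rewrite E.
under [X in _ +i* X = _]eq_Rintegral do rewrite E'.
rewrite RintegralB // RintegralD // !RintegralZl //; do ?[exact: Rein|exact: Imin].
Qed.

Lemma cintB F G a b : ccont F a b -> ccont G a b ->
  cint (fun x => F x - G x) a b = cint F a b - cint G a b.
Proof.
move=> cF cG; rewrite -[- cint G a b]mulN1r -(cintZ (-1) cG).
rewrite -(cintD cF (ccontZ (c := -1) cG)).
by apply: eq_cint => x _; rewrite (mulN1r (G x)).
Qed.

(** The factor 2 is the price of bounding the real and the imaginary part
    separately; no later estimate depends on the value of the constant. *)
Lemma cint_bound F a b M : a <= b -> ccont F a b ->
  (forall x, a <= x <= b -> nrm (F x) <= M) ->
  nrm (cint F a b) <= 2 * M * (b - a).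
Proof.
move=> ab cF FM; apply: (le_trans (nrm_ReIm _)) => /=.
have mu_ab : fine (lebesgue_measure (`[a, b] : set R)) = b - a.
  rewrite lebesgue_measure_itv /= lte_fin; have [//|ba] := ltP a b.
  by rewrite (_ : a = b) ?subrr //; lra.
have B (g : R -> R) : lebesgue_measure.-integrable `[a, b] (EFin \o g) ->
    (forall x, a <= x <= b -> `|g x| <= M) ->
    `|\int[lebesgue_measure]_(x in `[a, b]) g x| <= M * (b - a).
  move=> ig gM; apply: le_trans (le_normr_Rintegral _ ig) _ => //.
  rewrite -mu_ab -Rintegral_cst //; apply: le_Rintegral => //.
  - exact: integrable_norm.
  - apply: continuous_compact_integrable; first exact: segment_compact.
    exact: continuous_subspaceT (@cst_continuous _ _ M).
have -> : 2 * M * (b - a) = M * (b - a) + M * (b - a) by ring.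
apply: lerD; apply: B; do ?[exact: Rein|exact: Imin] => x /FM.
  exact: le_trans (Re_le _).
exact: le_trans (Im_le _).
Qed.

Lemma cint_split F a m b : a <= m -> m <= b -> ccont F a b ->
  cint F a b = cint F a m + cint F m b.
Proof.
move=> am mb cF.
have S (g : R -> R) : lebesgue_measure.-integrable `[a, b] (EFin \o g) ->
    \int[lebesgue_measure]_(x in `[a, b]) g x =
    \int[lebesgue_measure]_(x in `[a, m]) g x +
    \int[lebesgue_measure]_(x in `[m, b]) g x.
  move=> ig; have := @Rintegral_itvB R g (BLeft a) (BRight b) m ig.
  rewrite !bnd_simp => /(_ am mb) /(canRL (subrK _)) ->; rewrite addrC.
  congr (_ + _); rewrite Rintegral_itv_obnd_cbnd //.
  apply: integrableS ig => //.
  by move=> x /=; rewrite !in_itv /= => /andP[mx ->]; rewrite (le_trans am) // ltW.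
by rewrite /cint (S _ (Rein cF)) (S _ (Imin cF)).
Qed.

Let FTCreal (F f : R -> R) a b : a < b ->
  (forall x, a <= x <= b -> {for x, continuous f}) ->
  (forall x, a <= x <= b -> is_derive x 1 F (f x)) ->
  \int[lebesgue_measure]_(x in `[a, b]) f x = F b - F a.
Proof.
move=> ab cf dF; rewrite /Rintegral (@continuous_FTC2 _ f F) //.
- apply: continuous_in_subspaceT => x; rewrite inE /= in_itv /=; exact: cf.
- have cF x : a <= x <= b -> {for x, continuous F}.
    move=> /dF dFx; apply/differentiable_continuous/derivable1_diffP.
    exact: ex_derive.
  split.
  + move=> x; rewrite in_itv /= => /andP[ax xb].
    by have [] := dF x; rewrite ?(ltW ax) ?(ltW xb).
  + by apply: cvg_at_right_filter; apply: cF; rewrite lexx ltW.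
  + by apply: cvg_at_left_filter; apply: cF; rewrite lexx ltW.
- move=> x; rewrite in_itv /= => /andP[ax xb]; rewrite derive1E.
  by apply: (@derive_val _ _ _ _ _ _ _ (dF x _)); rewrite (ltW ax) (ltW xb).
Qed.

Let is_derive_eps (F : R -> R) x l :
  (forall e : R, 0 < e -> exists2 d : R, 0 < d &
    forall h : R, `|h| < d -> `|F (x + h) - F x - h * l| <= e * `|h|) ->
  is_derive x 1 F l.
Proof.
move=> H.
have cl : h^-1 *: ((F \o shift x) (h *: 1) - F x) @[h --> 0^'] --> l.
  apply/cvgrPdist_le => e e0; have [d d0 Hd] := H e e0.
  apply/nbhs_ballP; exists d => //= h; rewrite /ball /= sub0r normrN => hd h0.
  have := Hd h hd; rewrite /= /shift /= scaler1 (addrC h) => H1.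
  rewrite distrC -(@ler_pM2r _ `|h|) ?normr_gt0 //; apply: le_trans H1.
  by rewrite -normrM mulrBl /GRing.scale /= mulrAC mulVf // mul1r (mulrC l).
by apply: DeriveDef; [apply/cvg_ex; exists l | exact: cvg_lim].
Qed.

Theorem cint_FTC F f a b : a < b -> ccont f a b ->
  (forall x, a <= x <= b -> rder F x (f x)) ->
  cint f a b = F b - F a.
Proof.
move=> ab cf dF.
have -> : F b - F a = (complex.Re (F b) - complex.Re (F a)) +i*
    (complex.Im (F b) - complex.Im (F a)).
  by case: (F b) (F a) => ? ? [].
congr (_ +i* _).
- apply: (FTCreal (F := fun x => complex.Re (F x))) => // x xab.
    by apply: continuous_comp; [exact: cf | exact: Re_continuous].
  apply: is_derive_eps => e e0; have [d d0 Hd] := dF x xab e e0.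
  exists d => // h /Hd; apply: le_trans; apply: le_trans (Re_le _).
  by case: (F (x + h)) (F x) (f x) => ? ? [? ?] [? ?] /=; rewrite mul0r subr0.
- apply: (FTCreal (F := fun x => complex.Im (F x))) => // x xab.
    by apply: continuous_comp; [exact: cf | exact: Im_continuous].
  apply: is_derive_eps => e e0; have [d d0 Hd] := dF x xab e e0.
  exists d => // h /Hd; apply: le_trans; apply: le_trans (Im_le _).
  by case: (F (x + h)) (F x) (f x) => ? ? [? ?] [? ?] /=; rewrite mul0r addr0.
Qed.

End ComplexIntegral.

(** * Subdivision of rectangles *)

Section Goursat.
Context {R : realType}.
Implicit Types (a b c d x y t : R).

Lemma small_half_power (x d : R) : 0 < d -> exists n, x / 2 ^+ n < d.
Proof.
move=> d0; have [n nx] : exists n : nat, `|x| / d < n%:R.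
  exists (Num.bound (`|x| / d)); apply: archi_boundP.
  by rewrite divr_ge0 // ltW.
exists n; rewrite ltr_pdivrMr ?exprn_gt0 //; apply: le_lt_trans (ler_norm _) _.
move: nx; rewrite ltr_pdivrMr // => /lt_le_trans; apply.
rewrite mulrC ler_pM2l // -natrX ler_nat ltnW //; exact: ltn_expl.
Qed.

Lemma nested_intervals (a b : nat -> R) :
  (forall n, a n <= a n.+1) -> (forall n, b n.+1 <= b n) ->
  (forall n, a n <= b n) -> exists x, forall n, a n <= x <= b n.
Proof.
move=> ai bd ab.
have am n m : (n <= m)%N -> a n <= a m.
  by move=> nm; apply: (homo_leq (@lexx _ R) (@le_trans _ R) ai).
have bm n m : (n <= m)%N -> b m <= b n.
  move=> nm; apply: (homo_leq (@lexx _ (R^d)) (@le_trans _ (R^d)) _ nm).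
  by move=> k; exact: bd.
have anb n m : a n <= b m.
  apply: le_trans (am _ _ (leq_maxl n m)) _.
  by apply: le_trans (ab _) _; apply: bm; exact: leq_maxr.
exists (sup (range a)) => n; apply/andP; split.
  by apply: ub_le_sup; [exists (b 0) => _ [k _ <-] | exists n].
by apply: ge_sup; [exists (a 0), 0%N | move=> _ [k _ <-]].
Qed.

Lemma midpoint_halves a b : a < b -> [/\ a <= (a + b) / 2, (a + b) / 2 <= b,
  (a + b) / 2 - a = (b - a) / 2 & b - (a + b) / 2 = (b - a) / 2].
Proof. by move=> ab; split; lra. Qed.

(** The bisection argument behind Goursat's theorem, freed from integrals: if N
    were positive on the whole rectangle, one of the four quarters would keep at
    least a quarter of its value, and so on; the nested quarters shrink to a
    point at which N would not be of second order in the size. *)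
Lemma rect_subadditive_zero (N : R -> R -> R -> R -> R) a0 b0 c0 d0 :
  a0 < b0 -> c0 < d0 ->
  (forall a b c d, a0 <= a -> a < b -> b <= b0 -> c0 <= c -> c < d -> d <= d0 ->
    N a b c d <= N a ((a + b) / 2) c ((c + d) / 2) +
                 N ((a + b) / 2) b c ((c + d) / 2) +
                 (N a ((a + b) / 2) ((c + d) / 2) d +
                  N ((a + b) / 2) b ((c + d) / 2) d)) ->
  (forall x y e, a0 <= x <= b0 -> c0 <= y <= d0 -> 0 < e ->
    exists2 r : R, 0 < r & forall a b c d,
      a0 <= a -> a < b -> b <= b0 -> c0 <= c -> c < d -> d <= d0 ->
      a <= x <= b -> c <= y <= d -> (b - a) + (d - c) < r ->
      N a b c d <= e * ((b - a) + (d - c)) ^+ 2) ->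
  N a0 b0 c0 d0 <= 0.
Proof.
move=> ab0 cd0 sub loc; rewrite leNgt; apply/negP => N0.
pose s0 := (b0 - a0) + (d0 - c0).
have s00 : 0 < s0 by rewrite /s0; lra.
(* With this e the rectangle itself violates the local bound strictly, and one
   of the quarters of a violating rectangle violates it again. *)
pose e := N a0 b0 c0 d0 / 2 / s0 ^+ 2.
have e0 : 0 < e by rewrite !divr_gt0 // exprn_gt0.
pose T := (R * R * R * R)%type.
pose inv (q : T) := let: (a, b, c, d) := q in
  [/\ a0 <= a, a < b, b <= b0 & [/\ c0 <= c, c < d, d <= d0 &
   e * ((b - a) + (d - c)) ^+ 2 < N a b c d]].
pose nxt (q q' : T) := let: (a, b, c, d) := q in let: (a', b', c', d') := q' in
  [/\ a <= a', b' <= b, b' - a' = (b - a) / 2 &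
   [/\ c <= c', d' <= d & d' - c' = (d - c) / 2]].
have step q : exists q', inv q -> inv q' /\ nxt q q'.
  have [iq|] := pselect (inv q); last by exists q.
  move: q iq => [[[a b] c] d] [aa ab bb [cc cd dd bad]].
  set m := (a + b) / 2; set k := (c + d) / 2.
  have [am mb ma bm] := midpoint_halves ab; rewrite -/m in am mb ma bm.
  have [ck kd kc dk] := midpoint_halves cd; rewrite -/k in ck kd kc dk.
  pose E := e * (((b - a) + (d - c)) / 2) ^+ 2.
  have E4 : e * ((b - a) + (d - c)) ^+ 2 = 4 * E by rewrite /E; field.
  have good a' b' c' d' : a <= a' -> b' <= b -> b' - a' = (b - a) / 2 ->
      c <= c' -> d' <= d -> d' - c' = (d - c) / 2 -> E < N a' b' c' d' ->
      exists q', inv (a, b, c, d) -> inv q' /\ nxt (a, b, c, d) q'.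
    move=> h1 h2 h3 h4 h5 h6 h7; exists (a', b', c', d') => _; split; split=> //.
    - exact: le_trans aa h1.
    - by rewrite -subr_gt0 h3 divr_gt0 // subr_gt0.
    - exact: le_trans h2 bb.
    - split; [exact: le_trans cc h4 | | exact: le_trans h5 dd |].
        by rewrite -subr_gt0 h6 divr_gt0 // subr_gt0.
      by rewrite h3 h6 -mulrDl.
  have := sub a b c d aa ab bb cc cd dd; rewrite -/m -/k => subs.
  have [h1|h1] := ltP E (N a m c k).
    exact: (good a m c k).
  have [h2|h2] := ltP E (N m b c k).
    exact: (good m b c k).
  have [h3|h3] := ltP E (N a m k d).
    exact: (good a m k d).
  have [h4|h4] := ltP E (N m b k d).
    exact: (good m b k d).
  have E2 : E + E + (E + E) = 4 * E by ring.
  have := le_trans subs (lerD (lerD h1 h2) (lerD h3 h4)).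
  by rewrite E2 -E4 leNgt bad.
have [f Hf] := choice step.
pose s n := iter n f (a0, b0, c0, d0).
have inv0 : inv (a0, b0, c0, d0).
  split=> //; split=> //; rewrite -/s0 /e divfK ?gt_eqF ?exprn_gt0 //; lra.
have invs n : inv (s n) by elim: n => //= n /Hf[].
have nxts n : nxt (s n) (s n.+1) by have [] := Hf _ (invs n).
pose A n := (s n).1.1.1; pose B n := (s n).1.1.2.
pose C n := (s n).1.2; pose D n := (s n).2.
have sE n : s n = (A n, B n, C n, D n).
  by rewrite /A /B /C /D; case: (s n) => [[[? ?] ?] ?].
have iA n : inv (A n, B n, C n, D n) by rewrite -sE.
have nA n : nxt (A n, B n, C n, D n) (A n.+1, B n.+1, C n.+1, D n.+1).
  by rewrite -!sE.
have [x Hx] : exists x, forall n, A n <= x <= B n.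
  by apply: nested_intervals => n; [case: (nA n)|case: (nA n)|case: (iA n) => _ /ltW].
have [y Hy] : exists y, forall n, C n <= y <= D n.
  apply: nested_intervals => n.
  - by case: (nA n) => _ _ _ [].
  - by case: (nA n) => _ _ _ [].
  - by case: (iA n) => _ _ _ [_ /ltW].
have wid n : (B n - A n) + (D n - C n) = s0 / 2 ^+ n.
  elim: n => [|n IH]; first by rewrite expr0 divr1.
  have [_ _ -> [_ _ ->]] := nA n.
  by rewrite -mulrDl IH exprS invfM mulrA mulrAC.
have [r r0 Hr] := loc x y e (Hx 0%N) (Hy 0%N) e0.
have [n sn] := small_half_power s0 r0.
have [aa ab bb [cc cd dd bad]] := iA n.
move: bad; rewrite ltNge (Hr _ _ _ _ aa ab bb cc cd dd (Hx n) (Hy n)) //.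
by rewrite wid.
Qed.

End Goursat.

(** * Differentiation along curves *)

Section Curves.
Context {R : realType}.
Implicit Types (F G : R -> R[i]) (g phi : R[i] -> R[i]) (a b c d x y t : R).
Implicit Types (z w l : R[i]).

(** Turns a quadratic remainder, as Taylor estimates provide it, into a derivative. *)
Lemma hder_sq phi z l (K r : R) : 0 < r ->
  (forall w, nrm w < r -> nrm (phi (z + w) - phi z - l * w) <= K * nrm w ^+ 2) ->
  hder phi z l.
Proof.
move=> r0 H e e0.
have K0 : 0 < `|K| + 1 by rewrite ltr_wpDl.
exists (Num.min r (e / (`|K| + 1))); first by rewrite lt_min r0 divr_gt0.
move=> w; rewrite lt_min => /andP[wr we]; apply: (le_trans (H w wr)).
rewrite expr2 mulrA; apply: ler_wpM2r; first exact: nrm_ge0.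
rewrite ltr_pdivlMr // in we; apply: le_trans (ltW we).
rewrite mulrC; apply: ler_wpM2l; first exact: nrm_ge0.
by apply: (le_trans (ler_norm _)); rewrite lerDl.
Qed.

Lemma hder_continuous phi z l : hder phi z l -> {for z, continuous phi}.
Proof.
move=> H; apply/continuous_nrmP => e e0; have [d d0 Hd] := H 1 ltr01.
have L0 : 0 < 1 + nrm l by rewrite ltr_pwDl // nrm_ge0.
apply/nbhs_nrm; exists (Num.min d (e / (1 + nrm l))).
  by rewrite lt_min d0 divr_gt0.
move=> w; rewrite lt_min => /andP[wd we]; have := Hd _ wd; rewrite subrKC => H1.
rewrite ltr_pdivlMr // in we.
have := nrmD (phi w - phi z - l * (w - z)) (l * (w - z)).
rewrite subrK nrmM; nra.
Qed.

Lemma hderM phi psi z l m : hder phi z l -> hder psi z m ->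
  hder (fun w => phi w * psi w) z (l * psi z + phi z * m).
Proof.
move=> Hp Hq e e0.
pose K := 1 + nrm l + nrm m + nrm (psi z) + nrm (phi z) + nrm l * nrm m.
have nl := nrm_ge0 l; have nm := nrm_ge0 m; have np := nrm_ge0 (phi z).
have nq := nrm_ge0 (psi z).
have lm : 0 <= nrm l * nrm m by rewrite mulr_ge0.
have K0 : 0 < K by rewrite /K; lra.
have pK : nrm (psi z) <= K by rewrite /K; lra.
have fK : nrm (phi z) <= K by rewrite /K; lra.
have lmK : (nrm l + 1) * (nrm m + 1) <= 2 * K by rewrite /K; lra.
clearbody K.
pose e1 := Num.min 1 (e / (4 * K)).
have e10 : 0 < e1 by rewrite lt_min ltr01 divr_gt0 // mulr_gt0.
have e11 : e1 <= 1 by rewrite ge_min lexx.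
have e1K : 4 * K * e1 <= e.
  by rewrite mulrC -ler_pdivlMr ?mulr_gt0 // ge_min lexx orbT.
clearbody e1.
have [d1 d10 H1] := Hp e1 e10; have [d2 d20 H2] := Hq e1 e10.
exists (Num.min e1 (Num.min d1 d2)); first by rewrite !lt_min e10 d10 d20.
move=> w; rewrite !lt_min => /and3P[w1 wd1 wd2].
have {}H1 := H1 w wd1; have {}H2 := H2 w wd2.
set A := phi (z + w) - phi z - l * w in H1.
set B := psi (z + w) - psi z - m * w in H2.
have -> : phi (z + w) * psi (z + w) - phi z * psi z - (l * psi z + phi z * m) * w
  = A * psi z + phi z * B + (l * w + A) * (m * w + B) by rewrite /A /B; ring.
clearbody A B; have nw := nrm_ge0 w; have nA := nrm_ge0 A; have nB := nrm_ge0 B.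
have P1 : nrm (l * w + A) <= (nrm l + 1) * nrm w.
  by apply: (le_trans (nrmD _ _)); rewrite nrmM; nra.
have P2 : nrm (m * w + B) <= (nrm m + 1) * nrm w.
  by apply: (le_trans (nrmD _ _)); rewrite nrmM; nra.
apply: (le_trans (nrmD _ _)); rewrite nrmM.
have P3 : nrm (l * w + A) * nrm (m * w + B) <=
   (nrm l + 1) * nrm w * ((nrm m + 1) * nrm w).
  by apply: ler_pM => //; exact: nrm_ge0.
have P4 := nrmD (A * psi z) (phi z * B); rewrite !nrmM in P4.
have P5 : nrm A * nrm (psi z) <= e1 * nrm w * K.
  by apply: ler_pM.
have P6 : nrm (phi z) * nrm B <= K * (e1 * nrm w).
  by apply: ler_pM.
have P7 : (nrm l + 1) * nrm w * ((nrm m + 1) * nrm w) <= 2 * K * (e1 * nrm w).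
  have -> : (nrm l + 1) * nrm w * ((nrm m + 1) * nrm w) =
     ((nrm l + 1) * (nrm m + 1)) * (nrm w * nrm w) by ring.
  apply: ler_pM; first by rewrite mulr_ge0 // addr_ge0.
  - by rewrite mulr_ge0.
  - exact: lmK.
  - by apply: ler_wpM2r => //; exact: ltW.
have : 4 * K * e1 * nrm w <= e * nrm w by apply: ler_wpM2r.
move: P3 P4 P5 P6 P7; rewrite -mulrA (mulrAC e1) [K * (e1 * _)]mulrCA; lra.
Qed.

Lemma hder_cst k z : hder (fun=> k) z 0.
Proof.
apply: (@hder_sq _ _ _ 0 1) => // w _.
by rewrite subrr mul0r subr0 nrm0 mul0r.
Qed.

Lemma hderV z : z != 0 -> hder (fun w => w^-1) z (- (z ^- 2)).
Proof.
move=> z0; have nz := nrm_gt0 z0.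
apply: (@hder_sq _ _ _ (2 / nrm z ^+ 3) (nrm z / 2)); first by rewrite divr_gt0.
move=> w wz.
have zw : nrm z / 2 <= nrm (z + w).
  by have := nrmB (z + w) w; rewrite addrK; lra.
have zw0 : z + w != 0.
  by apply/eqP => E; move: zw; rewrite E nrm0; lra.
have -> : (z + w)^-1 - z^-1 - - z ^- 2 * w = w ^+ 2 / (z ^+ 2 * (z + w)).
  by field; rewrite z0 zw0.
rewrite nrmM nrmV nrmM !nrmX [leRHS]mulrC; apply: ler_wpM2l.
  by rewrite exprn_ge0 // nrm_ge0.
have -> : 2 / nrm z ^+ 3 = (nrm z ^+ 2 * (nrm z / 2))^-1 by field; rewrite gt_eqF.
rewrite lef_pV2 ?posrE ?mulr_gt0 ?exprn_gt0 ?(lt_le_trans _ zw) ?divr_gt0 //.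
by apply: ler_wpM2l => //; rewrite exprn_ge0 // nrm_ge0.
Qed.

Lemma eq_hder phi z l m : l = m -> hder phi z l -> hder phi z m.
Proof. by move=> ->. Qed.

Lemma hderX phi z l n : hder phi z l ->
  hder (fun w => phi w ^+ n.+1) z (n.+1%:R * phi z ^+ n * l).
Proof.
move=> H; elim: n => [|n IH].
  by rewrite expr0 !mul1r; exact: H.
rewrite (_ : (fun _ => _) = (fun w => phi w * phi w ^+ n.+1)); last first.
  by apply/funext => w; rewrite exprS.
apply: eq_hder (hderM H IH).
by rewrite [in RHS]mulrSr exprS; ring.
Qed.

Lemma rder_comp phi F x l m : hder phi (F x) l -> rder F x m ->
  rder (fun t => phi (F t)) x (l * m).
Proof.
move=> Hp HF e e0.
have nl := nrm_ge0 l; have nm := nrm_ge0 m.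
pose e2 := Num.min 1 (e / (2 * (nrm l + 1))).
pose e1 := e / (2 * (nrm m + 1)).
have L0 : 0 < 2 * (nrm l + 1) by lra.
have M0 : 0 < 2 * (nrm m + 1) by lra.
have e10 : 0 < e1 by rewrite divr_gt0.
have e20 : 0 < e2 by rewrite lt_min ltr01 divr_gt0.
have e21 : e2 <= 1 by rewrite ge_min lexx.
have e2l : e2 * (2 * (nrm l + 1)) <= e.
  by rewrite -ler_pdivlMr // ge_min lexx orbT.
have e1m : e1 * (2 * (nrm m + 1)) = e by rewrite divfK // gt_eqF.
clearbody e1 e2.
have [d1 d10 H1] := Hp e1 e10; have [d2 d20 H2] := HF e2 e20.
exists (Num.min d2 (d1 / (nrm m + 1))).
  by rewrite lt_min d20 divr_gt0 //; lra.
move=> h; rewrite lt_min => /andP[hd2 hd1].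
have {}H2 := H2 h hd2; rewrite ltr_pdivlMr in hd1; last by lra.
pose k := F (x + h) - F x.
have nh : 0 <= `|h| by [].
have nk : nrm k <= (nrm m + 1) * `|h|.
  have := nrmD (k - h%:C * m) (h%:C * m); rewrite subrK nrmM nrm_real => /le_trans; apply.
  by apply: (le_trans (lerD H2 (lexx _))); nra.
have {H1} := H1 k; rewrite /k subrKC -/k => H1.
have {H1} : nrm (phi (F (x + h)) - phi (F x) - l * k) <= e1 * nrm k.
  by apply: H1; lra.
move=> H1.
have -> : phi (F (x + h)) - phi (F x) - h%:C * (l * m) =
  (phi (F (x + h)) - phi (F x) - l * k) + l * (k - h%:C * m) by ring.
apply: (le_trans (nrmD _ _)); rewrite nrmM.
have : nrm l * nrm (k - h%:C * m) <= nrm l * (e2 * `|h|) by apply: ler_wpM2l.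
have : e1 * nrm k <= e1 * ((nrm m + 1) * `|h|) by apply: ler_wpM2l => //; exact: ltW.
have : e2 * (2 * (nrm l + 1)) * `|h| <= e * `|h| by apply: ler_wpM2r.
have : e1 * (2 * (nrm m + 1)) * `|h| = e * `|h| by rewrite e1m.
have : 0 <= e2 * `|h| by rewrite mulr_ge0 // ltW.
lra.
Qed.

Let is_derive_epsW (f : R -> R) (x m : R) : is_derive x 1 f m -> forall e : R, 0 < e ->
    exists2 d : R, 0 < d & forall h, `|h| < d -> `|f (x + h) - f x - h * m| <= e * `|h|.
Proof.
  move=> [df <-] e e0. move/derivable1_diffP : df => df. 
  have /eqaddoP/(_ e e0)/nbhs_ballP[d /= d0 H] := diff_locally df.
  exists d => // h hd; have := H h; rewrite /ball /= sub0r normrN => /(_ hd).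
  rewrite !fctE /= /cst /shift /= opprD addrA (addrC h) deriveE //. 
  by rewrite -{2}[h]mulr1 (_ : h * 1 = h *: 1) // linearZ.
Qed.

Lemma rder_ReIm F x l :
  is_derive x 1 (fun t => complex.Re (F t)) (complex.Re l) ->
  is_derive x 1 (fun t => complex.Im (F t)) (complex.Im l) -> rder F x l.
Proof.
move=> /is_derive_epsW HR /is_derive_epsW HI e e0; have e20 : 0 < e / 2 by lra.
have [d1 d10 H1] := HR _ e20; have [d2 d20 H2] := HI _ e20.
exists (Num.min d1 d2); first by rewrite lt_min d10.
move=> h; rewrite lt_min => /andP[/H1 {}H1 /H2 {}H2].
apply: (le_trans (nrm_ReIm _)).
move: H1 H2 {HR HI}; case: (F (x + h)) (F x) l => [p q] [r s] [u v] /=.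
rewrite !mul0r subr0 addr0; lra.
Qed.

(** The exponential of i t. *)
Definition expi (t : R) : R[i] := cos t +i* sin t.

(** The imaginary unit as an explicit complex number, so that real and imaginary
    parts compute. *)
Definition ci : R[i] := Complex 0 1.

Lemma rder_expi x : rder expi x (ci * expi x).
Proof.
apply: rder_ReIm; rewrite /= !(mul0r, mul1r, sub0r, add0r).
  exact: is_derive_cos.
exact: is_derive_sin.
Qed.

Lemma nrm_expi x : nrm (expi x) = 1.
Proof. by rewrite /nrm normc_def /= cos2Dsin2 sqrtr1. Qed.

Lemma expi_period x : expi (x + 2 * pi) = expi x.
Proof.
by rewrite /expi mulr_natl mulr2n addrA !cosDpi !sinDpi !opprK.
Qed.

Lemma rder_continuous F x l : rder F x l -> {for x, continuous F}.
Proof.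
move=> H; apply/continuous_nrmP => e e0; have [d d0 Hd] := H 1 ltr01.
have L0 : 0 < 1 + nrm l by rewrite ltr_pwDl // nrm_ge0.
apply/nbhs_ballP; exists (Num.min d (e / (1 + nrm l))) => /=.
  by rewrite lt_min d0 divr_gt0.
move=> y; rewrite /ball /= distrC lt_min => /andP[yd ye].
have := Hd _ yd; rewrite subrKC => H1.
rewrite ltr_pdivlMr // in ye.
have := nrmD (F y - F x - (y - x)%:C * l) ((y - x)%:C * l).
by rewrite subrK nrmM nrm_real; nra.
Qed.

End Curves.

(** * Goursat's theorem *)

Section PulledBackGoursat.
Context {R : realType}.
Implicit Types (g A G : R[i] -> R[i]) (a b c d x y t : R).
Variables (z0 : R[i]) (u u' : R -> R[i]) (U : R).
Hypothesis u_der : forall x, rder u x (u' x).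
Hypothesis u'_cont : continuous u'.
Hypothesis U0 : 0 < U.
Hypothesis uU : forall x, nrm (u x) <= U.
Hypothesis u'U : forall x, nrm (u' x) <= U.

(** The cone over the closed curve z0 + u with apex z0. Integrating g dz over the
    images of rectangles in the (t, x) plane, instead of over rectangles in C,
    gives the independence of the radius directly for circles that need not be
    centred at z0. *)
Let Phi (t x : R) : R[i] := z0 + t%:C * u x.

Let hside g t c d := cint (fun x => g (Phi t x) * (t%:C * u' x)) c d.
Let vside g x a b := cint (fun t => g (Phi t x) * u x) a b.
(** The integral of g dz over the image under Phi of the boundary of a rectangle. *)
Let J g a b c d := hside g b c d - hside g a c d - (vside g d a b - vside g c a b).

Let cont_on g a b c d := forall t x, a <= t <= b -> c <= x <= d ->
  {for Phi t x, continuous g}.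

Let Phi_dert t x : rder (fun s => Phi s x) t (u x).
Proof.
move=> e e0; exists 1 => // h _.
have -> : Phi (t + h) x - Phi t x - h%:C * u x = 0.
  by rewrite /Phi rmorphD /=; ring.
by rewrite nrm0 mulr_ge0 // ltW.
Qed.

Let Phi_derx t x : rder (Phi t) x (t%:C * u' x).
Proof.
apply: (@rder_comp R (fun w => z0 + t%:C * w) u) => //.
apply: (@hder_sq _ _ _ _ 0 1) => // w _.
have -> : z0 + t%:C * (u x + w) - (z0 + t%:C * u x) - t%:C * w = 0 by ring.
by rewrite nrm0 mul0r.
Qed.

Let cont_h g a b c d t : cont_on g a b c d -> a <= t <= b ->
  ccont (fun x => g (Phi t x) * (t%:C * u' x)) c d.
Proof.
move=> gc tab; apply: (@ccontM R (fun x => g (Phi t x)) (fun x => t%:C * u' x)).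
  move=> x xcd; apply: (@continuous_comp _ _ _ (Phi t) g); last exact: gc.
  exact: rder_continuous (Phi_derx t x).
by apply: (@ccontZ R t%:C u') => x _; exact: u'_cont.
Qed.

Let cont_v g a b c d x : cont_on g a b c d -> c <= x <= d ->
  ccont (fun t => g (Phi t x) * u x) a b.
Proof.
move=> gc xcd; apply: (@ccontM R (fun t => g (Phi t x)) (fun=> u x)).
  move=> t tab; apply: (@continuous_comp _ _ _ (fun t => Phi t x) g); last exact: gc.
  exact: rder_continuous (Phi_dert t x).
exact: ccont_cst.
Qed.

Let cont_onS g a b c d a' b' c' d' : a <= a' -> b' <= b -> c <= c' -> d' <= d ->
  cont_on g a b c d -> cont_on g a' b' c' d'.
Proof.
move=> aa bb cc dd H t x /andP[at1 tb] /andP[cx xd]; apply: H.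
  by rewrite (le_trans aa at1) (le_trans tb bb).
by rewrite (le_trans cc cx) (le_trans xd dd).
Qed.

Let J_splitv g a m b c d : a <= m -> m <= b -> c <= d -> cont_on g a b c d ->
  J g a b c d = J g a m c d + J g m b c d.
Proof.
move=> am mb cd gc; rewrite /J /vside.
rewrite (cint_split am mb (cont_v (x := d) gc _)) ?lexx ?cd //.
rewrite (cint_split am mb (cont_v (x := c) gc _)) ?lexx ?cd //.
move: (cint _ a m) (cint _ m b) (cint _ a m) (cint _ m b) (hside _ _ _ _) (hside _ _ _ _) (hside _ _ _ _).
by move=> x1 x2 x3 x4 x5 x6 x7; ring.
Qed.

Let J_splith g a b c m d : a <= b -> c <= m -> m <= d -> cont_on g a b c d ->
  J g a b c d = J g a b c m + J g a b m d.
Proof.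
move=> ab cm md gc; rewrite /J /hside.
rewrite (cint_split cm md (cont_h (t := b) gc _)) ?lexx ?ab //.
rewrite (cint_split cm md (cont_h (t := a) gc _)) ?lexx ?ab //.
move: (cint _ c m) (cint _ m d) (cint _ c m) (cint _ m d) (vside _ _ _ _) (vside _ _ _ _) (vside _ _ _ _).
by move=> x1 x2 x3 x4 x5 x6 x7; ring.
Qed.

Let J_sub g A a b c d : a <= b -> c <= d -> cont_on g a b c d ->
  cont_on A a b c d ->
  J (fun z => g z - A z) a b c d = J g a b c d - J A a b c d.
Proof.
move=> ab cd gc Ac; rewrite /J.
have Hh t : a <= t <= b ->
    hside (fun z => g z - A z) t c d = hside g t c d - hside A t c d.
  move=> tab; rewrite /hside -(cintB (cont_h gc tab) (cont_h Ac tab)).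
  by apply: eq_cint => x _; rewrite (mulrBl _ (g (Phi t x))).
have Hv x : c <= x <= d ->
    vside (fun z => g z - A z) x a b = vside g x a b - vside A x a b.
  move=> xcd; rewrite /vside -(cintB (cont_v gc xcd) (cont_v Ac xcd)).
  by apply: eq_cint => t _; rewrite (mulrBl _ (g (Phi t x))).
rewrite !Hh ?Hv ?lexx ?ab ?cd // {Hh Hv}.
move: (hside _ _ _ _) (hside _ _ _ _) (hside _ _ _ _) (hside _ _ _ _).
move: (vside _ _ _ _) (vside _ _ _ _) (vside _ _ _ _) (vside _ _ _ _).
by move=> x1 x2 x3 x4 x5 x6 x7 x8; ring.
Qed.

(** If A = G' then g dz has a primitive on each of the four sides, and the four
    differences of values of G cancel. *)
Let J_primitive A G a b c d : a < b -> c < d -> cont_on A a b c d ->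
  (forall t x, a <= t <= b -> c <= x <= d -> hder G (Phi t x) (A (Phi t x))) ->
  J A a b c d = 0.
Proof.
move=> ab cd Ac HG; rewrite /J.
have Hh t : a <= t <= b -> hside A t c d = G (Phi t d) - G (Phi t c).
  move=> tab; rewrite /hside.
  apply: (@cint_FTC R (fun x => G (Phi t x)) _ c d cd (cont_h Ac tab)) => x xcd.
  exact: (rder_comp (HG t x tab xcd) (Phi_derx t x)).
have Hv x : c <= x <= d -> vside A x a b = G (Phi b x) - G (Phi a x).
  move=> xcd; rewrite /vside.
  apply: (@cint_FTC R (fun t => G (Phi t x)) _ a b ab (cont_v Ac xcd)) => t tab.
  exact: (@rder_comp R G (fun s => Phi s x) t _ _ (HG t x tab xcd) (Phi_dert t x)).
by rewrite !Hh ?Hv ?lexx ?(ltW ab) ?(ltW cd) //; ring.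
Qed.

Let J_bound g a b c d M : 0 <= a -> a <= b -> b <= 1 -> c <= d ->
  cont_on g a b c d -> 0 <= M ->
  (forall t x, a <= t <= b -> c <= x <= d -> nrm (g (Phi t x)) <= M) ->
  nrm (J g a b c d) <= 4 * M * U * ((b - a) + (d - c)).
Proof.
move=> a0 ab b1 cd gc M0 gM.
have MU : 0 <= M * U by rewrite mulr_ge0 // ltW.
have Hh t : a <= t <= b -> nrm (hside g t c d) <= 2 * (M * U) * (d - c).
  move=> tab; apply: cint_bound cd (cont_h gc tab) _ => x xcd.
  rewrite !nrmM nrm_real; apply: ler_pM => //; do ?exact: nrm_ge0.
  - by rewrite mulr_ge0 // nrm_ge0.
  - exact: gM.
  - have t0 : 0 <= t by lra.
    rewrite ger0_norm //; have := nrm_ge0 (u' x); have := u'U x; nra.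
have Hv x : c <= x <= d -> nrm (vside g x a b) <= 2 * (M * U) * (b - a).
  move=> xcd; apply: cint_bound ab (cont_v gc xcd) _ => t tab.
  by rewrite nrmM; apply: ler_pM => //; [exact: nrm_ge0 | exact: nrm_ge0 | exact: gM].
rewrite /J; apply: (le_trans (nrmB _ _)).
apply: (le_trans (lerD (nrmB _ _) (nrmB _ _))).
have -> : 4 * M * U * ((b - a) + (d - c)) =
  (2 * (M * U) * (d - c) + 2 * (M * U) * (d - c)) +
  (2 * (M * U) * (b - a) + 2 * (M * U) * (b - a)) by ring.
have ha : a <= a <= b by rewrite lexx ab.
have hb : a <= b <= b by rewrite lexx ab.
have hc : c <= c <= d by rewrite lexx cd.
have hd : c <= d <= d by rewrite lexx cd.
exact: (lerD (lerD (Hh b hb) (Hh a ha)) (lerD (Hv d hd) (Hv c hc))).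
Qed.

(** By the mean value inequality, in the form of an integral of u'. *)
Let u_lip x y : x <= y -> nrm (u y - u x) <= 2 * U * (y - x).
Proof.
rewrite le_eqVlt => /predU1P[->|xy]; first by rewrite !subrr nrm0 mulr0.
have cu' : ccont u' x y by move=> ? _; exact: u'_cont.
rewrite -(cint_FTC xy cu' (fun t _ => u_der t)).
by apply: cint_bound (ltW xy) cu' _.
Qed.

(** The diameter of the image of a rectangle is of the order of its size. *)
Let cone_dist a b c d t x t0 x0 : 0 <= a -> b <= 1 -> a <= t <= b -> a <= t0 <= b ->
  c <= x <= d -> c <= x0 <= d ->
  nrm (Phi t x - Phi t0 x0) <= 2 * U * ((b - a) + (d - c)).
Proof.
move=> a0 b1 tab t0ab xcd x0cd; have U0' := U0.
have -> : Phi t x - Phi t0 x0 = t%:C * (u x - u x0) + (t - t0)%:C * u x0.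
  by rewrite /Phi rmorphB /=; ring.
apply: (le_trans (nrmD _ _)); rewrite !nrmM !nrm_real.
have H1 : `|t| <= 1 by rewrite ger0_norm; lra.
have H2 : nrm (u x - u x0) <= 2 * U * (d - c).
  have [xx|/ltW xx] := leP x x0; [rewrite nrmC|]; apply: (le_trans (u_lip xx));
    by apply: ler_wpM2l; [rewrite mulr_ge0 // ltW | lra].
have H3 : `|t - t0| <= b - a by rewrite ler_norml; apply/andP; split; lra.
have H4 : `|t| * nrm (u x - u x0) <= 1 * (2 * U * (d - c)).
  by apply: ler_pM => //; exact: nrm_ge0.
have H5 : `|t - t0| * nrm (u x0) <= (b - a) * U.
  by apply: ler_pM => //; exact: nrm_ge0.
have H6 : 0 <= (b - a) * U by rewrite mulr_ge0 ?(ltW U0) //; lra.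
by rewrite mulrDr; lra.
Qed.

(** Near any point g is an affine function up to an error of first order; affine
    functions have primitives, so that the integral over a small rectangle is of
    second order in its size, with a small constant. Subdivision does the rest
    ([rect_subadditive_zero]). *)
Theorem goursat g a b c d : 0 <= a -> a < b -> b <= 1 -> c < d ->
  (forall t x, a <= t <= b -> c <= x <= d -> exists l, hder g (Phi t x) l) ->
  hside g b c d - hside g a c d = vside g d a b - vside g c a b.
Proof.
move=> a0 ab b1 cd gder.
have gc : cont_on g a b c d.
  by move=> t x /gder + /[dup] => /[apply] -[l /hder_continuous].
suff : nrm (J g a b c d) <= 0.
  by move=> /nrm_le0 /eqP; rewrite subr_eq0 => /eqP.
apply: (@rect_subadditive_zero R (fun a b c d => nrm (J g a b c d))) => //.
  move=> a1 b1' c1 d1 aa ab1 bb cc cd1 dd.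
  have gc1 : cont_on g a1 b1' c1 d1 by apply: cont_onS gc.
  set m := (a1 + b1') / 2; set k := (c1 + d1) / 2.
  have am : a1 <= m by rewrite /m; lra.
  have mb : m <= b1' by rewrite /m; lra.
  have ck : c1 <= k by rewrite /k; lra.
  have kd : k <= d1 by rewrite /k; lra.
  rewrite (J_splith (ltW ab1) ck kd gc1).
  rewrite (J_splitv am mb ck (cont_onS _ _ _ _ gc1)) //.
  rewrite (J_splitv am mb kd (cont_onS _ _ _ _ gc1)) //.
  by apply: (le_trans (nrmD _ _)); apply: lerD; exact: nrmD.
move=> t0 x0 e t0ab x0cd e0.
have [l gl] := gder _ _ t0ab x0cd.
(* 8 U^2 is the product of the constants of J_bound and of the diameter bound. *)
have K0 : 0 < 8 * U ^+ 2 by rewrite mulr_gt0 // exprn_gt0.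
have [r r0 Hr] := gl (e / (8 * U ^+ 2)) (divr_gt0 e0 K0).
have [U2 U2r] : exists2 q, 0 < q & 2 * U * q = r.
  by exists (r / (2 * U)); [rewrite divr_gt0 // mulr_gt0 | rewrite mulrC divfK // gt_eqF // mulr_gt0].
move=> rE; exists U2 => // a1 b1' c1 d1 aa ab1 bb cc cd1 dd t0ab1 x0cd1 small.
have gc1 : cont_on g a1 b1' c1 d1 by apply: cont_onS gc.
pose z1 := Phi t0 x0.
(* The affine approximation of g at z1 and its primitive. *)
pose A z := g z1 + l * (z - z1).
pose G z := g z1 * z + l * ((z - z1) ^+ 2 / 2).
have HG z : hder G z (A z).
  apply: (@hder_sq _ _ _ _ (nrm (l / 2)) 1) => // w _.
  have -> : G (z + w) - G z - A z * w = l / 2 * w ^+ 2 by rewrite /G /A; field.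
  by rewrite nrmM nrmX.
have Ac : cont_on A a1 b1' c1 d1.
  move=> t x _ _; apply: (@hder_continuous _ _ _ l).
  apply: (@hder_sq _ _ _ _ 0 1) => // w _.
  have -> : A (Phi t x + w) - A (Phi t x) - l * w = 0 by rewrite /A; ring.
  by rewrite nrm0 mul0r.
have s0 : 0 <= (b1' - a1) + (d1 - c1) by lra.
have dist t x : a1 <= t <= b1' -> c1 <= x <= d1 ->
    nrm (Phi t x - z1) <= 2 * U * ((b1' - a1) + (d1 - c1)).
  move=> tab xcd; apply: cone_dist tab t0ab1 xcd x0cd1; first exact: le_trans aa.
  exact: le_trans bb b1.
have JE : J g a1 b1' c1 d1 = J (fun z => g z - A z) a1 b1' c1 d1.
  rewrite (J_sub (ltW ab1) (ltW cd1) gc1 Ac).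
  by rewrite (J_primitive ab1 cd1 Ac (fun t x _ _ => HG _)) subr0.
rewrite JE.
have gAc : cont_on (fun z => g z - A z) a1 b1' c1 d1.
  move=> t x tab xcd; apply: (@continuousB _ R[i] R[i] g A); [exact: gc1 | exact: Ac].
pose M := e / (8 * U ^+ 2) * (2 * U * ((b1' - a1) + (d1 - c1))).
have M0 : 0 <= M by rewrite !mulr_ge0 // ?invr_ge0 ?ltW.
have b11 : b1' <= 1 by exact: le_trans bb b1.
have a10 : 0 <= a1 by exact: le_trans a0 aa.
apply: le_trans (J_bound a10 (ltW ab1) b11 (ltW cd1) gAc M0 _) _.
  move=> t x tab xcd; have D := dist t x tab xcd.
  have := Hr (Phi t x - z1); rewrite subrKC => H.
  rewrite /A opprD addrA; apply: le_trans (H _) _.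
    by apply: (le_lt_trans D); rewrite -rE ltr_pM2l // mulr_gt0.
  by apply: ler_wpM2l => //; rewrite ltW // divr_gt0.
rewrite /M; rewrite le_eqVlt; apply/orP; left; apply/eqP; field.
by rewrite gt_eqF.
Qed.

End PulledBackGoursat.

(** * Cauchy's formula on a circle *)

Section CauchyFormula.
Context {R : realType}.
Implicit Types (phi psi : R[i] -> R[i]) (z w : R[i]) (r t x s a b : R).

Lemma expi_periodic : exists T : R, 0 < T /\ forall x, expi (x + T) = expi x.
Proof.
exists (2 * pi); split; first by rewrite mulr_gt0 // pi_gt0.
exact: expi_period.
Qed.

(** The period 2 pi of the circle, sealed behind its defining property so that
    conversion never unfolds the construction of pi. *)
Definition per : R := projT1 (cid expi_periodic).

Lemma per_gt0 : 0 < per.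
Proof. by rewrite /per; case: cid => T []. Qed.

Lemma expi_per x : expi (x + per) = expi x.
Proof. by rewrite /per; case: cid => T []. Qed.

Lemma cint0 a b : cint (fun=> 0 : R[i]) a b = 0.
Proof. by rewrite /cint /= !Rintegral_cst // !mul0r. Qed.

Definition circ r t : R[i] := r%:C * expi t.

Lemma rder_circ r t : rder (circ r) t (ci * circ r t).
Proof.
have H : hder (fun w => r%:C * w) (expi t) r%:C.
  apply: (@hder_sq _ _ _ _ 0 1) => // w _.
  have -> : r%:C * (expi t + w) - r%:C * expi t - r%:C * w = 0 by ring.
  by rewrite nrm0 mul0r.
have := rder_comp H (rder_expi t).
by rewrite (_ : r%:C * (ci * expi t) = ci * circ r t) // /circ; ring.
Qed.

Lemma circ_continuous r : continuous (circ r).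
Proof. by move=> t; exact: rder_continuous (rder_circ r t). Qed.

Lemma nrm_circ r t : 0 < r -> nrm (circ r t) = r.
Proof. by move=> r0; rewrite nrmM nrm_expi mulr1 nrm_real gtr0_norm. Qed.

Lemma circ_neq0 r t : 0 < r -> circ r t != 0.
Proof. by move=> r0; apply/eqP => E; have := nrm_circ t r0; rewrite E nrm0; lra. Qed.


Lemma nrm_i : nrm (ci : R[i]) = 1.
Proof. by rewrite -[ci]mul1r nrmI nrm1. Qed.

Lemma circ_period r : circ r per = circ r 0.
Proof. by rewrite /circ -(expi_per 0) add0r. Qed.

Section Formula.
Variables (r : R) (phi : R[i] -> R[i]).
Hypothesis r0 : 0 < r.
Hypothesis phi_hol : forall z, nrm z <= r -> exists l, hder phi z l.

Section Kernel.
Variable z0 : R[i].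
Hypothesis z0r : nrm z0 < r.

Let u t : R[i] := circ r t - z0.
Let k t : R[i] := ci * circ r t / u t.
Let K s t : R[i] := phi (z0 + s%:C * u t) * k t.

Let u_neq0 t : u t != 0.
Proof.
rewrite subr_eq0; apply/eqP => E; have := nrm_circ t r0;
  by rewrite E => H; move: z0r; rewrite H ltxx.
Qed.

Let u_der t : rder u t (ci * circ r t).
Proof.
have H : hder (fun w => w - z0) (circ r t) 1.
  apply: (@hder_sq _ _ _ _ 0 1) => // w _.
  have -> : circ r t + w - z0 - (circ r t - z0) - 1 * w = 0 by ring.
  by rewrite nrm0 mul0r.
by have := rder_comp H (rder_circ r t); rewrite mul1r.
Qed.

Let icirc_cont : continuous (fun t => ci * circ r t).
Proof.
move=> t; apply: (@continuousM R[i] R (fun=> ci) (circ r)).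
  exact: cvg_cst.
exact: circ_continuous.
Qed.

Let u_cont t : {for t, continuous u}.
Proof. exact: rder_continuous (u_der t). Qed.

Let Phi_le s t : 0 <= s -> s <= 1 -> nrm (z0 + s%:C * u t) <= r.
Proof.
move=> s0 s1; have -> : z0 + s%:C * u t = (1 - s)%:C * z0 + s%:C * circ r t.
  by rewrite /u rmorphB rmorph1; ring.
have s1' : 0 <= 1 - s by lra.
apply: (le_trans (nrmD _ _)); rewrite !nrmM !nrm_real nrm_expi mulr1 (gtr0_norm r0).
rewrite (ger0_norm s1') (ger0_norm s0).
have : 0 <= (1 - s) * (r - nrm z0) by rewrite mulr_ge0 // subr_ge0 ltW.
by rewrite mulrBr mulrBl mul1r; lra.
Qed.

Let k_cont a b : ccont k a b.
Proof.
apply: (@ccontM R (fun t => ci * circ r t) (fun t => (u t)^-1)).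
  by move=> t _; exact: icirc_cont.
by apply: ccontV => t _; [exact: u_neq0 | exact: u_cont].
Qed.

Let K_cont s a b : 0 <= s -> s <= 1 -> ccont (K s) a b.
Proof.
move=> s0 s1; apply: (@ccontM R (fun t => phi (z0 + s%:C * u t)) k); last exact: k_cont.
move=> t _; apply: (@continuous_comp _ _ _ (fun t => z0 + s%:C * u t) phi).
  apply: (@continuousD _ R[i] R (fun=> z0) (fun t => s%:C * u t)).
    exact: cvg_cst.
  apply: (@continuousM R[i] R (fun=> s%:C) u); first exact: cvg_cst.
  exact: u_cont.
by have [l /hder_continuous] := phi_hol (Phi_le t s0 s1).
Qed.

(** Goursat's theorem on the part a <= s <= 1 of the cone with apex
    z0: its two straight sides coincide because the circle is closed. *)
Let K_const a : 0 < a -> a < 1 -> cint (K 1) 0 per = cint (K a) 0 per.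
Proof.
move=> a0 a1; have [r0' z0r'] := (r0, z0r).
pose g w : R[i] := phi w * (w - z0)^-1.
have uU t : nrm (u t) <= 2 * r.
  by apply: (le_trans (nrmB _ _)); rewrite nrm_circ //; lra.
have u'U t : nrm (ci * circ r t) <= 2 * r.
  by rewrite nrmM nrm_i mul1r nrm_circ //; lra.
have U0 : 0 < 2 * r by lra.
have gder s t : a <= s <= 1 -> 0 <= t <= per ->
    exists l, hder g (z0 + s%:C * u t) l.
  move=> /andP[as1 s1] _.
  have [l Hl] := phi_hol (Phi_le t (le_trans (ltW a0) as1) s1).
  have su : z0 + s%:C * u t - z0 != 0.
    rewrite addrC addKr mulf_neq0 ?u_neq0 //.
    by rewrite (fmorph_eq0 (real_complex R)) gt_eqF // (lt_le_trans a0).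
  exists (l * (z0 + s%:C * u t - z0)^-1 +
    phi (z0 + s%:C * u t) * - (z0 + s%:C * u t - z0) ^- 2).
  apply: (@hderM R phi (fun w => (w - z0)^-1)); first exact: Hl.
  have H2 := hderV su.
  move=> e e0; have [d d0 Hd] := H2 e e0; exists d => // w /Hd.
  have -> : z0 + s%:C * u t + w - z0 = z0 + s%:C * u t - z0 + w by ring.
  by [].
have := goursat u_der icirc_cont U0 uU u'U (ltW a0) a1 (lexx 1) per_gt0 gder.
have -> : u per = u 0 by rewrite /u circ_period.
rewrite subrr => /eqP; rewrite subr_eq0 => /eqP E.
have EK s : 0 < s -> cint (K s) 0 per =
    cint (fun t => g (z0 + s%:C * u t) * (s%:C * (ci * circ r t))) 0 per.
  move=> s0; apply: eq_cint => t _; rewrite /K /g /k.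
  have su : s%:C != 0 :> R[i] by rewrite (fmorph_eq0 (real_complex R)) gt_eqF.
  have -> : z0 + s%:C * u t - z0 = s%:C * u t by ring.
  by move: (phi _) => F; field; rewrite u_neq0 su.
by rewrite !EK.
Qed.

(** By [K_const] the circle can be contracted towards z0, where phi is nearly
    constant. The integral on the right is evaluated later, from the special case
    of constant functions in [circ_kernel_integral]. *)
Lemma cauchy_kernel :
  cint (fun t => phi (circ r t) * (ci * circ r t / (circ r t - z0))) 0 per =
  phi z0 * cint (fun t => ci * circ r t / (circ r t - z0)) 0 per.
Proof.
have -> : cint (fun t => phi (circ r t) * (ci * circ r t / (circ r t - z0))) 0 per
    = cint (K 1) 0 per.
  by apply: eq_cint => t _; rewrite /K /u rmorph1 mul1r subrKC.
have -> : cint (fun t => ci * circ r t / (circ r t - z0)) 0 per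
    = cint k 0 per by [].
apply/eqP; rewrite -subr_eq0; apply/eqP/nrm_le0.
have [r0' z0r'] := (r0, z0r).
pose d0 := r - nrm z0; have d00 : 0 < d0 by rewrite /d0; lra.
have kM t : nrm (k t) <= r / d0.
  rewrite /k nrmM nrmM nrmV nrm_i mul1r nrm_circ //.
  apply: ler_wpM2l; first exact: ltW.
  have ud : d0 <= nrm (u t).
    by have := nrmD (u t) z0; rewrite /u subrK nrm_circ // /d0; lra.
  by rewrite lef_pV2 ?posrE // (lt_le_trans d00).
apply: (@le_eps R _ (2 * (r / d0) * per)) => e e0.
have [l /hder_continuous/continuous_nrmP/(_ e e0)/nbhs_nrm[d dp Hd]] := phi_hol (ltW z0r).
(* The contracted circle lies in the disc of radius d about z0, since |u t| <= 2 r. *)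
pose a := Num.min (1/2) (d / (4 * r)).
have a0 : 0 < a by rewrite lt_min !divr_gt0 // ?mulr_gt0.
have a1 : a < 1 by apply: (@le_lt_trans _ _ (1/2)); [rewrite ge_min lexx | lra].
have ad : a * (4 * r) <= d by rewrite -ler_pdivlMr ?mulr_gt0 // ge_min lexx orbT.
rewrite (K_const a0 a1) -(cintZ _ (@k_cont 0 per)).
have ck : ccont (fun t => phi z0 * k t) 0 per by apply: ccontZ; exact: k_cont.
rewrite -(cintB (@K_cont a 0 per (ltW a0) (ltW a1)) ck).
have -> : e * (2 * (r / d0) * per) = 2 * (e * (r / d0)) * (per - 0) by ring.
apply: (cint_bound (ltW per_gt0)
  (ccontB (@K_cont a 0 per (ltW a0) (ltW a1)) ck)) => t _.
 rewrite /K -mulrBl nrmM; apply: ler_pM => //; do ?exact: nrm_ge0.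
apply/ltW/Hd; rewrite addrC addKr nrmM nrm_real gtr0_norm //.
have : nrm (u t) <= 2 * r.
  by apply: (le_trans (nrmB _ _)); rewrite nrm_circ //; lra.
move=> ut; apply: (@lt_le_trans _ _ (a * (4 * r))) => //.
by rewrite ltr_pM2l //; lra.
Qed.

End Kernel.
End Formula.

(** The n-th Taylor coefficient at 0 as a Cauchy integral over the circle of
    radius r. *)
Definition cc phi r n : R[i] := (per^-1)%:C *
  cint (fun t => phi (circ r t) * (circ r t)^-1 ^+ n) 0 per.

Lemma circV_cont r n a b : 0 < r -> ccont (fun t => (circ r t)^-1 ^+ n) a b.
Proof.
move=> r0; apply: (@ccontX R (fun t => (circ r t)^-1)); apply: ccontV.
  by move=> t _; exact: circ_neq0.
by move=> t _; exact: circ_continuous.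
Qed.

Lemma hol_circ_cont r phi a b : 0 < r ->
  (forall z, nrm z <= r -> exists l, hder phi z l) ->
  ccont (fun t => phi (circ r t)) a b.
Proof.
move=> r0 phol t _; apply: (@continuous_comp _ _ _ (circ r) phi).
  exact: circ_continuous.
have [|l /hder_continuous] // := phol (circ r t).
by rewrite nrm_circ.
Qed.

Lemma cc_bound r phi n M : 0 < r -> ccont (fun t => phi (circ r t)) 0 per ->
  (forall t, 0 <= t <= per -> nrm (phi (circ r t)) <= M) ->
  nrm (cc phi r n) <= 2 * M / r ^+ n.
Proof.
move=> r0 cphi pM; rewrite /cc nrmM nrm_real gtr0_norm ?invr_gt0 ?per_gt0 //.
have c1 := ccontM cphi (@circV_cont r n 0 per r0).
have := cint_bound (M := M / r ^+ n) (ltW per_gt0) c1.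
rewrite subr0 => H; rewrite mulrC ler_pdivrMr ?per_gt0 //.
rewrite -[leRHS](_ : 2 * (M / r ^+ n) * per = _); last by ring.
apply: H => t tI; rewrite nrmM nrmX nrmV nrm_circ // exprVn.
apply: ler_wpM2r; last exact: pM.
by rewrite invr_ge0 exprn_ge0 // ltW.
Qed.

(** The geometric expansion of 1 / (w - z0) for |w| = r > |z0|, integrated term by
    term with its remainder. *)
Lemma kernel_series r z0 phi M N : 0 < r -> nrm z0 < r ->
  ccont (fun t => phi (circ r t)) 0 per ->
  (forall t, 0 <= t <= per -> nrm (phi (circ r t)) <= M) ->
  nrm (cint (fun t => phi (circ r t) * (ci * circ r t / (circ r t - z0))) 0 per
   - per%:C * ci * \sum_(n < N) cc phi r n * z0 ^+ n) <=
  per * (2 * M * (nrm z0 / r) ^+ N * (1 - nrm z0 / r)^-1).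
Proof.
move=> r0 z0r cphi pM.
have rho1 : nrm z0 / r < 1 by rewrite ltr_pdivrMr // mul1r.
have M0 : 0 <= M.
  by apply: le_trans (nrm_ge0 _) (pM 0 _); rewrite lexx (ltW per_gt0).
pose rem t := phi (circ r t) * (circ r t)^-1 ^+ N * ((ci * z0 ^+ N) * circ r t / (circ r t - z0)).
have u0 t : circ r t - z0 != 0.
  by rewrite subr_eq0; apply/eqP => E; have := nrm_circ t r0;
  by rewrite E => H; move: z0r; rewrite H ltxx.
have cker c : ccont (fun t => c * circ r t / (circ r t - z0)) 0 per.
  apply: (@ccontM R (fun t => c * circ r t) (fun t => (circ r t - z0)^-1)).
    by apply: (@ccontZ R _ (circ r)) => t _; exact: circ_continuous.
  apply: ccontV => [t _|]; first exact: u0.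
  apply: (@ccontB R (circ r) (fun=> z0)) => [t _|]; first exact: circ_continuous.
  exact: ccont_cst.
have crem : ccont rem 0 per.
  exact: (ccontM (ccontM cphi (@circV_cont r N 0 per r0)) (cker (ci * z0 ^+ N))).
have E : cint (fun t => phi (circ r t) * (ci * circ r t / (circ r t - z0))) 0 per
   - per%:C * ci * \sum_(n < N) cc phi r n * z0 ^+ n = cint rem 0 per.
  have ct n : ccont (fun t => phi (circ r t) * (circ r t)^-1 ^+ n) 0 per.
    exact: ccontM cphi (@circV_cont r n 0 per r0).
  have pi0 : per%:C != 0 :> R[i].
    by rewrite (fmorph_eq0 (real_complex R)) gt_eqF ?per_gt0.
  pose Sf m t : R[i] := \sum_(n < m) ci * z0 ^+ n *
      (phi (circ r t) * (circ r t)^-1 ^+ n).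
  have Sf0 : Sf 0%N = fun=> 0 by apply/funext => t; rewrite /Sf big_ord0.
  have SfS m : Sf m.+1 = fun t => Sf m t +
      ci * z0 ^+ m * (phi (circ r t) * (circ r t)^-1 ^+ m).
    by apply/funext => t; rewrite /Sf big_ord_recr.
  have S m : cint (Sf m) 0 per =
      per%:C * ci * \sum_(n < m) cc phi r n * z0 ^+ n /\
      ccont (Sf m) 0 per.
    elim: m => [|m [IH IHc]].
      by rewrite Sf0 big_ord0; split; [rewrite cint0 mulr0 | exact: ccont_cst].
    have cN := ccontZ (c := ci * z0 ^+ m) (ct m).
    rewrite SfS; split; last exact: ccontD IHc cN.
    rewrite (cintD IHc cN) IH (cintZ _ (ct m)) big_ord_recr /= mulrDr; congr (_ + _).
    by rewrite /cc fmorphV /=; field.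
  rewrite -(S N).1 -(cintB (ccontM cphi (cker ci)) (S N).2).
  apply: eq_cint => t _; rewrite /rem /Sf.
  have c0 := circ_neq0 t r0; have {}u0 := u0 t.
  move: (circ r t) (phi (circ r t)) c0 u0 => c f c0 u0.
  elim: N {rem crem} => [|N IH]; first by rewrite big_ord0 !expr0; field.
  rewrite big_ord_recr /= opprD addrA IH !exprS.
  move: (c^-1 ^+ N) (z0 ^+ N) => p q; field.
  by rewrite u0 c0.
rewrite E.
have -> : per * (2 * M * (nrm z0 / r) ^+ N * (1 - nrm z0 / r)^-1) =
   2 * (M * (nrm z0 / r) ^+ N * (1 - nrm z0 / r)^-1) * (per - 0) by ring.
apply: (cint_bound (ltW per_gt0) crem) => t tI.
have ud : r - nrm z0 <= nrm (circ r t - z0).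
  by have := nrmD (circ r t - z0) z0; rewrite subrK nrm_circ //; lra.
have nz := nrm_ge0 z0.
have -> : nrm (rem t) = nrm (phi (circ r t)) * r^-1 ^+ N *
    (nrm z0 ^+ N * r / nrm (circ r t - z0)).
  rewrite /rem [LHS]nrmM [X in X * _]nrmM [X in _ * X]nrmM [X in _ * (X * _)]nrmM.
  by rewrite [X in _ * (X * _ * _)]nrmM !nrmV !nrmX nrmV nrm_i nrm_circ // mul1r.
have -> : nrm (phi (circ r t)) * r^-1 ^+ N * (nrm z0 ^+ N * r / nrm (circ r t - z0)) =
  nrm (phi (circ r t)) * (nrm z0 / r) ^+ N * (r / nrm (circ r t - z0)).
  by rewrite exprMn; ring.
have rho0 : 0 <= nrm z0 / r by rewrite divr_ge0 // ltW.
apply: ler_pM.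
- by rewrite mulr_ge0 ?nrm_ge0 // exprn_ge0.
- by rewrite divr_ge0 ?nrm_ge0 // ltW.
- by apply: ler_wpM2r; [rewrite exprn_ge0 | exact: pM].
have -> : (1 - nrm z0 / r)^-1 = r / (r - nrm z0).
  by field; rewrite !gt_eqF //; lra.
apply: ler_wpM2l; first exact: ltW.
by rewrite lef_pV2 ?posrE //; lra.
Qed.

End CauchyFormula.

(** * Cauchy coefficients and Taylor expansion in one variable *)

Section CauchySeries.
Context {R : realType}.
Implicit Types (phi psi : R[i] -> R[i]) (z w : R[i]) (r t s a b M : R).

(** Integration by parts: the derivative of phi(w) w^-(n+1) along the closed circle
    integrates to zero. *)
Lemma cc_der r phi psi n : 0 < r ->
  (forall z, nrm z = r -> hder phi z (psi z)) ->
  (forall a b, ccont (fun t => psi (circ r t)) a b) ->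
  cc psi r n = n.+1%:R * cc phi r n.+1.
Proof.
move=> r0 dphi cpsi; rewrite /cc mulrCA; congr (_ * _).
have c0 t : circ r t != 0 by exact: circ_neq0.
have cphi a b : ccont (fun t => phi (circ r t)) a b.
  move=> t _; apply: (@continuous_comp _ _ _ (circ r) phi).
    exact: circ_continuous.
  by apply: hder_continuous; apply: dphi; rewrite nrm_circ.
have c1 := ccontM (cpsi 0 per) (@circV_cont R r n 0 per r0).
have c2 := ccontM (cphi 0 per) (@circV_cont R r n.+1 0 per r0).
have c3 := ccontB c1 (ccontZ (c := n.+1%:R) c2).
have dG t : rder (fun s => phi (circ r s) * (circ r s)^-1 ^+ n.+1) t
    (ci * (psi (circ r t) * (circ r t)^-1 ^+ n -
      n.+1%:R * (phi (circ r t) * (circ r t)^-1 ^+ n.+1))).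
  have H1 := hderX n (hderV (c0 t)).
  have H2 := hderM (dphi _ (nrm_circ t r0)) H1.
  have := rder_comp H2 (rder_circ r t).
  congr (rder _ t _); rewrite !exprS.
  by move: ((circ r t)^-1 ^+ n) => p; field.
have := cint_FTC per_gt0 (ccontZ (c := ci) c3) (fun t _ => dG t).
rewrite circ_period subrr (cintZ _ c3) (cintB c1 (ccontZ (c := n.+1%:R) c2)).
rewrite (cintZ _ c2) => /eqP; rewrite mulf_eq0 subr_eq0 => /orP[|/eqP //].
by move=> /eqP/(congr1 (@nrm R R[i])); rewrite nrm_i nrm0 => /eqP; rewrite oner_eq0.
Qed.

Lemma cc1 r n : 0 < r -> cc (fun=> 1 : R[i]) r n = (n == 0%N)%:R.
Proof.
move=> r0; case: n => [|n].
  rewrite /cc; under eq_cint do rewrite expr0 mulr1.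
  have H t : rder (fun x => x%:C : R[i]) t 1.
    move=> e e0; exists 1 => // h _.
    have -> : (t + h)%:C - t%:C - h%:C * 1 = 0 :> R[i] by rewrite rmorphD /=; ring.
    by rewrite nrm0 mulr_ge0 // ltW.
  rewrite (cint_FTC per_gt0 (@ccont_cst R 1 0 per) (fun t _ => H t)).
  by rewrite subr0 -rmorphM /= mulVf // gt_eqF // per_gt0.
have := @cc_der r (fun=> 1) (fun=> 0) n r0 (fun z _ => @hder_cst R 1 z)
  (fun a b => @ccont_cst R 0 a b).
have -> : cc (fun=> 0 : R[i]) r n = 0.
  by rewrite /cc; under eq_cint do rewrite mul0r; rewrite cint0 mulr0.
move=> /esym/eqP; rewrite mulf_eq0 => /orP[|/eqP //].
by move=> /eqP/(congr1 (@nrm R R[i])); rewrite nrm_nat nrm0 => /eqP; rewrite pnatr_eq0.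
Qed.

Lemma geom_small (rho K : R) : 0 <= rho < 1 ->
  forall e, 0 < e -> exists n0 : nat, forall n, (n0 <= n)%N -> K * rho ^+ n <= e.
Proof.
move=> /andP[rho0 rho1] e e0.
have /cvgrPdist_le : (fun n => rho ^+ n) @ \oo --> (0 : R).
  by apply: cvg_expr; rewrite ger0_norm.
have K0 : 0 < `|K| + 1 by rewrite ltr_wpDl.
move=> /(_ (e / (`|K| + 1)) (divr_gt0 e0 K0)) [n0 _ H]; exists n0 => n n0n.
have := H n n0n; rewrite /= sub0r normrN ger0_norm ?exprn_ge0 // => h.
have p0 : 0 <= rho ^+ n by rewrite exprn_ge0.
rewrite ler_pdivlMr // in h; apply: le_trans h; rewrite mulrC.
by apply: ler_wpM2l => //; apply: (le_trans (ler_norm _)); rewrite lerDl.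
Qed.

(** The constant function 1 is its own Taylor series, so the remainder estimate of
    [kernel_series] is a statement about this integral. *)
Lemma circ_kernel_integral r z : 0 < r -> nrm z < r ->
  cint (fun t => ci * circ r t / (circ r t - z)) 0 per = per%:C * ci.
Proof.
move=> r0 zr; apply/eqP; rewrite -subr_eq0; apply/eqP/nrm_le0.
have rho1 : 0 <= nrm z / r < 1.
  by rewrite divr_ge0 ?nrm_ge0 ?(ltW r0) //= ltr_pdivrMr // mul1r.
apply: (@le_eps R _ 1) => e e0; rewrite mulr1.
have [n0 H] := geom_small (per * (2 * (1 - nrm z / r)^-1)) rho1 e0.
apply: le_trans (H n0.+1 (leqnSn _)).
have p1 t : 0 <= t <= per -> nrm ((fun=> 1 : R[i]) (circ r t)) <= 1.
  by rewrite nrm1.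
have := @kernel_series R r z (fun=> 1) 1 n0.+1 r0 zr (@ccont_cst R 1 0 per) p1.
rewrite big_ord_recl /= cc1 // expr0 mulr1 big1 ?addr0 => [|i _]; last first.
  by rewrite cc1 // mul0r.
under eq_cint do rewrite mul1r.
rewrite eqxx !mulr1 => /le_trans; apply.
by rewrite le_eqVlt; apply/orP; left; apply/eqP; ring.
Qed.

Theorem cauchy_series r z phi M N : 0 < r -> nrm z < r ->
  (forall w, nrm w <= r -> exists l, hder phi w l) ->
  (forall t, 0 <= t <= per -> nrm (phi (circ r t)) <= M) ->
  nrm (phi z - \sum_(n < N) cc phi r n * z ^+ n) <=
    2 * M * (nrm z / r) ^+ N * (1 - nrm z / r)^-1.
Proof.
move=> r0 zr hphi pM.
have cphi := @hol_circ_cont R r phi 0 per r0 hphi.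
have := kernel_series N r0 zr cphi pM.
rewrite (cauchy_kernel r0 hphi zr) circ_kernel_integral //.
rewrite (mulrC (phi z)) -mulrBr nrmM nrmM nrm_i mulr1 nrm_real.
by rewrite gtr0_norm ?per_gt0 // ler_pM2l // per_gt0.
Qed.

Lemma hol_circ_bounded r phi : 0 < r ->
  (forall w, nrm w <= r -> exists l, hder phi w l) ->
  exists M, forall t, 0 <= t <= per -> nrm (phi (circ r t)) <= M.
Proof.
move=> r0 hphi.
have cphi := @hol_circ_cont R r phi 0 per r0 hphi.
have [|c _ cM] := @EVT_max R (fun t => nrm (phi (circ r t))) 0 per (ltW per_gt0).
  apply: continuous_in_subspaceT => t; rewrite inE /= in_itv /= => tI.
  have /continuous_nrmP ct := cphi t tI.
  apply/cvgrPdist_lt => e e0; have := ct e e0; apply: filterS => s.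
  move=> h; rewrite distrC; apply: le_lt_trans h; rewrite ler_norml.
  have h1 := nrmD (phi (circ r s) - phi (circ r t)) (phi (circ r t)).
  have h2 := nrmD (phi (circ r t) - phi (circ r s)) (phi (circ r s)).
  rewrite subrK in h1; rewrite subrK nrmC in h2.
  by apply/andP; split; lra.
exists (nrm (phi (circ r c))) => t tI; apply: cM.
by rewrite in_itv.
Qed.

Lemma cc0 r phi : 0 < r ->
  (forall w, nrm w <= r -> exists l, hder phi w l) -> cc phi r 0 = phi 0.
Proof.
move=> r0 hphi; have [M pM] := hol_circ_bounded r0 hphi.
have := @cauchy_series r 0 phi M 1 r0 _ hphi pM.
rewrite nrm0 mul0r expr1 mulr0 mul0r big_ord_recl big_ord0 expr0 mulr1 addr0.
by move=> /(_ r0)/nrm_le0/eqP; rewrite subr_eq0 => /eqP.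
Qed.

(** Integrating by parts n times lowers the index of the coefficient to 0, where
    it is a value of the function. *)
Lemma cc_iter_der r (phi : nat -> R[i] -> R[i]) n : 0 < r ->
  (forall k z, nrm z <= r -> hder (phi k) z (phi k.+1 z)) ->
  cc (phi 0%N) r n = phi n 0 / n`!%:R.
Proof.
move=> r0 dphi.
have hphi k z : nrm z <= r -> exists l, hder (phi k) z l.
  by move=> zr; exists (phi k.+1 z); exact: dphi.
have f0 k : k`!%:R != 0 :> R[i].
  apply/eqP => /(congr1 (@nrm R R[i])); rewrite nrm_nat nrm0 => /eqP.
  by rewrite pnatr_eq0 gtn_eqF // fact_gt0.
suff H k : cc (phi k) r 0 = k`!%:R * cc (phi 0%N) r k.
  by rewrite -(cc0 r0 (hphi n)) H mulrC mulKf.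
suff H' : forall k j m, cc (phi (k + m)%N) r j =
    ((j + k)`!%:R / j`!%:R) * cc (phi m) r (j + k)%N.
  by have := H' k 0%N 0%N; rewrite addn0 add0n fact0 divr1.
clear k; elim => [j m|k IH j m]; first by rewrite addn0 add0n divff // mul1r.
rewrite addSnnS IH addnS.
rewrite (@cc_der r (phi m) (phi m.+1) (j + k) r0).
- by rewrite factS natrM; move: (_ `!%:R) (f0 j) => x x0; field.
- by move=> z zr; apply: dphi; rewrite zr.
- by move=> a b; exact: (@hol_circ_cont R r (phi m.+1) a b r0 (hphi m.+1)).
Qed.

End CauchySeries.

(** * Limits of complex sequences *)

Section ComplexLimits.
Context {R : realType}.
Implicit Types (u : nat -> R[i]) (l c : R[i]).

(** Convergence with the real-valued norm and weak inequalities, which pass to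
    the limit. *)
Definition tends u l := forall e : R, 0 < e ->
  exists K, forall k, (K <= k)%N -> nrm (u k - l) <= e.

Lemma tends_le u l c (M : R) K : tends u l ->
  (forall k, (K <= k)%N -> nrm (u k - c) <= M) -> nrm (l - c) <= M.
Proof.
move=> ul uM; rewrite -subr_le0; apply: (@le_eps R _ 1) => e e0.
have [K' H] := ul e e0; have := H _ (leq_maxr K K'); have := uM _ (leq_maxl K K').
have := nrm_tri (u (maxn K K')) l c; rewrite (nrmC l (u _)); lra.
Qed.

Lemma tends_unique u l l' : tends u l -> tends u l' -> l = l'.
Proof.
move=> ul ul'; apply/eqP; rewrite -subr_eq0; apply/eqP/nrm_le0.
apply: (@le_eps R _ 1) => e e0; rewrite mulr1.
by have [K H] := ul' e e0; exact: tends_le ul H.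
Qed.

Lemma tends_cst c : tends (fun=> c) c.
Proof. by move=> e e0; exists 0%N => k _; rewrite subrr nrm0 ltW. Qed.

Lemma tendsD u u' l l' : tends u l -> tends u' l' ->
  tends (fun k => u k + u' k) (l + l').
Proof.
move=> ul ul' e e0; have e20 : 0 < e / 2 by lra.
have [K H] := ul _ e20; have [K' H'] := ul' _ e20.
exists (maxn K K') => k; rewrite geq_max => /andP[/H h /H' h'].
by rewrite opprD addrACA; apply: (le_trans (nrmD _ _)); lra.
Qed.

Lemma tendsM u u' l l' : tends u l -> tends u' l' ->
  tends (fun k => u k * u' k) (l * l').
Proof.
move=> ul ul' e e0.
have nl := nrm_ge0 l; have nl' := nrm_ge0 l'.
have A0 : 0 < nrm l + nrm l' + 1 by lra.
pose d := Num.min 1 (e / (nrm l + nrm l' + 1)).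
have d0 : 0 < d by rewrite lt_min ltr01 divr_gt0.
have d1 : d <= 1 by rewrite ge_min lexx.
have dE : d * (nrm l + nrm l' + 1) <= e by rewrite -ler_pdivlMr // ge_min lexx orbT.
clearbody d.
have [K H] := ul _ d0; have [K' H'] := ul' _ d0.
exists (maxn K K') => k; rewrite geq_max => /andP[/H h /H' h'].
have -> : u k * u' k - l * l' =
  (u k - l) * (u' k - l') + (u k - l) * l' + l * (u' k - l') by ring.
apply: (le_trans (nrmD _ _)); apply: (le_trans (lerD (nrmD _ _) (lexx _))).
rewrite !nrmM; have n1 := nrm_ge0 (u k - l); have n2 := nrm_ge0 (u' k - l').
have h1 : nrm (u k - l) * nrm (u' k - l') <= d * 1 by apply: ler_pM => //; lra.
have h2 : nrm (u k - l) * nrm l' <= d * nrm l' by apply: ler_wpM2r.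
have h3 : nrm l * nrm (u' k - l') <= nrm l * d by apply: ler_wpM2l.
lra.
Qed.

Lemma tendsZ c u l : tends u l -> tends (fun k => c * u k) (c * l).
Proof. by move=> ul; exact: tendsM (tends_cst c) ul. Qed.

Lemma tendsB u u' l l' : tends u l -> tends u' l' ->
  tends (fun k => u k - u' k) (l - l').
Proof.
move=> ul ul'; rewrite -[- l']mulN1r; have := tendsD ul (tendsZ (-1) ul').
by congr (tends _ _); apply/funext => k; rewrite mulN1r.
Qed.

Lemma eq_tends u u' l : u =1 u' -> tends u l -> tends u' l.
Proof. by move=> /funext ->. Qed.

Lemma tends_cvg u l : tends u l <-> u @ \oo --> l.
Proof.
split=> [ul|ul e e0].
  apply/(@cvgrPdist_le _ R[i]) => e /gt0_toC[r r0 ->].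
  have [K H] := ul r r0; exists K => // k /= Kk.
  by rewrite nrmE lecR nrmC H.
have /(@cvgrPdist_le _ R[i])/(_ e%:C) := ul; rewrite (@ltcR R 0) => /(_ e0)[K _ H].
by exists K => k /H /=; rewrite nrmE lecR nrmC.
Qed.

Lemma cauchy_tends u : (forall e : R, 0 < e -> exists K, forall k m, (K <= k)%N ->
  (K <= m)%N -> nrm (u k - u m) <= e) -> exists l, tends u l.
Proof.
move=> uC.
have cR (v : nat -> R) : (forall k m, `|v k - v m| <= nrm (u k - u m)) ->
    exists l : R, forall e, 0 < e ->
      exists K, forall k, (K <= k)%N -> `|v k - l| <= e.
  move=> vu.
  have /cauchy_cvgP/cvg_ex[/= l vl] : cauchy (v @ \oo).
    apply: cauchy_exP => e e0; have e20 : 0 < e / 2 by lra.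
    have [K HK] := uC _ e20.
    exists (v K); exists K => // k /= Kk; rewrite /ball /=.
    by apply: le_lt_trans (vu _ _) _; have := HK K k (leqnn K) Kk; lra.
  exists l => e e0; have /cvgrPdist_le/(_ e e0)[K _ HK] := vl.
  by exists K => k /HK /=; rewrite distrC.
have [a Ha] : exists l : R, forall e, 0 < e -> exists K, forall k, (K <= k)%N ->
    `|complex.Re (u k) - l| <= e.
  by apply: (cR (fun k => complex.Re (u k))) => k m; rewrite -raddfB; exact: Re_le.
have [b Hb] : exists l : R, forall e, 0 < e -> exists K, forall k, (K <= k)%N ->
    `|complex.Im (u k) - l| <= e.
  by apply: (cR (fun k => complex.Im (u k))) => k m; rewrite -raddfB; exact: Im_le.
exists (a +i* b) => e e0; have e20 : 0 < e / 2 by lra.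
have [K HK] := Ha _ e20; have [K' HK'] := Hb _ e20.
exists (maxn K K') => k; rewrite geq_max => /andP[/HK h /HK' h'].
apply: (le_trans (nrm_ReIm _)); move: h h'; case: (u k) => x y /=; lra.
Qed.

End ComplexLimits.

(** * Holomorphic functions on normed spaces *)

Section BanachHolomorphy.
Context {R : realType} {V : normedModType R[i]}.
Implicit Types (g f : V -> R[i]) (a b h v : V) (z w : R[i]) (r s M e : R).

(** Restriction to complex lines reduces holomorphy on a normed space to one
    variable. *)
Lemma line_hder g a h z : differentiable g (a + z *: h) ->
  hder (fun w => g (a + w *: h)) z ('d g (a + z *: h) h).
Proof.
move=> dg e e0; have nh := nrm_ge0 h.
have h1 : 0 < nrm h + 1 by lra.
have [d d0 Hd] := fder_differentiable dg (divr_gt0 e0 h1).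
exists (d / (nrm h + 1)); first exact: divr_gt0.
move=> w wd; rewrite ltr_pdivlMr // in wd; have nw := nrm_ge0 w.
have wh : nrm (w *: h) < d by rewrite nrmZ; lra.
have := Hd _ wh; rewrite nrmZ linearZ /=.
have -> : a + z *: h + w *: h = a + (z + w) *: h by rewrite scalerDl addrA.
rewrite (mulrC _ w) => /le_trans; apply.
rewrite mulrAC ler_pdivrMr // -mulrA; apply: ler_wpM2l; first exact: ltW.
by apply: ler_wpM2l => //; lra.
Qed.

Lemma fderB g f a L L' : fder g a L -> fder f a L' ->
  fder (fun b => g b - f b) a (fun h => L h - L' h).
Proof.
move=> Hg Hf e e0; have e20 : 0 < e / 2 by lra.
have [d d0 Hd] := Hg _ e20; have [d' d'0 Hd'] := Hf _ e20.
exists (Num.min d d'); first by rewrite lt_min d0.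
move=> h; rewrite lt_min => /andP[/Hd {}Hd /Hd' {}Hd'].
have -> : g (a + h) - f (a + h) - (g a - f a) - (L h - L' h) =
  (g (a + h) - g a - L h) - (f (a + h) - f a - L' h) by ring.
apply: (le_trans (nrmB _ _)); lra.
Qed.

Lemma fderZ c g a L : fder g a L -> fder (fun b => c * g b) a (fun h => c * L h).
Proof.
move=> Hg e e0; have nc := nrm_ge0 c; have c1 : 0 < nrm c + 1 by lra.
have [d d0 Hd] := Hg _ (divr_gt0 e0 c1); exists d => // h /Hd {}Hd.
rewrite -!mulrBr nrmM; have nn := nrm_ge0 (g (a + h) - g a - L h).
apply: (@le_trans _ _ ((nrm c + 1) * (e / (nrm c + 1) * nrm h))).
  by apply: ler_pM => //; lra.
by rewrite mulrA [_ * (e / _)]mulrC divfK // gt_eqF.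
Qed.

Lemma bounded_linB (L L' : V -> R[i]) : bounded_lin L -> bounded_lin L' ->
  bounded_lin (fun h => L h - L' h).
Proof.
move=> [[LD LZ] [C LC]] [[LD' LZ'] [C' LC']]; split; first split.
- by move=> x y; rewrite LD LD' opprD addrACA.
- by move=> c x; rewrite LZ LZ' mulrBr.
exists (C + C') => h; apply: (le_trans (nrmB _ _)); rewrite mulrDl.
by apply: lerD.
Qed.

Lemma bounded_linZ c (L : V -> R[i]) : bounded_lin L -> bounded_lin (fun h => c * L h).
Proof.
move=> [[LD LZ] [C LC]]; split; first split.
- by move=> x y; rewrite LD mulrDr.
- by move=> d x; rewrite LZ mulrCA.
by exists (nrm c * C) => h; rewrite nrmM -mulrA; apply: ler_wpM2l => //; exact: nrm_ge0.
Qed.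

Lemma dB g f a : differentiable g a -> differentiable f a ->
  differentiable (fun b => g b - f b) a /\
  forall h, 'd (fun b => g b - f b) a h = 'd g a h - 'd f a h.
Proof.
move=> dg df; have [] := differentiable_fder
  (bounded_linB (bounded_lin_diff dg) (bounded_lin_diff df))
  (fderB (fder_differentiable dg) (fder_differentiable df)).
by move=> H1 H2; split; [exact: H1 | move=> h; exact: (congr1 (@^~ h) H2)].
Qed.

Lemma dZ c g a : differentiable g a ->
  differentiable (fun b => c * g b) a /\
  forall h, 'd (fun b => c * g b) a h = c * 'd g a h.
Proof.
move=> dg; have [] := differentiable_fder
  (bounded_linZ c (bounded_lin_diff dg)) (fderZ c (fder_differentiable dg)).
by move=> H1 H2; split; [exact: H1 | move=> h; exact: (congr1 (@^~ h) H2)].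
Qed.

Lemma shift_differentiable g a v : differentiable g (a + v) ->
  differentiable (fun b => g (b + v)) a /\
  forall h, 'd (fun b => g (b + v)) a h = 'd g (a + v) h.
Proof.
move=> dg; have H : fder (fun b => g (b + v)) a ('d g (a + v)).
  move=> e e0; have [d d0 Hd] := fder_differentiable dg e0; exists d => // h /Hd.
  by rewrite (addrAC a).
have [H1 H2] := differentiable_fder (bounded_lin_diff dg) H.
by split; [exact: H1 | move=> h; exact: (congr1 (@^~ h) H2)].
Qed.

Lemma near_eq_diff g f a : (\forall b \near a, g b = f b) -> differentiable f a ->
  differentiable g a /\ forall h, 'd g a h = 'd f a h.
Proof.
move=> gf df; have H : fder g a ('d f a).
  move=> e e0; have [d d0 Hd] := fder_differentiable df e0.
  have /nbhs_nrm[d' d'0 Hd'] := gf.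
  exists (Num.min d d'); first by rewrite lt_min d0.
  move=> h; rewrite lt_min => /andP[/Hd {}Hd hd'].
  by rewrite (nbhs_singleton gf) Hd' // addrC addKr.
have [H1 H2] := differentiable_fder (bounded_lin_diff df) H.
by split; [exact: H1 | move=> h; exact: (congr1 (@^~ h) H2)].
Qed.

(** Cauchy's estimates on the disc cut out by the line through a in direction h.
    The second one is uniform in g: it turns uniform convergence of functions
    into convergence of derivatives, and difference quotients into uniform
    approximations. *)
Lemma cauchy_first_second g a s M : 0 < s ->
  (forall b, nrm (b - a) <= s -> differentiable g b /\ nrm (g b) <= M) ->
  (forall h, nrm ('d g a h) <= 2 * M / s * nrm h) /\
  (forall h, nrm h <= s / 2 ->
    nrm (g (a + h) - g a - 'd g a h) <= 4 * M / s ^+ 2 * nrm h ^+ 2).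
Proof.
move=> s0 gs.
have M0 : 0 <= M.
  by apply: le_trans (nrm_ge0 _) (gs a _).2; rewrite subrr nrm0 ltW.
have dga : differentiable g a by apply: (gs a _).1; rewrite subrr nrm0 ltW.
have main h : h != 0 ->
    nrm ('d g a h) <= 2 * M / s * nrm h /\
    (nrm h <= s / 2 -> nrm (g (a + h) - g a - 'd g a h) <= 4 * M / s ^+ 2 * nrm h ^+ 2).
  move=> h0; have nh := nrm_gt0 h0.
  (* |z| <= r means |z h| <= s. *)
  pose r := s / nrm h; have r0 : 0 < r by rewrite divr_gt0.
  have rh : r * nrm h = s by rewrite divfK // gt_eqF.
  pose phi z : R[i] := g (a + z *: h).
  have hphi z : nrm z <= r -> exists l, hder phi z l.
    move=> zr; exists ('d g (a + z *: h) h); apply/line_hder/(gs _ _).1.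
    by rewrite addrC addKr nrmZ -rh ler_wpM2r // ltW.
  have pM t : 0 <= t <= per -> nrm (phi (circ r t)) <= M.
    move=> _; apply: (gs _ _).2.
    by rewrite addrC addKr nrmZ nrm_circ // rh.
  have E2 z : nrm z <= r / 2 ->
      nrm (phi z - phi 0 - cc phi r 1 * z) <= 4 * M / r ^+ 2 * nrm z ^+ 2.
    move=> zr; have nz := nrm_ge0 z.
    have zr' : nrm z < r by lra.
    have := cauchy_series 2 r0 zr' hphi pM.
    rewrite !big_ord_recl big_ord0 addr0 expr0 mulr1 expr1 (cc0 r0 hphi).
    rewrite opprD addrA => /le_trans; apply.
    have q2 : nrm z / r <= 1 / 2 by rewrite ler_pdivrMr //; lra.
    have q0 : 0 <= nrm z / r by rewrite divr_ge0 // ltW.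
    have -> : 4 * M / r ^+ 2 * nrm z ^+ 2 = 2 * M * (nrm z / r) ^+ 2 * 2.
      by field; rewrite gt_eqF.
    apply: ler_wpM2l.
      by apply: mulr_ge0; [rewrite mulr_ge0 | rewrite exprn_ge0].
    by rewrite invf_ple ?posrE //; lra.
  have c1 : 'd g a h = cc phi r 1.
    have H1 : hder phi 0 (cc phi r 1).
      apply: (@hder_sq _ _ _ _ (4 * M / r ^+ 2) (r / 2)) => [|w wr].
        by rewrite divr_gt0.
      by rewrite add0r; apply: E2; exact: ltW.
    have H2 : hder phi 0 ('d g a h).
      have := @line_hder g a h 0; rewrite scale0r addr0; exact.
    have lin1 (l : R[i]) : lin (fun w : R[i] => l * w).
      by split=> [x y|c x]; [rewrite mulrDr | rewrite /GRing.scale /= mulrCA].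
    by have := fder_unique (lin1 _) (lin1 _) H2 H1 1; rewrite !mulr1.
  split.
    rewrite c1; have cphi := @hol_circ_cont R r phi 0 per r0 hphi.
    have := cc_bound 1 r0 cphi pM; rewrite expr1 => /le_trans; apply.
    rewrite le_eqVlt; apply/orP; left; apply/eqP; rewrite -rh; field.
    by rewrite !gt_eqF.
  move=> hs; have := E2 1; rewrite nrm1 /phi scale1r scale0r addr0 mulr1 -c1.
  have r2 : 1 <= r / 2 by rewrite ler_pdivlMr // mul1r ler_pdivlMr //; lra.
  move=> /(_ r2) /le_trans; apply.
  rewrite le_eqVlt; apply/orP; left; apply/eqP; rewrite -rh; field.
  by rewrite !gt_eqF.
split=> [h|h hs]; (have [->|h0] := eqVneq h 0; last by have [H1 H2] := main h h0; auto).
  by rewrite linear0 !nrm0 mulr0.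
by rewrite addr0 linear0 subr0 subrr !nrm0 expr0n mulr0.
Qed.

(** Differences of the g_k are uniformly small on the ball, hence so are their
    derivatives and their second order remainders at a ([cauchy_first_second]);
    the limit of the derivatives inherits the remainder estimate of one fixed g_k. *)
Lemma weierstrass (gk : nat -> V -> R[i]) g a s : 0 < s ->
  (forall k b, nrm (b - a) <= s -> differentiable (gk k) b) ->
  (forall e, 0 < e -> exists K, forall k, (K <= k)%N -> forall b,
     nrm (b - a) <= s -> nrm (gk k b - g b) <= e) ->
  differentiable g a /\ forall h, tends (fun k => 'd (gk k) a h) ('d g a h).
Proof.
move=> s0 dgk unif.
have aa : nrm (a - a) <= s by rewrite subrr nrm0 ltW.
have pair e K k l : (forall k, (K <= k)%N -> forall b,
     nrm (b - a) <= s -> nrm (gk k b - g b) <= e) -> (K <= k)%N -> (K <= l)%N ->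
    forall b, nrm (b - a) <= s ->
      differentiable (fun b => gk k b - gk l b) b /\ nrm (gk k b - gk l b) <= 2 * e.
  move=> H Kk Kl b bs; split; first exact: (dB (dgk k b bs) (dgk l b bs)).1.
  have := nrm_tri (g b) (gk k b) (gk l b); rewrite (nrmC (g b)).
  have := H k Kk b bs; have := H l Kl b bs; lra.
have est e K k l : (forall k, (K <= k)%N -> forall b,
     nrm (b - a) <= s -> nrm (gk k b - g b) <= e) -> (K <= k)%N -> (K <= l)%N ->
    forall h, nrm ('d (gk k) a h - 'd (gk l) a h) <= 2 * (2 * e) / s * nrm h.
  move=> H Kk Kl h; have [E _] := cauchy_first_second s0 (pair e K k l H Kk Kl).
  by rewrite -((dB (dgk k a aa) (dgk l a aa)).2 h); exact: E.
have cv h : exists l, tends (fun k => 'd (gk k) a h) l.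
  apply: cauchy_tends => e e0; have nh := nrm_ge0 h.
  have h1 : 0 < 4 * (nrm h + 1) / s by rewrite divr_gt0 // mulr_gt0 //; lra.
  have [K HK] := unif _ (divr_gt0 e0 h1).
  exists K => k l Kk Kl; apply: (le_trans (est _ K k l HK Kk Kl h)).
  have -> : 2 * (2 * (e / (4 * (nrm h + 1) / s))) / s * nrm h =
     e * (nrm h / (nrm h + 1)).
    by field; rewrite !gt_eqF //; lra.
  rewrite -[leRHS]mulr1; apply: ler_wpM2l; first exact: ltW.
  by rewrite ler_pdivrMr ?mul1r; lra.
have [L HL] := choice cv.
have [K1 HK1] := unif 1 ltr01.
have estL k : (K1 <= k)%N -> forall h, nrm (L h - 'd (gk k) a h) <= 4 / s * nrm h.
  move=> Kk h; apply: (tends_le (HL h) (K := K1)) => l Kl.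
  by have := est 1 K1 l k HK1 Kl Kk h; rewrite mulr1 -natrM.
have blL : bounded_lin L.
  split; first split.
  - move=> x y; apply: (tends_unique (HL _)).
    by apply: eq_tends (tendsD (HL x) (HL y)) => k; rewrite linearD.
  - move=> c x; apply: (tends_unique (HL _)).
    by apply: eq_tends (tendsZ c (HL x)) => k; rewrite linearZ.
  have [_ [C HC]] := bounded_lin_diff (dgk K1 a aa).
  exists (4 / s + C) => h; rewrite mulrDl.
  have := nrmD (L h - 'd (gk K1) a h) ('d (gk K1) a h); rewrite subrK.
  by have := HC h; have := estL K1 (leqnn _) h; lra.
have fL : fder g a L.
  move=> e e0; have e20 : 0 < e / 2 by lra.
  have [d d0 Hd] := fder_differentiable (dgk K1 a aa) e20.
  have s2 : 0 < s ^+ 2 by rewrite exprn_gt0.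
  exists (Num.min d (Num.min (s / 2) (e * s ^+ 2 / 16))).
    by rewrite !lt_min d0 !divr_gt0 // mulr_gt0.
  move=> h; rewrite !lt_min => /and3P[hd hs he].
  have nh := nrm_ge0 h.
  have D : nrm ((g (a + h) - g a - L h) - (gk K1 (a + h) - gk K1 a - 'd (gk K1) a h))
      <= 4 * 2 / s ^+ 2 * nrm h ^+ 2.
    have as_ : nrm (a + h - a) <= s by rewrite addrC addKr; lra.
    have tg b : nrm (b - a) <= s -> tends (fun k => gk k b) (g b).
      by move=> bs e' e'0; have [K HK] := unif e' e'0; exists K => k Kk; exact: HK.
    have T : tends (fun k => gk k (a + h) - gk k a - 'd (gk k) a h) (g (a + h) - g a - L h).
      exact: tendsB (tendsB (tg _ as_) (tg _ aa)) (HL h).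
    apply: (tends_le T (K := K1)) => k Kk.
    have [_ E] := cauchy_first_second s0 (pair 1 K1 k K1 HK1 Kk (leqnn _)).
    have rearr (x1 x2 x3 y1 y2 y3 : R[i]) :
        x1 - x2 - x3 - (y1 - y2 - y3) = x1 - y1 - (x2 - y2) - (x3 - y3) by ring.
    rewrite rearr -((dB (dgk k a aa) (dgk K1 a aa)).2 h).
    by have := E h (ltW hs); rewrite mulr1; exact.
  have := Hd h hd; set A := gk K1 (a + h) - _ - _ in D *; set B := g _ - _ - _ in D *.
  have := nrmD (B - A) A; rewrite subrK => H1 H2.
  have : 4 * 2 / s ^+ 2 * nrm h ^+ 2 <= e / 2 * nrm h.
    rewrite expr2 mulrA; apply: ler_wpM2r => //.
    rewrite mulrAC ler_pdivrMr //; rewrite ltr_pdivlMr // in he; lra.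
  lra.
have [H1 H2] := differentiable_fder blL fL.
split; [exact: H1 | move=> h].
have E : L h = 'd g a h by exact: esym (congr1 (@^~ h) H2).
exact: (eq_ind _ (tends _) (HL h) _ E).
Qed.

Definition hol_ball g a r := forall b, nrm (b - a) < r -> differentiable g b.

Lemma hol_ball_sub g a r b s : hol_ball g a r -> nrm (b - a) + s <= r -> hol_ball g b s.
Proof.
move=> H bs c cb; apply: H; have := nrm_tri b c a; lra.
Qed.

Lemma differentiable_bounded g a : differentiable g a ->
  exists2 d, 0 < d & forall b, nrm (b - a) < d -> nrm (g b) <= nrm (g a) + 1.
Proof.
move=> /differentiable_continuous/continuous_nrmP/(_ 1 ltr01)/nbhs_nrm[d d0 Hd].
exists d => // b /Hd; have := nrmD (g b - g a) (g a); rewrite subrK; lra.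
Qed.

Definition dir v g : V -> R[i] := fun b => 'd g b v.

(** The difference quotients of g in direction v are holomorphic and converge
    uniformly near each point, by the second order estimate; hence the
    directional derivative is holomorphic by [weierstrass]. *)
Lemma hol_ball_dir g a r v : hol_ball g a r -> hol_ball (dir v g) a r.
Proof.
move=> H b br.
have [d d0 Hd] := differentiable_bounded (H b br).
pose rb := r - nrm (b - a); have rb0 : 0 < rb by rewrite /rb; lra.
(* A quarter leaves room for a ball of radius s about each point c of the ball of
   radius s about b, and for the shift by t k *: v. *)
pose s := Num.min d rb / 4.
have m0 : 0 < Num.min d rb by rewrite lt_min d0.
have md : Num.min d rb <= d by rewrite ge_min lexx.
have mr : Num.min d rb <= rb by rewrite ge_min lexx orbT.
have s0 : 0 < s by rewrite divr_gt0.
set M := nrm (g b) + 1 in Hd.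
have dg c : nrm (c - b) <= 3 * s -> differentiable g c /\ nrm (g c) <= M.
  move=> cb; split; last by apply: Hd; rewrite /s in cb; lra.
  by apply: H; have := nrm_tri b c a; rewrite /s /rb in cb mr *; lra.
have nv := nrm_ge0 v; have v1 : 0 < nrm v + 1 by lra.
pose t k : R := s / 2 / (nrm v + 1) / k.+1%:R.
have t0 k : 0 < t k by rewrite !divr_gt0.
have tv k : t k * nrm v <= s / 2.
  have : t k <= s / 2 / (nrm v + 1).
    by rewrite ler_pdivrMr // ler_peMr ?ler1n // divr_ge0 ?ltW // divr_gt0.
  rewrite ler_pdivlMr //; have := t0 k; nra.
pose gk k c : R[i] := (t k)%:C^-1 * (g (c + (t k)%:C *: v) - g c).
have nt k : nrm ((t k)%:C *: v) = t k * nrm v by rewrite nrmZ nrm_real gtr0_norm.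
have tC k : (t k)%:C != 0 :> R[i] by rewrite (fmorph_eq0 (real_complex R)) gt_eqF.
apply: (@weierstrass gk (dir v g) b s s0 _ _).1.
  move=> k c cs.
  have d1 : differentiable g (c + (t k)%:C *: v).
    apply: (dg _ _).1; rewrite addrAC; apply: (le_trans (nrmD _ _)).
    by rewrite nt; have := tv k; lra.
  have d2 : differentiable g c by apply: (dg _ _).1; lra.
  exact: (dZ _ (dB (shift_differentiable d1).1 d2).1).1.
move=> e e0.
pose C := 4 * M / s ^+ 2 * nrm v ^+ 2.
have M0 : 0 <= M by rewrite /M; have := nrm_ge0 (g b); lra.
have C0 : 0 <= C.
  apply: mulr_ge0; last by rewrite exprn_ge0.
  by apply: divr_ge0; [rewrite mulr_ge0 | rewrite exprn_ge0 // ltW].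
have [K HK] : exists K : nat, C * (s / 2 / (nrm v + 1)) / e < K%:R.
  exists (Num.bound (C * (s / 2 / (nrm v + 1)) / e)); apply: archi_boundP.
  by rewrite divr_ge0 ?(ltW e0) // mulr_ge0 // !divr_ge0 ?ltW // divr_gt0.
exists K => k Kk c cs.
have dgc x : nrm (x - c) <= s -> differentiable g x /\ nrm (g x) <= M.
  by move=> xc; apply: dg; have := nrm_tri c x b; lra.
have [_ E] := cauchy_first_second s0 dgc.
have tvs : nrm ((t k)%:C *: v) <= s / 2 by rewrite nt.
have := E _ tvs; rewrite linearZ /= nt.
have -> : gk k c - dir v g c =
   (t k)%:C^-1 * (g (c + (t k)%:C *: v) - g c - (t k)%:C *: 'd g c v).
  by rewrite mulrBr [_ *: 'd g c v]/GRing.scale /= mulKf.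
move=> H1; rewrite nrmM nrmV nrm_real gtr0_norm // mulrC ler_pdivrMr //.
apply: (le_trans H1).
have -> : 4 * M / s ^+ 2 * (t k * nrm v) ^+ 2 = C * t k * t k by rewrite /C; ring.
apply: ler_wpM2r; first exact: ltW.
rewrite /t mulrA ler_pdivrMr // -ler_pdivrMl // mulrC; apply: ltW.
by apply: (lt_le_trans HK); rewrite ler_nat; apply: (leq_trans Kk).
Qed.

Definition idir n v g := iter n (dir v) g.

Lemma hol_ball_idir g a r v n : hol_ball g a r -> hol_ball (idir n v g) a r.
Proof. by move=> H; elim: n => //= n IH; exact: hol_ball_dir. Qed.

(** The n-th term of the Taylor series of g at a, evaluated at v. *)
Definition tay n v g a : R[i] := idir n v g a / n`!%:R.

(** Along the line through a in direction v, the derivatives of z -> g (a + z v)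
    are the iterated directional derivatives of g. *)
Lemma tay_cc g a (rho r : R) v n : hol_ball g a rho -> 0 < r -> r * nrm v < rho ->
  tay n v g a = cc (fun z => g (a + z *: v)) r n.
Proof.
move=> H r0 rv.
have := @cc_iter_der R r (fun k z => idir k v g (a + z *: v)) n r0.
rewrite scale0r addr0 => -> // k z zr.
apply: line_hder; apply: (hol_ball_idir v k H).
rewrite addrC addKr nrmZ; apply: le_lt_trans rv.
by apply: ler_wpM2r => //; exact: nrm_ge0.
Qed.

Let line_hol g a (rho r : R) v : hol_ball g a rho -> r * nrm v < rho ->
  forall z, nrm z <= r -> exists l, hder (fun z => g (a + z *: v)) z l.
Proof.
move=> H rv z zr; exists ('d g (a + z *: v) v); apply: line_hder; apply: H.
rewrite addrC addKr nrmZ; apply: le_lt_trans rv.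
by apply: ler_wpM2r => //; exact: nrm_ge0.
Qed.

(** The circle of radius r may be taken small when v is large: this is Cauchy's
    estimate for the homogeneous polynomial v -> tay n v g a. *)
Lemma tay_bound g a (rho r : R) v M n : hol_ball g a rho -> 0 < r ->
  r * nrm v < rho ->
  (forall b, nrm (b - a) <= r * nrm v -> nrm (g b) <= M) ->
  nrm (tay n v g a) <= 2 * M / r ^+ n.
Proof.
move=> H r0 rv gM; rewrite (tay_cc n H r0 rv).
apply: cc_bound => //; first exact: (hol_circ_cont r0 (line_hol H rv)).
by move=> t _; apply: gM; rewrite addrC addKr nrmZ nrm_circ.
Qed.

Lemma tay_series_bound g a (rho r : R) v M N : hol_ball g a rho -> 1 < r ->
  r * nrm v < rho ->
  (forall b, nrm (b - a) <= r * nrm v -> nrm (g b) <= M) ->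
  nrm (g (a + v) - \sum_(n < N) tay n v g a) <= 2 * M * r^-1 ^+ N * (1 - r^-1)^-1.
Proof.
move=> H r1 rv gM; have r0 : 0 < r by lra.
have r1' : nrm (1 : R[i]) < r by rewrite nrm1.
have pM t : 0 <= t <= per -> nrm (g (a + circ r t *: v)) <= M.
  by move=> _; apply: gM; rewrite addrC addKr nrmZ nrm_circ.
have := cauchy_series N r0 r1' (line_hol H rv) pM.
rewrite scale1r nrm1 mul1r; congr (nrm (_ - _) <= _).
by apply: eq_bigr => n _; rewrite expr1n mulr1 (tay_cc n H r0 rv).
Qed.

Lemma tay_series g a (rho : R) v : hol_ball g a rho -> nrm v < rho ->
  tends (fun N => \sum_(n < N) tay n v g a) (g (a + v)).
Proof.
move=> H vr; have nv := nrm_ge0 v.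
have [r r1 rv] : exists2 r : R, 1 < r & r * nrm v < rho.
  have v1 : 0 < nrm v + 1 by lra.
  exists (1 + (rho - nrm v) / 2 / (nrm v + 1)).
    by rewrite ltrDl !divr_gt0 //; lra.
  have : (rho - nrm v) / 2 / (nrm v + 1) * nrm v <= (rho - nrm v) / 2.
    rewrite mulrAC ler_pdivrMr // ler_wpM2l //; lra.
  by rewrite [(1 + _) * _]mulrDl mul1r; lra.
have r0 : 0 < r by lra.
have [M pM] := hol_circ_bounded r0 (line_hol H rv).
have r1' : nrm (1 : R[i]) < r by rewrite nrm1.
move=> e e0.
have q01 : 0 <= r^-1 < 1 by rewrite invr_ge0 (ltW r0) invf_lt1.
have [K HK] := geom_small (2 * M * (1 - r^-1)^-1) q01 e0.
exists K => N KN; rewrite nrmC; apply: le_trans (HK N KN).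
have := cauchy_series N r0 r1' (line_hol H rv) pM.
rewrite scale1r nrm1 mul1r (mulrAC (2 * M)); congr (nrm (_ - _) <= _).
by apply: eq_bigr => n _; rewrite expr1n mulr1 (tay_cc n H r0 rv).
Qed.

End BanachHolomorphy.

(** * Local inverses of the projection of a Riemann domain *)

Section LineConnected.
Context {R : realType}.

Lemma line_connected (h r : R) : connected [set t : R | `|t| * `|h| < r].
Proof.
apply/connected_intervalP => a b /= ar br c /andP[ac cb].
have : `|c| <= Num.max `|a| `|b|.
  have [c0|/ltW c0] := leP 0 c.
    by rewrite (ger0_norm c0) le_max (le_trans cb (ler_norm _)) orbT.
  rewrite (ler0_norm c0) le_max; apply/orP; left.
  by apply: (@le_trans _ _ (- a)); [rewrite lerN2 | rewrite -normrN ler_norm].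
rewrite le_max => /orP[] H; [apply: le_lt_trans ar|apply: le_lt_trans br];
  by apply: ler_wpM2r.
Qed.

Lemma line_continuous {V : normedModType R[i]} (a h : V) :
  continuous (fun t : R => a + t%:C *: h).
Proof.
move=> t A /nbhs_nrm[r r0 rA]; have nh := nrm_ge0 h.
have h1 : 0 < nrm h + 1 by lra.
apply/nbhs_ballP; exists (r / (nrm h + 1)); first exact: divr_gt0.
move=> u; rewrite /ball /= ltr_pdivlMr // distrC => ut; apply: rA.
rewrite opprD addrACA subrr add0r -scalerBl -rmorphB nrmZ nrm_real.
by have := normr_ge0 (u - t); nra.
Qed.

End LineConnected.

Section Lifts.
Context {R : realType} {E : completeNormedModType R[i]} {X : topologicalType}.
Variable p : X -> E.
Hypothesis rdp : riemann_domain p.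
Implicit Types (x y : X) (a b h v : E) (r t e : R) (s : E -> X) (f : X -> R[i]).

(** A continuous inverse of p over the ball of radius r about p x that takes p x
    to x. Total functions E -> X make these easy to restrict and to compare, unlike
    charts given as subsets of X. *)
Definition is_lift x r s := s (p x) = x /\
  forall b, nrm (b - p x) < r -> p (s b) = b /\ {for b, continuous s}.

Lemma local_inj x : exists2 U, open_nbhs x U & forall y z, U y -> U z -> p y = p z -> y = z.
Proof.
have [U [oU Ux _ [[_ Uinj _] _ _]]] := rdp.2 x.
exists U; first by split.
by move=> y z Uy Uz; apply: Uinj; rewrite inE.
Qed.

Lemma p_continuous : continuous p.
Proof.
move=> x; have [U [oU Ux _ [_ cU _]]] := rdp.2 x.
by move: cU; rewrite continuous_open_subspace //; apply; rewrite inE.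
Qed.

Lemma chart_lift x U : is_chart p x U ->
  exists2 r, 0 < r & is_lift x r ('pinv_(fun=> x) U p).
Proof.
move=> [oU Ux opU [[_ Uinj _] _ cV]].
have : nbhs (p x) (p @` U) by apply: open_nbhs_nbhs; split=> //; exists x.
move=> /nbhs_nrm[r r0 rU]; exists r => //; split; first by rewrite pinvKV ?inE.
move=> b /rU Ub; split; first by apply: pinvK; rewrite inE.
by move: cV; rewrite continuous_open_subspace //; apply; rewrite inE.
Qed.

Lemma homeo_lift x U r : nbhs x U -> homeo_onto p x U (ball (p x) r%:C) ->
  is_lift x r ('pinv_(fun=> x) U p).
Proof.
move=> Ux [[_ Uinj Usurj] _ cV]; have xU := nbhs_singleton Ux.
split; first by rewrite pinvKV ?inE.
move=> b /ball_nrm Bb; split.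
  by apply: pinvK; rewrite inE; exact: Usurj.
have oB : open (ball (p x) r%:C) by exact: ball_open.
by move: cV; rewrite continuous_open_subspace //; apply; rewrite inE.
Qed.

Lemma near_nrm_ball (V : normedModType R[i]) (a b : V) r :
  nrm (b - a) < r -> \forall c \near b, nrm (c - a) < r.
Proof.
move=> br; apply/nbhs_nrm; exists (r - nrm (b - a)); first by lra.
by move=> c cb; have := nrm_tri b c a; lra.
Qed.

Lemma lift_sub x r s b r' : is_lift x r s -> 0 < r' ->
  nrm (b - p x) + r' <= r -> is_lift (s b) r' s.
Proof.
move=> [sx H] r'0 br; have br' : nrm (b - p x) < r by lra.
have [psb _] := H b br'.
split; first by rewrite psb.
move=> c; rewrite psb => cb; apply: H; have := nrm_tri b c (p x); lra.
Qed.

Lemma lift_shrink x r s r' : is_lift x r s -> r' <= r -> is_lift x r' s.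
Proof. by move=> [sx H] rr; split=> // b br; apply: H; lra. Qed.

(** The coincidence set is open since p is locally injective, and closed since X
    is Hausdorff. *)
Lemma lifts_agree (T : topologicalType) (A : set T) (F G : T -> X) (t0 : T) :
  connected A -> open A -> A t0 -> F t0 = G t0 ->
  (forall t : T, A t -> [/\ {for t, continuous F}, {for t, continuous G} & p (F t) = p (G t)]) ->
  forall t : T, A t -> F t = G t.
Proof.
move=> cA oA At0 FG0 FG.
pose B := [set t | A t /\ F t = G t].
suff <- : B = A by move=> t [].
apply: cA; first by exists t0.
- exists B; last by apply/seteqP; split=> [t [At FGt]|t []] //.
  rewrite openE => t [At FGt]; have [cF cG _] := FG t At.
  have [U oU Uinj] := local_inj (F t).
  have n0 : \forall c \near t, A c by exact: open_nbhs_nbhs.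
  have n1 : \forall c \near t, U (F c) by apply: cF; exact: open_nbhs_nbhs.
  have n2 : \forall c \near t, U (G c).
    by apply: cG; rewrite -FGt; exact: open_nbhs_nbhs.
  apply: filterS (filterI n0 (filterI n1 n2)) => c [Ac [UF UG]]; split=> //.
  by apply: Uinj => //; have [] := FG c Ac.
- exists (closure B); first exact: closed_closure.
  apply/seteqP; split=> [t Bt|t [At clt]].
    by split; [case: Bt | exact: subset_closure].
  split=> //; apply: rdp.1 => P Q nP nQ; have [cF cG _] := FG t At.
  have nF : nbhs t (F @^-1` P) by exact: cF.
  have nG : nbhs t (G @^-1` Q) by exact: cG.
  have [c [[_ E1] [/= Pc Qc]]] := clt _ (filterI nF nG).
  by exists (F c); split=> //; rewrite E1.
Qed.

(** The segment from p x to b is connected, and both lifts start at x. *)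
Lemma lift_unique x r r' s s' b : is_lift x r s -> is_lift x r' s' ->
  nrm (b - p x) < r -> nrm (b - p x) < r' -> s b = s' b.
Proof.
move=> [sx H] [s'x H'] br br'.
pose h := b - p x; pose g (t : R) : E := p x + t%:C *: h.
pose rho := Num.min r r'.
pose I := [set t : R | `|t| * `|nrm h| < rho].
have gI t : I t -> nrm (g t - p x) < r /\ nrm (g t - p x) < r'.
  rewrite /I /= /rho (ger0_norm (nrm_ge0 h)) lt_min => /andP[h1 h2].
  by rewrite /g addrC addKr nrmZ nrm_real.
have cg : continuous g by exact: line_continuous.
have g1 : g 1 = b by rewrite /g rmorph1 scale1r /h subrKC.
rewrite -g1.
apply: (@lifts_agree R I (s \o g) (s' \o g) 0).
- exact: line_connected.
- have cn : continuous (fun t : R => `|t| * `|nrm h|).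
    move=> t; apply: (@continuousM R R Num.norm (fun=> `|nrm h|)).
      exact: norm_continuous.
    exact: cvg_cst.
  exact: (open_comp (fun t _ => cn t) (@open_lt _ rho)).
- have nb := nrm_ge0 (b - p x).
  by rewrite /I /= normr0 mul0r /rho lt_min; apply/andP; split; lra.
- by rewrite /= /g rmorph0 scale0r addr0 sx s'x.
- move=> t /gI[g_r g_r']; split.
  + by apply: continuous_comp; [exact: cg | exact: (H _ g_r).2].
  + by apply: continuous_comp; [exact: cg | exact: (H' _ g_r').2].
  + by rewrite /= (H _ g_r).1 (H' _ g_r').1.
- by rewrite /I /= normr1 mul1r (ger0_norm (nrm_ge0 h)) /rho lt_min br.
Qed.

(** The image of the segment from p x to b is connected. *)
Lemma lift_component x r s b : is_lift x r s -> nrm (b - p x) < r ->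
  connected_component [set: X] x (s b).
Proof.
move=> [sx H] br.
pose h := b - p x; pose g (t : R) : E := p x + t%:C *: h.
pose I := [set t : R | `|t| * `|nrm h| < r].
have gI t : I t -> nrm (g t - p x) < r.
  rewrite /I /= (ger0_norm (nrm_ge0 h)) => h1.
  by rewrite /g addrC addKr nrmZ nrm_real.
have cg : continuous g by exact: line_continuous.
exists ((s \o g) @` I); last first.
  exists 1; first by rewrite /I /= normr1 mul1r (ger0_norm (nrm_ge0 h)).
  by rewrite /= /g rmorph1 scale1r /h subrKC.
split=> //.
  exists 0; last by rewrite /= /g rmorph0 scale0r addr0 sx.
  by rewrite /I /= normr0 mul0r; exact: le_lt_trans (nrm_ge0 _) br.
apply: connected_continuous_connected; first exact: line_connected.
apply: continuous_in_subspaceT => t; rewrite inE => /gI g_r.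
by apply: continuous_comp; [exact: cg | exact: (H _ g_r).2].
Qed.

(** A continuous right inverse of a locally injective map is also a left inverse
    near the points of its image. *)
Lemma lift_near x r s b : is_lift x r s -> nrm (b - p x) < r ->
  \forall y \near s b, nrm (p y - p x) < r /\ s (p y) = y.
Proof.
move=> [sx H] br; have [psb cs] := H b br.
have [U oU Uinj] := local_inj (s b).
have n1 : \forall c \near b, U (s c) /\ nrm (c - p x) < r.
  apply: filterI; last exact: near_nrm_ball.
  by apply: cs; exact: open_nbhs_nbhs.
have n2 : \forall y \near s b, U (s (p y)) /\ nrm (p y - p x) < r.
  have := @p_continuous (s b) [set c | U (s c) /\ nrm (c - p x) < r].
  by rewrite psb; apply.
have n3 : \forall y \near s b, U y by exact: open_nbhs_nbhs.
apply: filterS (filterI n2 n3) => y [[Us yr] Uy]; split=> //.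
by apply: Uinj => //; have [] := H _ yr.
Qed.

Lemma lift_exists x : exists r s, 0 < r /\ is_lift x r s.
Proof.
have [U cU] := rdp.2 x; have [r r0 H] := chart_lift cU.
by exists r, ('pinv_(fun=> x) U p).
Qed.

Lemma lift_dist_ge x r s : 0 < r -> is_lift x r s -> (r%:E <= dist_pt p x)%E.
Proof.
move=> r0 L; have [sx H] := L.
apply: ereal_sup_ubound; exists r => //; split=> //.
pose B := ball (p x) r%:C.
have Bn b : B b <-> nrm (b - p x) < r by exact: ball_nrm.
have px : nrm (p x - p x) < r by rewrite subrr nrm0.
exists (s @` B).
  have := lift_near L px; rewrite sx; apply: filterS => y [yr ys].
  by exists (p y) => //; apply/Bn.
have inj : {in s @` B &, injective p}.
  move=> y z; rewrite !inE => -[b /Bn Bb <-] [c /Bn Bc <-].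
  by rewrite (H b Bb).1 (H c Bc).1 => ->.
split; first split=> //.
- by move=> _ [b Bb <-]; rewrite (H b _).1 //; apply/Bn.
- by move=> b Bb; exists (s b); [exists b | rewrite (H b _).1 //; apply/Bn].
- by apply: continuous_subspaceT => y; exact: p_continuous.
- apply: (@subspace_eq_continuous _ _ _ s).
    move=> b; rewrite inE => Bb; rewrite -{2}(H b _).1; last by apply/Bn.
    by apply/esym/(pinvKV _ inj); rewrite inE; exists b.
  by apply: continuous_in_subspaceT => b; rewrite inE => /Bn /H[].
Qed.

Lemma dist_lift x r : (r%:E < dist_pt p x)%E ->
  exists r' s, [/\ r < r', 0 < r' & is_lift x r' s].
Proof.
move=> /ereal_sup_gt[_ [r' [r'0 [U nU hU]] <-]]; rewrite lte_fin => rr'.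
by exists r', ('pinv_(fun=> x) U p); split=> //; exact: homeo_lift.
Qed.

Lemma idir_eq (f g : E -> R[i]) a r v n : hol_ball f a r ->
  (forall b, nrm (b - a) < r -> g b = f b) ->
  forall b, nrm (b - a) < r -> idir n v g b = idir n v f b.
Proof.
move=> hf gf; elim: n => [|n IH] b br; first exact: gf.
have [_ H] := @near_eq_diff R E (idir n v g) (idir n v f) b
  (filterS (fun c => IH c) (near_nrm_ball br)) (hol_ball_idir v n hf br).
exact: H.
Qed.

Lemma holomorphic_near f x r s : is_lift x r s -> 0 < r ->
  differentiable (f \o s) (p x) <-> differentiable (local_rep p f x) (p x).
Proof.
move=> L r0; have [r' r'0 L'] := chart_lift (chartP rdp x).
have px r1 : 0 < r1 -> nrm (p x - p x) < r1 by rewrite subrr nrm0.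
have E1 : \forall b \near p x, s b = 'pinv_(fun=> x) (get (is_chart p x)) p b.
  apply: filterS (filterI (near_nrm_ball (px r r0)) (near_nrm_ball (px r' r'0))) => b [b1 b2].
  exact: lift_unique L L' b1 b2.
split=> d.
  apply: (near_eq_diff _ d).1; apply: filterS E1 => b sb.
  by rewrite /local_rep /= -sb.
apply: (near_eq_diff _ d).1; apply: filterS E1 => b sb.
by rewrite /local_rep /= -sb.
Qed.

(** Holomorphy is defined with a chosen chart at each point; any lift serves. *)
Lemma holomorphicP f : (forall x, exists r s, [/\ 0 < r, is_lift x r s &
  differentiable (f \o s) (p x)]) -> holomorphic p f.
Proof.
by move=> H x; have [r [s [r0 L d]]] := H x; apply/(holomorphic_near f L r0).
Qed.

Lemma hol_lift f x r s : holomorphic p f -> is_lift x r s -> hol_ball (f \o s) (p x) r.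
Proof.
move=> hf L b br; have r'0 : 0 < r - nrm (b - p x) by lra.
have L' : is_lift (s b) (r - nrm (b - p x)) s by apply: lift_sub L r'0 _; lra.
have /(holomorphic_near f L' r'0) := hf (s b).
by rewrite (L.2 b br).1.
Qed.

(** The differentials at s b are defined by the chart chosen there; near b it
    agrees with the lift s by uniqueness. *)
Lemma dn_lift f x r s b n v : holomorphic p f -> is_lift x r s -> nrm (b - p x) < r ->
  dn p n f (s b) v = idir n v (f \o s) b.
Proof.
move=> hf L br; have r'0 : 0 < r - nrm (b - p x) by lra.
have L' : is_lift (s b) (r - nrm (b - p x)) s by apply: lift_sub L r'0 _; lra.
have [r1 r10 L1] := chart_lift (chartP rdp (s b)).
pose r2 := Num.min r1 (r - nrm (b - p x)).
have r20 : 0 < r2 by rewrite lt_min r10.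
have r21 : r2 <= r1 by rewrite ge_min lexx.
have r2r : r2 <= r - nrm (b - p x) by rewrite ge_min lexx orbT.
have psb := (L.2 b br).1.
rewrite /dn psb; apply: (@idir_eq (f \o s) (local_rep p f (s b)) b r2).
- by apply: (hol_ball_sub (hol_lift hf L)); lra.
- move=> c cb; rewrite /local_rep /=; congr f; apply: lift_unique L1 L' _ _.
    by rewrite psb; lra.
  by rewrite psb; lra.
- by rewrite subrr nrm0.
Qed.

Lemma taylor_term_lift f x r s b n v : holomorphic p f -> is_lift x r s ->
  nrm (b - p x) < r -> taylor_term p n f v (s b) = tay n v (f \o s) b.
Proof. by move=> hf L br; rewrite /taylor_term (dn_lift n v hf L br). Qed.

Lemma taylor_term_holomorphic f n v : holomorphic p f -> holomorphic p (taylor_term p n f v).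
Proof.
move=> hf; apply: holomorphicP => x; have [r [s [r0 L]]] := lift_exists x.
exists r, s; split; [exact: r0 | exact: L |].
have px : nrm (p x - p x) < r by rewrite subrr nrm0.
have d := (dZ (n`!%:R^-1) (hol_ball_idir v n (hol_lift hf L) px)).1.
apply: (near_eq_diff _ d).1; apply: filterS (near_nrm_ball px) => b br.
by rewrite /= (taylor_term_lift n v hf L br) /tay mulrC.
Qed.

(** The interior of the coincidence set is closed: for x in its closure, the Taylor
    series of f and g at a point of the interior close to x agree, and converge to f
    and g on a ball that contains x. *)
Lemma identity_theorem f g x0 : connected [set: X] ->
  holomorphic p f -> holomorphic p g -> (\forall y \near x0, f y = g y) -> f = g.
Proof.
move=> cX hf hg fg0.
pose B := interior [set y | f y = g y].
suff BT : B = [set: X].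
  apply/funext => x; have Bx : B x by rewrite BT.
  exact: (nbhs_singleton Bx).
apply: cX; first by exists x0.
- by exists B; [exact: open_interior | rewrite setTI].
exists (closure B); first exact: closed_closure.
rewrite setTI; apply/seteqP; split; first exact: subset_closure.
move=> x clx; have [r [s [r0 L]]] := lift_exists x.
have px : nrm (p x - p x) < r / 3 by rewrite subrr nrm0; lra.
have px' : nrm (p x - p x) < r by lra.
have n1 : \forall y \near x, nrm (p y - p x) < r / 3.
  by apply: (@p_continuous x [set c | nrm (c - p x) < r / 3]); exact: near_nrm_ball.
have n2 := lift_near L px'; rewrite L.1 in n2.
have [y [By [yr [_ spy]]]] := clx _ (filterI n1 n2).
have hF := hol_lift hf L; have hG := hol_lift hg L.
have pyr : nrm (p y - p x) < r by lra.
have [d d0 FGd] : exists2 d, 0 < d & forall b, nrm (b - p y) < d -> f (s b) = g (s b).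
  apply/nbhs_nrm; apply: ((L.2 _ pyr).2 [set z | f z = g z]).
  by rewrite spy; exact: By.
pose d' := Num.min d (r / 2).
have d'0 : 0 < d' by rewrite lt_min d0 divr_gt0.
have d'd : d' <= d by rewrite ge_min lexx.
have d'r : d' <= r / 2 by rewrite ge_min lexx orbT.
clearbody d'.
have FG b : nrm (b - p y) < r / 2 -> f (s b) = g (s b).
  move=> br.
  have hF2 : hol_ball (f \o s) (p y) (r / 2) by apply: (hol_ball_sub hF); lra.
  have hG2 : hol_ball (g \o s) (p y) (r / 2) by apply: (hol_ball_sub hG); lra.
  have TF := tay_series hF2 br; have TG := tay_series hG2 br.
  rewrite subrKC /= in TF TG; apply: (tends_unique TF).
  apply: eq_tends TG => N; apply: eq_bigr => n _; congr (_ / _).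
  apply: (@idir_eq _ _ (p y) d').
  - by apply: (hol_ball_sub hF); lra.
  - by move=> c cd; rewrite /= FGd //; lra.
  - by rewrite subrr nrm0.
have n3 : \forall y \near x, nrm (p y - p x) < r / 6.
  apply: (@p_continuous x [set c | nrm (c - p x) < r / 6]); apply: near_nrm_ball.
  by rewrite subrr nrm0; lra.
apply: filterS (filterI n3 n2) => z [zr [_ spz]].
rewrite /= -spz; apply: FG; have := nrm_tri (p x) (p z) (p y).
rewrite (nrmC (p x) (p y)); lra.
Qed.

End Lifts.

(** * Bounded sets and Taylor series of functions of bounded type *)

Section BoundedSets.
Context {R : realType} {E : completeNormedModType R[i]} {X : topologicalType}.
Variable p : X -> E.
Hypothesis rdp : riemann_domain p.
Implicit Types (x y : X) (a b h v : E) (r t e M : R) (s : E -> X) (B : set X).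

(** The point x + v of X, reached from x inside the largest ball around x; the
    junk value is x. *)
Definition sh x v : X :=
  xget x [set y | exists r s, [/\ nrm v < r, is_lift p x r s & y = s (p x + v)]].

Lemma sh_lift x r s v : is_lift p x r s -> nrm v < r -> sh x v = s (p x + v).
Proof.
move=> L vr; rewrite /sh; case: xgetP => [_ -> [r' [s' [vr' L' ->]]]|].
  by apply: (lift_unique rdp L' L); rewrite addrC addKr.
by move=> /(_ (s (p x + v)))[]; exists r, s.
Qed.

Lemma dist_setP B t : (t%:E < dist_set p B)%E -> forall x, B x -> (t%:E < dist_pt p x)%E.
Proof.
by move=> tB x Bx; apply: (lt_le_trans tB); apply: ereal_inf_lbound; exists x.
Qed.

Lemma dist_set_ge B t : (forall x, B x -> (t%:E <= dist_pt p x)%E) -> (t%:E <= dist_set p B)%E.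
Proof. by move=> H; apply: le_ereal_inf_tmp => _ [x Bx <-]; exact: H. Qed.

Lemma Xbounded_nrm B : Xbounded p B -> exists M, forall x, B x -> nrm (p x) <= M.
Proof.
move=> [[M [Mr HM]] _]; exists (complex.Re (M + 1)) => x Bx.
have /HM : M < M + 1 by rewrite ltrDl.
move=> /(_ (p x)) H; rewrite -(@lecR R) -nrmE RRe_real ?realD // H //.
Qed.

Lemma nrm_Xbounded B M t : 0 < t -> (forall x, B x -> nrm (p x) <= M) ->
  (forall x, B x -> (t%:E <= dist_pt p x)%E) -> Xbounded p B.
Proof.
move=> t0 BM Bt; split.
  exists M%:C; split; first by rewrite complex_real /=.
  move=> M' MM' _ [x Bx <-] /=; apply: le_trans (ltW MM').
  by rewrite nrmE lecR BM.
by apply: lt_le_trans (dist_set_ge Bt); rewrite lte_fin.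
Qed.

Lemma Hb_holomorphic (f : Hb p) : holomorphic p f.
Proof. by have /asboolP[] := Hb_funP f. Qed.

Lemma Hb_bounded (f : Hb p) B : Xbounded p B -> exists M, forall x, B x -> nrm (f x) <= M.
Proof.
move=> XB; have /asboolP[_ /(_ B XB)[M [Mr HM]]] := Hb_funP f.
exists (complex.Re (M + 1)) => x Bx.
have /HM : M < M + 1 by rewrite ltrDl.
move=> /(_ x Bx) H; rewrite -(@lecR R) -nrmE RRe_real ?realD //.
Qed.

Lemma Hb_memP (f : X -> R[i]) : holomorphic p f ->
  (forall B, Xbounded p B -> exists M, forall x, B x -> nrm (f x) <= M) ->
  f \in Hb_pred p.
Proof.
move=> hf bf; apply/asboolP; split=> // B /bf[M HM].
exists M%:C; split; first by rewrite complex_real /=.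
move=> M' MM' x Bx /=; apply: le_trans (ltW MM').
by rewrite nrmE lecR HM.
Qed.

(** The union of the closed balls of radius t about the points of B, taken inside X. *)
Definition thick B t : set X := [set y | exists x v, [/\ B x, nrm v <= t & y = sh x v]].

Lemma sh0 x : sh x 0 = x.
Proof.
have [r [s [r0 L]]] := lift_exists rdp x.
by rewrite (sh_lift L) ?nrm0 // addr0 L.1.
Qed.

Lemma p_sh x v : ((nrm v)%:E < dist_pt p x)%E -> p (sh x v) = p x + v.
Proof.
move=> /dist_lift[r [s [vr r0 L]]]; rewrite (sh_lift L) //.
by have [] := L.2 (p x + v); rewrite // addrC addKr.
Qed.

Lemma dist_pt_sh x v t : (t%:E < dist_pt p x)%E -> nrm v < t ->
  ((t - nrm v)%:E <= dist_pt p (sh x v))%E.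
Proof.
move=> /dist_lift[r [s [tr r0 L]]] vt; rewrite (sh_lift L); last by lra.
have q0 : 0 < r - nrm v by lra.
have L' : is_lift p (s (p x + v)) (r - nrm v) s.
  by apply: (lift_sub L q0); rewrite [p x + v - _]addrC addKr; lra.
by apply: le_trans (lift_dist_ge rdp q0 L'); rewrite lee_fin; lra.
Qed.

Lemma thick_dist B t t' : (t'%:E < dist_set p B)%E -> t < t' ->
  forall y, thick B t y -> ((t' - t)%:E <= dist_pt p y)%E.
Proof.
move=> t'B tt' y [x [v [Bx vt ->]]].
apply: le_trans (dist_pt_sh (dist_setP t'B Bx) (_ : nrm v < t')); last by lra.
by rewrite lee_fin; lra.
Qed.

Lemma ereal_dense t (d : \bar R) : (t%:E < d)%E -> exists2 t', t < t' & (t'%:E < d)%E.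
Proof.
case: d => [d| |] //; first by rewrite lte_fin => td; exists ((t + d) / 2);
  rewrite ?lte_fin; lra.
by move=> _; exists (t + 1); [lra | exact: ltry].
Qed.

(** Moving by at most t reduces the distance to the boundary by at most t. *)
Lemma thick_Xbounded B t : Xbounded p B -> 0 <= t -> (t%:E < dist_set p B)%E ->
  Xbounded p (thick B t).
Proof.
move=> XB t0 tB; have [t' tt' t'B] := ereal_dense tB.
have [M HM] := Xbounded_nrm XB.
apply: (@nrm_Xbounded _ (M + t) (t' - t)); first by lra.
  move=> y [x [v [Bx vt ->]]]; rewrite p_sh.
    by apply: (le_trans (nrmD _ _)); apply: lerD => //; exact: HM.
  by apply: le_lt_trans (dist_setP tB Bx); rewrite lee_fin.
exact: thick_dist t'B tt'.
Qed.

Lemma Xbounded1 x : Xbounded p [set x].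
Proof.
split; last by rewrite /dist_set image_set1 ereal_inf1; exact: dist_pt_gt0.
by rewrite image_set1; exists `|p x|; split=> // M /ltW Mx _ /= ->.
Qed.

(** The bound is the one on [thick p B t]. *)
Lemma Hb_lift_bounded (f : Hb p) B t : Xbounded p B -> 0 <= t -> (t%:E < dist_set p B)%E ->
  exists2 M, 0 <= M & forall x, B x -> exists r s, [/\ t < r, is_lift p x r s &
    forall b, nrm (b - p x) <= t -> nrm (f (s b)) <= M].
Proof.
move=> XB t0 tB; have [M HM] := Hb_bounded f (thick_Xbounded XB t0 tB).
exists (Num.max 0 M); first by rewrite le_max lexx.
move=> x Bx; have [r [s [tr r0 L]]] := dist_lift (dist_setP tB Bx).
exists r, s; split=> // b bt; rewrite le_max; apply/orP; right; apply: HM.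
exists x, (b - p x); split=> //; rewrite (sh_lift L) ?subrKC //; lra.
Qed.

(** Cauchy's estimate on a thickening B' of B that does not depend on v. If v is
    longer than the available radius, the ratio q is less than 1, and the bound
    still shows that each Taylor term is of bounded type and depends continuously
    on f. *)
Lemma taylor_bound B v : Xbounded p B -> exists B' q, [/\ Xbounded p B', 0 < q &
  forall n (f : Hb p) M, (forall y, B' y -> nrm (f y) <= M) ->
    forall x, B x -> nrm (taylor_term p n f v x) <= 2 * M / q ^+ n].
Proof.
move=> XB; have [t t0 tB] := ereal_dense XB.2.
have nv := nrm_ge0 v; have v1 : 0 < nrm v + 1 by lra.
pose q := t / (nrm v + 1); have q0 : 0 < q by rewrite divr_gt0.
have qv : q * nrm v <= t by rewrite /q mulrAC ler_pdivrMr // ler_wpM2l //; lra.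
exists (thick B t), q; split=> // [|n f M HM x Bx].
  exact: thick_Xbounded XB (ltW t0) tB.
have [r [s [tr r0 L]]] := dist_lift (dist_setP tB Bx).
have px : nrm (p x - p x) < r by rewrite subrr nrm0; lra.
have := taylor_term_lift rdp n v (Hb_holomorphic f) L px; rewrite L.1 => ->.
apply: (tay_bound n (hol_lift rdp (Hb_holomorphic f) L) q0); first by lra.
move=> b bq; apply: HM; exists x, (b - p x).
by split=> //; [lra | rewrite (sh_lift L) ?subrKC //; lra].
Qed.

Lemma taylor_Hb n v (f : Hb p) : taylor_term p n f v \in Hb_pred p.
Proof.
apply: Hb_memP; first exact: (taylor_term_holomorphic rdp n v (Hb_holomorphic f)).
move=> B /(taylor_bound v)[B' [q [XB' _ H]]].
by have [M HM] := Hb_bounded f XB'; exists (2 * M / q ^+ n) => x; exact: H.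
Qed.

Definition tayHb n v (f : Hb p) : Hb p := MkHb (taylor_Hb n v f).

Definition taysum N v (f : Hb p) : Hb p := \sum_(n < N) tayHb n v f.

Lemma Hb_sum_fun N (F : nat -> Hb p) x :
  (\sum_(n < N) F n) x = \sum_(n < N) (F n x) :> R[i].
Proof.
elim: N => [|N IH]; first by rewrite !big_ord0.
by rewrite !big_ord_recr /= -IH.
Qed.

Lemma ratio_gt1 (n t : R) : 0 <= n -> n < t -> exists2 q : R, 1 < q & q * n <= t.
Proof.
move=> n0 nt; have n1 : 0 < n + 1 by lra.
exists (1 + (t - n) / (n + 1)); first by rewrite ltrDl divr_gt0 //; lra.
have : (t - n) / (n + 1) * n <= t - n.
  by rewrite mulrAC ler_pdivrMr // ler_wpM2l //; lra.
by rewrite [(1 + _) * _]mulrDl mul1r; lra.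
Qed.

(** The remainder of the Taylor series is geometric in the ratio of |v| to the
    radius, uniformly over B. *)
Theorem taylor_unif B v (f : Hb p) : Xbounded p B -> ((nrm v)%:E < dist_set p B)%E ->
  forall e, 0 < e -> exists K, forall N, (K <= N)%N -> forall x, B x ->
    nrm (taysum N v f x - f (sh x v)) <= e.
Proof.
move=> XB /ereal_dense[t vt tB] e e0; have nv := nrm_ge0 v.
have t0 : 0 <= t by lra.
have [M M0 HM] := Hb_lift_bounded f XB t0 tB.
have [q q1 qv] := ratio_gt1 nv vt; have q0 : 0 < q by lra.
have q01 : 0 <= q^-1 < 1 by rewrite invr_ge0 (ltW q0) invf_lt1.
have [K HK] := geom_small (2 * M * (1 - q^-1)^-1) q01 e0.
exists K => N KN x Bx; have [r [s [tr L H]]] := HM x Bx.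
apply: le_trans (HK N KN); rewrite nrmC (mulrAC (2 * M)).
have px : nrm (p x - p x) < r by rewrite subrr nrm0; lra.
have qr : q * nrm v < r by lra.
have Hq b : nrm (b - p x) <= q * nrm v -> nrm ((f \o s) b) <= M.
  by move=> bq; apply: H; lra.
have := tay_series_bound N (hol_lift rdp (Hb_holomorphic f) L) q1 qr Hq.
rewrite (sh_lift L); last by lra.
rewrite /taysum (Hb_sum_fun N (fun n => tayHb n v f)); congr (nrm (_ - _) <= _).
apply: eq_bigr => n _ /=.
by have := taylor_term_lift rdp n v (Hb_holomorphic f) L px; rewrite L.1 => ->.
Qed.

End BoundedSets.

(** * Continuous functionals on the algebra of functions of bounded type *)

Section HbTopology.
Context {R : realType} {E : completeNormedModType R[i]} {X : topologicalType}.
Variable p : X -> E.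
Implicit Types (x y : X) (e M : R) (B : set X).

Lemma entourage_nrm (Q : set (R[i] * R[i])) : entourage Q <->
  exists2 e, 0 < e & forall z w : R[i], nrm (w - z) < e -> Q (z, w).
Proof.
rewrite -entourage_ballE; split=> [[e /= /gt0_toC[r r0 ->] H]|[e e0 H]].
  by exists r => // z w zw; apply: H => /=; apply/ball_nrm.
by exists e%:C => /= [|[z w] /= /ball_nrm]; [rewrite (@ltcR R 0) | exact: H].
Qed.

Lemma Xbounded0 : Xbounded p set0.
Proof.
split; last by rewrite /dist_set image_set0 ereal_inf0 ltry.
by rewrite image_set0; exists 0; split=> // M _ x [].
Qed.

Lemma XboundedU B B' : Xbounded p B -> Xbounded p B' -> Xbounded p (B `|` B').
Proof.
move=> XB XB'; have [M HM] := Xbounded_nrm XB; have [M' HM'] := Xbounded_nrm XB'.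
have [t t0 tB] := ereal_dense XB.2; have [t' t'0 tB'] := ereal_dense XB'.2.
apply: (@nrm_Xbounded _ _ _ _ _ (Num.max M M') (Num.min t t')).
- by rewrite lt_min t0.
- by move=> x [/HM|/HM'] H; rewrite le_max H ?orbT.
- move=> x [/(dist_setP tB)|/(dist_setP tB')] /ltW; apply: le_trans;
    by rewrite lee_fin ge_min lexx ?orbT.
Qed.

(** Finite unions of X-bounded sets are X-bounded, so that the sets on the right
    already form a basis of neighbourhoods. *)
Lemma Hb_nbhsP (f0 : Hb p) (P : set (Hb p)) : nbhs f0 P <->
  exists B e, [/\ Xbounded p B, 0 < e &
    forall f : Hb p, (forall x, B x -> nrm (f x - f0 x) <= e) -> P f].
Proof.
split.
  move=> [_ [[/= A oA <-] Af0 AP]].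
  pose F : set_system (X -> R[i]) := [set W | exists B e, [/\ Xbounded p B, 0 < e &
    forall h : X -> R[i], (forall x, B x -> nrm (h x - f0 x) <= e) -> W h]].
  have FF : Filter F.
    split.
    - by exists set0, 1; split=> //; exact: Xbounded0.
    - move=> W W' [B [e [XB e0 H]]] [B' [e' [XB' e'0 H']]].
      exists (B `|` B'), (Num.min e e'); split; first exact: XboundedU.
        by rewrite lt_min e0.
      move=> h Hh; split; [apply: H|apply: H'] => x Bx.
        by apply: (le_trans (Hh x _)); [left | rewrite ge_min lexx].
      by apply: (le_trans (Hh x _)); [right | rewrite ge_min lexx orbT].
    - move=> W W' WW' [B [e [XB e0 H]]]; exists B, e; split=> // h Hh.
      by apply/WW'/H.
  have Fc : {family Xbounded p, F --> (f0 : X -> R[i])}.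
    apply/fam_cvgP => B XB W /uniform_nbhs[Q [/entourage_nrm[e e0 HQ] QW]].
    exists B, (e / 2); split=> //; first by rewrite divr_gt0.
    move=> h Hh; apply: QW => y By; apply: HQ.
    by apply: le_lt_trans (Hh y By) _; lra.
  have [B [e [XB e0 H]]] := Fc A (open_nbhs_nbhs (conj oA Af0)).
  by exists B, e; split=> // f /H/AP.
move=> [B [e [XB e0 H]]].
have /fam_cvgP/(_ _ XB) :=
  @initial_continuous (Hb p) {family Xbounded p, X -> R[i]} (@Hb_fun R E X p) f0.
have FF : Filter (Hb_fun g @[g --> f0]) by apply: fmap_filter; exact: nbhs_filter.
move=> /(_ FF [set h : X -> R[i] | forall y, B y -> nrm (h y - f0 y) < e]).
have nQ : nbhs ((f0 : X -> R[i]) : {uniform` B -> R[i]})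
    [set h : X -> R[i] | forall y, B y -> nrm (h y - f0 y) < e].
  apply/uniform_nbhs; exists [set zw | nrm (zw.2 - zw.1) < e]; split=> //.
  by apply/entourage_nrm; exists e.
move=> /(_ nQ) nW.
have {}nW : nbhs f0 [set f : Hb p | forall y, B y -> nrm (f y - f0 y) < e].
  exact: nW.
apply: filterS nW => f Hf; apply: H => x Bx.
by apply: ltW; exact: Hf.
Qed.

End HbTopology.

Section Functionals.
Context {R : realType} {E : completeNormedModType R[i]} {X : topologicalType}.
Variable p : X -> E.
Hypothesis rdp : riemann_domain p.
Implicit Types (x y : X) (e M : R) (B : set X) (phi : Hb p -> R[i]) (f g : Hb p).

Lemma HbD f g x : (f + g) x = f x + g x. Proof. by []. Qed.
Lemma HbM f g x : (f * g) x = f x * g x. Proof. by []. Qed.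
Lemma HbZ c f x : (c *: f) x = c * f x. Proof. by []. Qed.
Lemma HbB f g x : (f - g) x = f x - g x. Proof. by []. Qed.
Lemma Hb1 x : (1 : Hb p) x = 1. Proof. by []. Qed.
Lemma Hb0 x : (0 : Hb p) x = 0. Proof. by []. Qed.

(** Stated with upper bounds M of f on B rather than with the supremum, which may
    be -oo when B is empty. *)
Definition le_on phi (C : R) B := forall f M, 0 <= M ->
  (forall x, B x -> nrm (f x) <= M) -> nrm (phi f) <= C * M.

Lemma HbP f g : (forall x, f x = g x) -> f = g.
Proof. by move=> fg; apply: val_inj; apply/funext => x; exact: fg. Qed.

Section Linear.
Variable phi : Hb p -> R[i].
Hypothesis phi_lin : linear phi.

Lemma linD f g : phi (f + g) = phi f + phi g.
Proof. by have := phi_lin 1 f g; rewrite !scale1r. Qed.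

Lemma lin0 : phi 0 = 0.
Proof. by apply: (addrI (phi 0)); rewrite -linD !addr0. Qed.

Lemma linZ c f : phi (c *: f) = c * phi f.
Proof. by have := phi_lin c f 0; rewrite !addr0 lin0 addr0. Qed.

Lemma linB f g : phi (f - g) = phi f - phi g.
Proof. by rewrite -scaleN1r linD linZ mulN1r. Qed.

Lemma lin_sum N (F : nat -> Hb p) : phi (\sum_(n < N) F n) = \sum_(n < N) phi (F n).
Proof.
elim: N => [|N IH]; first by rewrite !big_ord0 lin0.
by rewrite !big_ord_recr /= linD IH.
Qed.

Lemma le_on_continuous C B : Xbounded p B -> le_on phi C B -> continuous phi.
Proof.
move=> XB H f; apply/continuous_nrmP => e e0; apply/Hb_nbhsP.
have C1 : 0 < `|C| + 1 by rewrite ltr_wpDl.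
exists B, (e / (`|C| + 1) / 2); split=> //; first by rewrite !divr_gt0.
move=> g Hg; rewrite -linB.
have q0 : 0 <= e / (`|C| + 1) / 2 by rewrite !divr_ge0 // ltW.
apply: le_lt_trans (H (g - f) _ q0 Hg) _.
have : C * (e / (`|C| + 1) / 2) <= (`|C| + 1) * (e / (`|C| + 1) / 2).
  by apply: ler_wpM2r => //; apply: le_trans (ler_norm _) _; rewrite lerDl.
have -> : (`|C| + 1) * (e / (`|C| + 1) / 2) = e / 2 by field; rewrite gt_eqF.
lra.
Qed.

(** Continuity at 0 gives a neighbourhood of 0 on which phi is bounded by 1;
    rescale. *)
Lemma continuous_le_on : continuous phi ->
  exists C B, [/\ Xbounded p B, 0 <= C & le_on phi C B].
Proof.
move=> /(_ 0)/continuous_nrmP/(_ 1 ltr01)/Hb_nbhsP[B [e [XB e0 H]]].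
exists e^-1, B; split=> //; first by rewrite invr_ge0 ltW.
move=> f M M0 HM; rewrite -subr_le0; apply: (@le_eps R _ e^-1) => d d0.
have Md : 0 < M + d by lra.
(* d > 0 avoids dividing by M = 0. *)
pose c : R := e / (M + d); have c0 : 0 < c by rewrite divr_gt0.
have : nrm (phi (c%:C *: f)) <= 1.
  have := H (c%:C *: f); rewrite lin0 subr0 => H1; apply/ltW/H1 => x Bx.
  rewrite Hb0 subr0 HbZ nrmM nrm_real gtr0_norm // /c mulrAC ler_pdivrMr //.
  by rewrite ler_pM2l //; have := HM x Bx; lra.
rewrite linZ nrmM nrm_real gtr0_norm // mulrC -ler_pdivlMr // mul1r => H1.
rewrite lerBlDr; apply: (le_trans H1); rewrite /c invf_div mulrDl.
by rewrite [M / e]mulrC addrC.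
Qed.

End Linear.

(** Domination of phi by B, in the form of [le_on]. *)
Definition dom phi B := le_on phi 1 B.

Section Multiplicative.
Variable phi : Hb p -> R[i].
Hypothesis phi_lin : linear phi.
Hypothesis phi_mul : {morph phi : f g / f * g}.
Hypothesis phi1 : phi 1 = 1.

(** The estimate for the powers of f reads |phi f|^n <= C M^n; letting n grow
    removes the constant. *)
Lemma le_on_dom C B : 0 <= C -> le_on phi C B -> dom phi B.
Proof.
move=> C0 H f M M0 HM; rewrite mul1r leNgt; apply/negP => Mf.
have f0 : 0 < nrm (phi f) by lra.
have phiX n : phi (f ^+ n) = phi f ^+ n.
  by elim: n => [|n IH]; rewrite ?expr0 // !exprS phi_mul IH.
have HX n : nrm (phi f) ^+ n <= C * M ^+ n.
  rewrite -nrmX -phiX; apply: H => [|x Bx]; first by rewrite exprn_ge0.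
  have -> : (f ^+ n) x = f x ^+ n.
    by elim: n => [|n IH]; rewrite ?expr0 // !exprS HbM IH.
  by rewrite nrmX lerXn2r ?nnegrE ?nrm_ge0 //; exact: HM.
have q01 : 0 <= M / nrm (phi f) < 1.
  by rewrite divr_ge0 ?(ltW f0) //= ltr_pdivrMr // mul1r.
have h2 : 0 < 1 / 2 :> R by lra.
have [n0 Hn] := geom_small C q01 h2.
have := Hn n0 (leqnn _); have := HX n0.
rewrite exprMn exprVn mulrA ler_pdivrMr ?exprn_gt0 //.
have : 0 < nrm (phi f) ^+ n0 by rewrite exprn_gt0.
lra.
Qed.

Lemma dominated_dom B : dominated phi B -> dom phi B.
Proof.
move=> H f M M0 HM; rewrite mul1r -lee_fin; apply: le_trans (H f) _.
by apply: ge_ereal_sup => _ [x Bx <-]; rewrite lee_fin; exact: HM.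
Qed.

Lemma dom_dominated B : dom phi B -> dominated phi B.
Proof.
move=> H f; have [x0 Bx0] : exists x, B x.
  apply/not_existsP => B0; have := H 1 0 (lexx 0) (fun x Bx => False_ind _ (B0 x Bx)).
  by rewrite phi1 nrm1 mulr0; lra.
have s0 : ((nrm (f x0))%:E <= sup_norm f B)%E.
  by apply: ereal_sup_ubound; exists x0.
case S : (sup_norm f B) s0 => [s| |] //=.
- rewrite !lee_fin => fs.
  have := H f s (le_trans (nrm_ge0 _) fs); rewrite mul1r; apply => x Bx.
  by rewrite -lee_fin -S; apply: ereal_sup_ubound; exists x.
- by move=> _; exact: leey.
Qed.

End Multiplicative.

End Functionals.

(** * Translates of characters *)

Section Translates.
Context {R : realType} {E : completeNormedModType R[i]} {X : topologicalType}.
Variable p : X -> E.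
Hypothesis rdp : riemann_domain p.
Implicit Types (x y : X) (v w : E) (t e M rho : R) (B : set X) (f g : Hb p).
Implicit Types (phi : Hb p -> R[i]).

Local Notation tayHb := (tayHb rdp).
Local Notation taysum := (taysum rdp).

Lemma tay1 w (F : E -> R[i]) b : tay 1 w F b = 'd F b w.
Proof. by rewrite /tay (_ : 1`! = 1%N) // divr1. Qed.

(** phi^v, as a limit of the values of phi on Taylor polynomials. *)
Definition tr phi v : Hb p -> R[i] := fun f =>
  xget 0 [set l | tends (fun N => phi (taysum N v f)) l].

(** A continuous unital character with dist (phi) >= rho, as a property of a bare
    functional: translates are first studied without projecting them to E. *)
Definition character phi rho := [/\ linear phi, {morph phi : f g / f * g}, phi 1 = 1 &
  forall t, t < rho -> exists B, [/\ Xbounded p B, (t%:E < dist_set p B)%E & dom phi B]].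

(** Bounds of u N on B pass to phi (u N), then to the limit. All identities for
    translates reduce in this way to identities for the values f (x + v), x in B. *)
Lemma dom_limit phi B (u : nat -> Hb p) l M : dom phi B -> 0 <= M ->
  tends (fun N => phi (u N)) l ->
  (forall e, 0 < e -> exists K, forall N, (K <= N)%N -> forall x, B x ->
    nrm (u N x) <= M + e) -> nrm l <= M.
Proof.
move=> dB M0 ul H; rewrite -subr_le0; apply: (@le_eps R _ 1) => e e0.
have [K HK] := H e e0; rewrite mulr1 lerBlDr addrC.
have : nrm (l - 0) <= M + e.
  apply: (tends_le ul (K := K)) => N KN; rewrite subr0.
  by have := dB (u N) (M + e) _ (HK N KN); rewrite mul1r; apply; lra.
by rewrite subr0.
Qed.

Lemma dom_limit0 phi B (u : nat -> Hb p) l : dom phi B ->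
  tends (fun N => phi (u N)) l ->
  (forall e, 0 < e -> exists K, forall N, (K <= N)%N -> forall x, B x ->
    nrm (u N x) <= e) -> l = 0.
Proof.
move=> dB ul H; apply: nrm_le0; apply: (dom_limit dB (lexx 0) ul) => e e0.
by have [K HK] := H e e0; exists K => N KN x Bx; rewrite add0r; exact: HK.
Qed.

Section OneFunctional.
Variable phi : Hb p -> R[i].
Hypothesis phi_lin : linear phi.
Hypothesis phi_mul : {morph phi : f g / f * g}.
Hypothesis phi1 : phi 1 = 1.

Section FixedB.
Variable B : set X.
Hypothesis XB : Xbounded p B.
Hypothesis phiB : dom phi B.

Lemma tr_tends v f : ((nrm v)%:E < dist_set p B)%E ->
  tends (fun N => phi (taysum N v f)) (tr phi v f).
Proof.
move=> vB; rewrite /tr; case: xgetP => [l _ //|noL].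
have [l Hl] : exists l, tends (fun N => phi (taysum N v f)) l; last by case: (noL l).
apply: cauchy_tends => e e0; have e20 : 0 < e / 2 by lra.
have [K HK] := taylor_unif rdp f XB vB e20.
exists K => k m Kk Km; rewrite -(linB phi_lin).
have := phiB (_ : 0 <= e) (_ : forall x, B x -> nrm ((taysum k v f - taysum m v f) x) <= e).
rewrite mul1r; apply; first exact: ltW.
move=> x Bx; rewrite HbB.
have := nrm_tri (f (sh p x v)) (taysum k v f x) (taysum m v f x).
have := HK k Kk x Bx; have := HK m Km x Bx; rewrite (nrmC (f _)); lra.
Qed.

Let sh_bounded v f : ((nrm v)%:E < dist_set p B)%E ->
  exists2 M, 0 <= M & forall x, B x -> nrm (f (sh p x v)) <= M.
Proof.
move=> vB; have nv := nrm_ge0 v; have [M M0 HM] := Hb_lift_bounded rdp f XB nv vB.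
exists M => // x Bx; have [r [s [vr L H]]] := HM x Bx.
by rewrite (sh_lift rdp L vr); apply: H; rewrite addrC addKr.
Qed.

Lemma tr_linear v : ((nrm v)%:E < dist_set p B)%E -> linear (tr phi v).
Proof.
move=> vB c f g; apply/eqP; rewrite -subr_eq0 opprD addrA; apply/eqP.
pose u N := taysum N v (c *: f + g) - c *: taysum N v f - taysum N v g.
apply: (dom_limit0 phiB (u := u)).
  have := tendsB (tendsB (tr_tends (c *: f + g) vB) (tendsZ c (tr_tends f vB)))
    (tr_tends g vB).
  by apply: eq_tends => N; rewrite /u !(linB phi_lin) (linZ phi_lin).
move=> e e0; have nc := nrm_ge0 c.
have c3 : 0 < 3 * (nrm c + 1) by lra.
have [K1 H1] := taylor_unif rdp (c *: f + g) XB vB (divr_gt0 e0 c3).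
have [K2 H2] := taylor_unif rdp f XB vB (divr_gt0 e0 c3).
have [K3 H3] := taylor_unif rdp g XB vB (divr_gt0 e0 c3).
exists (maxn K1 (maxn K2 K3)) => N; rewrite !geq_max => /and3P[N1 N2 N3] x Bx.
have h1 := H1 N N1 x Bx; have h2 := H2 N N2 x Bx; have h3 := H3 N N3 x Bx.
rewrite /u !HbB !HbZ.
rewrite HbD HbZ in h1.
set a := taysum N v (c *: f + g) x in h1 *; set b := taysum N v f x in h2 *.
set d := taysum N v g x in h3 *.
have -> : a - c * b - d = (a - (c * f (sh p x v) + g (sh p x v)))
  - c * (b - f (sh p x v)) - (d - g (sh p x v)) by ring.
apply: (le_trans (nrmB _ _)); apply: (le_trans (lerD (nrmB _ _) (lexx _))).
rewrite nrmM; have : nrm c * nrm (b - f (sh p x v)) <= nrm c * (e / (3 * (nrm c + 1))).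
  exact: ler_wpM2l.
have E1 : e / (3 * (nrm c + 1)) * (3 * (nrm c + 1)) = e by rewrite divfK // gt_eqF.
have q0 : 0 < e / (3 * (nrm c + 1)) by rewrite divr_gt0.
move: (e / (3 * (nrm c + 1))) E1 q0 h1 h2 h3 => q E1 q0 h1 h2 h3 h4.
have : nrm c * q >= 0 by rewrite mulr_ge0 // ltW.
lra.
Qed.

(** Taylor polynomials of f g differ from products of Taylor polynomials, but both
    converge to f (x + v) g (x + v) uniformly on B; this replaces Leibniz's formula. *)
Lemma tr_mul v : ((nrm v)%:E < dist_set p B)%E -> {morph tr phi v : f g / f * g}.
Proof.
move=> vB f g; apply/eqP; rewrite -subr_eq0; apply/eqP.
pose u N := taysum N v (f * g) - taysum N v f * taysum N v g.
apply: (dom_limit0 phiB (u := u)).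
  have := tendsB (tr_tends (f * g) vB) (tendsM (tr_tends f vB) (tr_tends g vB)).
  by apply: eq_tends => N; rewrite /u (linB phi_lin) phi_mul.
have [M1 M10 HM1] := sh_bounded f vB; have [M2 M20 HM2] := sh_bounded g vB.
move=> e e0.
have c3 : 0 < 3 * (M1 + M2 + 1) by lra.
pose q := Num.min 1 (e / (3 * (M1 + M2 + 1))).
have q0 : 0 < q by rewrite lt_min ltr01 divr_gt0.
have q1 : q <= 1 by rewrite ge_min lexx.
have qe : q * (3 * (M1 + M2 + 1)) <= e.
  by rewrite -ler_pdivlMr // ge_min lexx orbT.
clearbody q.
have [K1 H1] := taylor_unif rdp (f * g) XB vB q0.
have [K2 H2] := taylor_unif rdp f XB vB q0.
have [K3 H3] := taylor_unif rdp g XB vB q0.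
exists (maxn K1 (maxn K2 K3)) => N; rewrite !geq_max => /and3P[N1 N2 N3] x Bx.
have h1 := H1 N N1 x Bx; have h2 := H2 N N2 x Bx; have h3 := H3 N N3 x Bx.
have m1 := HM1 x Bx; have m2 := HM2 x Bx.
rewrite /u HbB HbM; rewrite HbM in h1.
set a := taysum N v (f * g) x in h1 *; set b := taysum N v f x in h2 *.
set d := taysum N v g x in h3 *; set F := f _ in h1 h2 m1; set G := g _ in h1 h3 m2.
have -> : a - b * d = (a - F * G) - (b - F) * (d - G) - (b - F) * G - F * (d - G) by ring.
apply: (le_trans (nrmB _ _)); apply: (le_trans (lerD (nrmB _ _) (lexx _))).
apply: (le_trans (lerD (lerD (nrmB _ _) (lexx _)) (lexx _))); rewrite !nrmM.
have k1 : nrm (b - F) * nrm (d - G) <= q * 1.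
  by apply: ler_pM; rewrite ?nrm_ge0 //; lra.
have k2 : nrm (b - F) * nrm G <= q * M2 by apply: ler_pM; rewrite ?nrm_ge0.
have k3 : nrm F * nrm (d - G) <= M1 * q by apply: ler_pM; rewrite ?nrm_ge0.
have : 0 <= q * M1 by rewrite mulr_ge0 // ltW.
have : 0 <= q * M2 by rewrite mulr_ge0 // ltW.
lra.
Qed.

Lemma tr_one v : ((nrm v)%:E < dist_set p B)%E -> tr phi v 1 = 1.
Proof.
move=> vB; apply/eqP; rewrite -subr_eq0; apply/eqP.
pose u N := taysum N v 1 - 1.
apply: (dom_limit0 phiB (u := u)).
  have := tendsB (tr_tends 1 vB) (tends_cst 1).
  by apply: eq_tends => N; rewrite /u (linB phi_lin) phi1.
move=> e e0; have [K HK] := taylor_unif rdp 1 XB vB e0.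
by exists K => N KN x Bx; rewrite /u HbB; exact: HK.
Qed.

(** The values f (x + v), x in B, are values of f on the thickening of B. *)
Lemma tr_dom v t : ((nrm v)%:E < dist_set p B)%E -> nrm v <= t ->
  dom (tr phi v) (thick p B t).
Proof.
move=> vB vt f M M0 HM; rewrite mul1r.
apply: (dom_limit phiB M0 (tr_tends f vB)) => e e0.
have [K HK] := taylor_unif rdp f XB vB e0; exists K => N KN x Bx.
have := nrmD (taysum N v f x - f (sh p x v)) (f (sh p x v)); rewrite subrK.
have : nrm (f (sh p x v)) <= M by apply: HM; exists x, v.
have := HK N KN x Bx; lra.
Qed.

(** On B the translate of gamma o p is gamma o p + gamma v. *)
Lemma tr_dual v (gamma : topdual) : ((nrm v)%:E < dist_set p B)%E ->
  tr phi v (dual_comp rdp gamma) = phi (dual_comp rdp gamma) + gamma v.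
Proof.
move=> vB; apply/eqP; rewrite -subr_eq0 opprD addrA; apply/eqP.
pose f := dual_comp rdp gamma.
pose u N := taysum N v f - f - gamma v *: (1 : Hb p).
apply: (dom_limit0 phiB (u := u)).
  have := tendsB (tendsB (tr_tends f vB) (tends_cst (phi f))) (tends_cst (gamma v)).
  by apply: eq_tends => N; rewrite /u !(linB phi_lin) (linZ phi_lin) phi1 mulr1.
move=> e e0; have [K HK] := taylor_unif rdp f XB vB e0.
exists K => N KN x Bx; have := HK N KN x Bx.
have -> : f (sh p x v) = f x + gamma v.
  have fE y : f y = gamma (p y) by [].
  by rewrite !fE p_sh ?linearD //; exact: dist_setP vB _ Bx.
by rewrite /u !HbB HbZ Hb1 mulr1 opprD addrA.
Qed.

Lemma tayHb1_lin f : (forall w w', tayHb 1 (w + w') f = tayHb 1 w f + tayHb 1 w' f) /\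
  (forall c w, tayHb 1 (c *: w) f = c *: tayHb 1 w f).
Proof.
split=> [w w'|c w]; apply: HbP => x.
  rewrite HbD /= /taylor_term /dn /= -mulrDl; congr (_ / _).
  exact: linearD.
rewrite HbZ /= /taylor_term /dn /= mulrA; congr (_ / _).
exact: linearZ.
Qed.

(** The functions v -> f (x + v), x in B, satisfy the second order estimate of
    [cauchy_first_second] with a common constant; applying phi preserves it. *)
Lemma tr_fder v f : ((nrm v)%:E < dist_set p B)%E ->
  bounded_lin (fun w => tr phi v (tayHb 1 w f)) /\
  fder (fun v => tr phi v f) v (fun w => tr phi v (tayHb 1 w f)).
Proof.
move=> /ereal_dense[t vt tB].
have nv := nrm_ge0 v.
have vB : ((nrm v)%:E < dist_set p B)%E by apply: le_lt_trans tB; rewrite lee_fin ltW.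
have t0 : 0 <= t by lra.
have [M M0 HM] := Hb_lift_bounded rdp f XB t0 tB.
pose s := t - nrm v; have s0 : 0 < s by rewrite /s; lra.
have key x : B x -> (forall w, nrm (tayHb 1 w f (sh p x v)) <= 2 * M / s * nrm w) /\
   (forall w, nrm w <= s / 2 -> nrm (f (sh p x (v + w)) - f (sh p x v)
       - tayHb 1 w f (sh p x v)) <= 4 * M / s ^+ 2 * nrm w ^+ 2).
  move=> Bx; have [r [q [tr' L H]]] := HM x Bx.
  have xv : nrm (p x + v - p x) = nrm v by rewrite addrC addKr.
  have hb b : nrm (b - (p x + v)) <= s -> differentiable (f \o q) b /\ nrm ((f \o q) b) <= M.
    move=> bs; have bt : nrm (b - p x) <= t.
      by have := nrm_tri (p x + v) b (p x); rewrite xv /s in bs *; lra.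
    split; last exact: H.
    by apply: (hol_lift rdp (Hb_holomorphic f) L); lra.
  have [E1 E2] := cauchy_first_second s0 hb.
  have T w : tayHb 1 w f (sh p x v) = 'd (f \o q) (p x + v) w.
    rewrite (sh_lift rdp L); last by lra.
    have bt : nrm (p x + v - p x) < r by rewrite xv; lra.
    have := taylor_term_lift rdp 1 w (Hb_holomorphic f) L bt.
    by rewrite tay1; apply.
  split=> [w|w ws]; first by rewrite T; exact: E1.
  rewrite T (sh_lift rdp L (_ : nrm v < r)); last by lra.
  rewrite (sh_lift rdp L (_ : nrm (v + w) < r)); last first.
    by have := nrmD v w; rewrite /s in ws; lra.
  by have := E2 w ws; rewrite /= addrA.
have [lD lZ] := tayHb1_lin f.
have lT := tr_linear vB.
split.
  split; first split.
  - by move=> w w'; rewrite lD (linD lT).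
  - by move=> c w; rewrite lZ (linZ lT).
  exists (2 * M / s) => w.
  have nw := nrm_ge0 w.
  apply: (dom_limit phiB _ (tr_tends _ vB)).
    by rewrite mulr_ge0 // divr_ge0 ?(ltW s0) // mulr_ge0.
  move=> e e0; have [K HK] := taylor_unif rdp (tayHb 1 w f) XB vB e0.
  exists K => N KN x Bx; have [h1 _] := key x Bx.
  have := nrmD (taysum N v (tayHb 1 w f) x - tayHb 1 w f (sh p x v)) (tayHb 1 w f (sh p x v)).
  by rewrite subrK; have := HK N KN x Bx; have := h1 w; lra.
move=> e e0.
have C0 : 0 <= 4 * M / s ^+ 2.
  by apply: divr_ge0; [rewrite mulr_ge0 | rewrite exprn_ge0 // ltW].
have C1 : 0 < 4 * M / s ^+ 2 + 1 by lra.
exists (Num.min (s / 2) (e / (4 * M / s ^+ 2 + 1))).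
  by rewrite lt_min !divr_gt0.
move=> w; rewrite lt_min => /andP[ws we]; have nw := nrm_ge0 w.
rewrite ltr_pdivlMr // in we.
have wB : ((nrm (v + w))%:E < dist_set p B)%E.
  apply: lt_trans tB; rewrite lte_fin; have := nrmD v w; rewrite /s in ws; lra.
pose u N := taysum N (v + w) f - taysum N v f - taysum N v (tayHb 1 w f).
apply: (@le_trans _ _ (4 * M / s ^+ 2 * nrm w ^+ 2)); last first.
  rewrite expr2 mulrA; apply: ler_wpM2r => //.
  by have : nrm w >= 0 by []; nra.
apply: (dom_limit phiB (u := u)).
- by rewrite mulr_ge0 // exprn_ge0.
- have := tendsB (tendsB (tr_tends f wB) (tr_tends f vB)) (tr_tends (tayHb 1 w f) vB).
  by apply: eq_tends => N; rewrite /u !(linB phi_lin).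
move=> d d0; have d3 : 0 < d / 3 by lra.
have [K1 H1] := taylor_unif rdp f XB wB d3.
have [K2 H2] := taylor_unif rdp f XB vB d3.
have [K3 H3] := taylor_unif rdp (tayHb 1 w f) XB vB d3.
exists (maxn K1 (maxn K2 K3)) => N; rewrite !geq_max => /and3P[N1 N2 N3] x Bx.
have h1 := H1 N N1 x Bx; have h2 := H2 N N2 x Bx; have h3 := H3 N N3 x Bx.
have [_ h4] := key x Bx; have {}h4 := h4 w (ltW ws).
rewrite /u !HbB.
move: (taysum N (v + w) f x) (taysum N v f x) (taysum N v (tayHb 1 w f) x)
  (f (sh p x (v + w))) (f (sh p x v)) (tayHb 1 w f (sh p x v)) h1 h2 h3 h4
  => a b c a' b' c' h1 h2 h3 h4.
have -> : a - b - c = (a' - b' - c') + (a - a') - (b - b') - (c - c') by ring.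
apply: (le_trans (nrmB _ _)); apply: (le_trans (lerD (nrmB _ _) (lexx _))).
apply: (le_trans (lerD (lerD (nrmD _ _) (lexx _)) (lexx _))).
lra.
Qed.

End FixedB.
End OneFunctional.

Section Character.
Variables (phi : Hb p -> R[i]) (rho : R).
Hypothesis phi_char : character phi rho.

Let HB v : nrm v < rho -> exists B, [/\ Xbounded p B, ((nrm v)%:E < dist_set p B)%E & dom phi B].
Proof. by case: phi_char => _ _ _; apply. Qed.

Lemma char_tends v f : nrm v < rho -> tends (fun N => phi (taysum N v f)) (tr phi v f).
Proof.
have [lin _ _ _] := phi_char.
by move=> /HB[B [XB vB dB]]; exact: (tr_tends lin XB dB f vB).
Qed.

Lemma tr_character v : nrm v < rho -> character (tr phi v) (rho - nrm v).
Proof.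
move=> vr; have [lin mul one dm] := phi_char.
have [B [XB vB dB]] := HB vr; split.
- exact: (tr_linear lin XB dB vB).
- exact: (tr_mul lin mul XB dB vB).
- exact: (tr_one lin one XB dB vB).
move=> t tr'; have nv := nrm_ge0 v.
pose t' := (nrm v + Num.max t 0 + rho) / 2.
have m0 : 0 <= Num.max t 0 by rewrite le_max lexx orbT.
have mt : t <= Num.max t 0 by rewrite le_max lexx.
have mr : Num.max t 0 < rho - nrm v by rewrite gt_max; apply/andP; split; lra.
have [|B' [XB' tB' dB']] := dm t'; first by rewrite /t'; lra.
have vt' : nrm v < t' by rewrite /t'; lra.
have vB' : ((nrm v)%:E < dist_set p B')%E by apply: lt_trans tB'; rewrite lte_fin.
exists (thick p B' (nrm v)); split.
- exact: (thick_Xbounded rdp XB' nv vB').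
- apply: (@lt_le_trans _ _ (t' - nrm v)%:E); first by rewrite lte_fin /t'; lra.
  by apply: dist_set_ge => y; exact: (thick_dist rdp tB' vt').
- exact: (tr_dom lin XB' dB' vB' (lexx _)).
Qed.

Lemma char_dual v gamma : nrm v < rho ->
  tr phi v (dual_comp rdp gamma) = phi (dual_comp rdp gamma) + gamma v.
Proof.
have [lin mul one _] := phi_char.
by move=> /HB[B [XB vB dB]]; exact: (tr_dual lin one XB dB gamma vB).
Qed.

Lemma char_diff v f : nrm v < rho -> differentiable (fun v => tr phi v f) v /\
  forall w, 'd (fun v => tr phi v f) v w = tr phi v (tayHb 1 w f).
Proof.
have [lin mul one _] := phi_char.
move=> /HB[B [XB vB dB]]; have [H1 H2] := tr_fder lin XB dB f vB.
have [H3 H4] := differentiable_fder H1 H2.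
by split; [exact: H3 | move=> w; exact: (congr1 (@^~ w) H4)].
Qed.

Lemma char_hol f : hol_ball (fun v => tr phi v f) 0 rho.
Proof. by move=> v; rewrite subr0 => /(char_diff f)[]. Qed.

(** Lets properties of the first differential pass to all Taylor terms. *)
Lemma iter_tayHb n w f x : iter n (tayHb 1 w) f x = n`!%:R * tayHb n w f x.
Proof.
have [r [s [r0 L]]] := lift_exists rdp x.
have px : nrm (p x - p x) < r by rewrite subrr nrm0.
have H m b : nrm (b - p x) < r -> iter m (tayHb 1 w) f (s b) = idir m w (f \o s) b.
  elim: m b => [//|m IH] b br; rewrite iterS.
  have := taylor_term_lift rdp 1 w (Hb_holomorphic (iter m (tayHb 1 w) f)) L br.
  rewrite tay1 => E1; apply: (etrans E1).
  apply: (@idir_eq _ _ (idir m w (f \o s)) _ (p x) r w 1) => //.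
  exact: (hol_ball_idir w m (hol_lift rdp (Hb_holomorphic f) L)).
have := taylor_term_lift rdp n w (Hb_holomorphic f) L px.
have := H n (p x) px; rewrite L.1 => -> /= ->.
by rewrite /tay mulrC divfK // pnatr_eq0 gtn_eqF // fact_gt0.
Qed.

(** Differentiation in direction w under phi^v, from [char_diff] iterated. *)
Lemma tay_tr n w f v : nrm v < rho ->
  tay n w (fun v => tr phi v f) v = tr phi v (tayHb n w f).
Proof.
move=> vr.
have lT : linear (tr phi v) by have [] := tr_character vr.
have H m v' : nrm v' < rho ->
    idir m w (fun v => tr phi v f) v' = tr phi v' (iter m (tayHb 1 w) f).
  elim: m v' => [//|m IH] v' vr'; rewrite iterS.
  transitivity (idir 1 w (fun v => tr phi v (iter m (tayHb 1 w) f)) v').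
    apply: (@idir_eq _ _ _ _ 0 rho w 1 (char_hol (iter m (tayHb 1 w) f))).
      by move=> b; rewrite subr0; exact: IH.
    by rewrite subr0.
  exact: (char_diff _ vr').2.
rewrite /tay H //.
have -> : iter n (tayHb 1 w) f = n`!%:R *: tayHb n w f.
  by apply: HbP => x; rewrite iter_tayHb HbZ.
by rewrite (linZ lT) mulrC mulKf // pnatr_eq0 gtn_eqF // fact_gt0.
Qed.

(** The function v -> phi^v (f) is holomorphic on a ball of radius rho and its
    Taylor series at v, evaluated at w, is by [tay_tr] the series that defines
    (phi^v)^w (f). *)
Lemma tr_tr v w : nrm v + nrm w < rho -> tr (tr phi v) w = tr phi (v + w).
Proof.
move=> vw; have nv := nrm_ge0 v; have nw := nrm_ge0 w.
have vr : nrm v < rho by lra.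
have cT := tr_character vr; have [lT _ _ _] := cT.
apply/funext => f.
have hv : hol_ball (fun v => tr phi v f) v (rho - nrm v).
  by apply: (hol_ball_sub (char_hol f)); rewrite subr0; lra.
have wr : nrm w < rho - nrm v by lra.
have T1 := tay_series hv wr.
have [B [XB wB dB]] : exists B, [/\ Xbounded p B, ((nrm w)%:E < dist_set p B)%E &
    dom (tr phi v) B] by case: cT => _ _ _; apply.
apply: (tends_unique (tr_tends lT XB dB f wB)).
apply: eq_tends T1 => N; rewrite /taysum.
rewrite (lin_sum lT N (fun n => tayHb n w f)).
by apply: eq_bigr => n _; exact: tay_tr.
Qed.

End Character.
End Translates.

(** * Continuous functionals separate points *)

Section HahnBanach.
Context {R : realType} {V : normedModType R[i]}.
Implicit Types (q : V -> R) (x y a : V) (c t r : R).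

Definition sublin q := (forall x y, q (x + y) <= q x + q y) /\
  (forall c x, 0 <= c -> q (c%:C *: x) <= c * q x).

Lemma inf_sublin (S : V -> set R) :
  (forall x, S x !=set0) -> (forall x, has_lbound (S x)) ->
  (forall x y r r', S x r -> S y r' -> exists2 r'', S (x + y) r'' & r'' <= r + r') ->
  (forall c x r, 0 <= c -> S x r -> exists2 r', S (c%:C *: x) r' & r' <= c * r) ->
  sublin (fun x => inf (S x)).
Proof.
move=> S0 Sb SD SZ; split=> [x y|c x].
  rewrite -lerBlDr; apply: lb_le_inf (S0 x) _ => r Sr.
  rewrite lerBlDr -lerBlDl; apply: lb_le_inf (S0 y) _ => r' Sr'.
  have [r'' Sr'' rr] := SD _ _ _ _ Sr Sr'.
  by rewrite lerBlDl; apply: le_trans rr; exact: ge_inf.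
rewrite le_eqVlt => /predU1P[<-|c0].
  have [r Sr] := S0 x; have [r' Sr' rr] := SZ 0 x r (lexx 0) Sr.
  by rewrite mul0r; rewrite mul0r in rr; apply: le_trans rr; exact: ge_inf.
rewrite -ler_pdivrMl //; apply: lb_le_inf (S0 x) _ => r Sr.
have [r' Sr' rr] := SZ c x r (ltW c0) Sr.
by rewrite ler_pdivrMl //; apply: le_trans rr; exact: ge_inf.
Qed.

Lemma sublin0 q : sublin q -> q 0 = 0.
Proof.
move=> [qD qZ]; apply/eqP; rewrite eq_le; apply/andP; split.
  by have := qZ 0 0 (lexx 0); rewrite mul0r scaler0.
by have := qD 0 0; rewrite addr0; lra.
Qed.

Lemma sublinN q x : sublin q -> - q (- x) <= q x.
Proof. by move=> sq; have := sq.1 x (- x); rewrite subrr sublin0 //; lra. Qed.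

Lemma sublinZ q c x : sublin q -> 0 <= c -> q (c%:C *: x) = c * q x.
Proof.
move=> sq; rewrite le_eqVlt => /predU1P[<-|c0].
  by rewrite mul0r scale0r sublin0.
apply/le_anti/andP; split; first exact: sq.2 _ _ (ltW c0).
rewrite -ler_pdivlMl //.
have := sq.2 c^-1 (c%:C *: x); rewrite invr_ge0 => /(_ (ltW c0)).
by rewrite scalerA -rmorphM mulVf ?gt_eqF // scale1r.
Qed.

(** The infimum of q (x + t y) - t q y over t >= 0. *)
Lemma sublin_step q y : sublin q -> exists q', [/\ sublin q',
  forall x, q' x <= q x & forall x, q' x + q y <= q (x + y)].
Proof.
move=> sq; have [qD qZ] := sq.
pose S x := [set r | exists2 t, 0 <= t & r = q (x + t%:C *: y) - t * q y].
have Slb x : has_lbound (S x).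
  exists (- q (- x)) => _ [t t0 ->].
  have := qD (- x) (x + t%:C *: y); rewrite addKr sublinZ //; lra.
have sq' : sublin (fun x => inf (S x)).
  apply: inf_sublin => //.
  - by move=> x; exists (q (x + 0%:C *: y) - 0 * q y), 0.
  - move=> x x' _ _ [t t0 ->] [t' t'0 ->].
    exists (q ((x + x') + (t + t')%:C *: y) - (t + t') * q y).
      by exists (t + t'); rewrite // addr_ge0.
    have := qD (x + t%:C *: y) (x' + t'%:C *: y).
    rewrite addrACA -scalerDl -rmorphD /=; lra.
  - move=> c x _ c0 [t t0 ->].
    exists (q (c%:C *: x + (c * t)%:C *: y) - (c * t) * q y).
      by exists (c * t); rewrite // mulr_ge0.
    rewrite rmorphM /= -scalerA -scalerDr mulrBr mulrA.
    by have := qZ c (x + t%:C *: y) c0; lra.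
exists (fun x => inf (S x)); split=> // x.
- by apply: ge_inf => //; exists 0; rewrite // scale0r addr0 mul0r subr0.
- by rewrite -lerBrDr; apply: ge_inf => //; exists 1; rewrite // scale1r mul1r.
Qed.

(** Zorn's lemma: the pointwise infimum of a chain of sublinear functionals is
    sublinear. *)
Lemma minimal_sublin q0 : sublin q0 -> exists q, [/\ sublin q, forall x, q x <= q0 x &
  forall q', sublin q' -> (forall x, q' x <= q x) -> q' = q].
Proof.
move=> sq0.
pose T := {q : V -> R | sublin q /\ forall x, q x <= q0 x}.
pose rl (s t : T) := `[< forall x, sval t x <= sval s x >].
have rP (s t : T) : rl s t <-> forall x, sval t x <= sval s x by split=> /asboolP.
have [|r s t|s t|A tA|[m [sm m0]] Hm] := @Zorn T rl.
- by move=> t; apply/rP.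
- by move=> /rP rs /rP st; apply/rP => x; exact: le_trans (st x) (rs x).
- move=> /rP st /rP ts; case: s t st ts => [s ps] [t pt] /= st ts.
  by apply: eq_exist; apply/funext => x; apply/eqP; rewrite eq_le ts st.
- have [[t0 At0]|A0] := pselect (A !=set0); last first.
    by exists (exist (fun q => sublin q /\ forall x, q x <= q0 x) q0 (conj sq0 (fun=> lexx _))) => s As; case: A0; exists s.
  pose S x := [set r | exists2 t, A t & r = sval t x].
  have Sn x : S x !=set0 by exists (sval t0 x), t0.
  have Slb x : has_lbound (S x).
    exists (- q0 (- x)) => _ [[t [st tq]] At ->] /=.
    by have := sublinN x st; have := tq (- x); lra.
  have sI : sublin (fun x => inf (S x)).
    apply: inf_sublin => //.
    + move=> x y _ _ [s As ->] [t At ->].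
      have [/rP st|/rP ts] := tA s t As At.
        exists (sval t (x + y)); first by exists t.
        by apply: le_trans ((svalP t).1.1 x y) _; rewrite lerD2r.
      exists (sval s (x + y)); first by exists s.
      by apply: le_trans ((svalP s).1.1 x y) _; rewrite lerD2l.
    + move=> c x _ c0 [s As ->]; exists (sval s (c%:C *: x)); first by exists s.
      exact: (svalP s).1.2.
  have Iq x : inf (S x) <= q0 x.
    by apply: le_trans ((svalP t0).2 x); apply: ge_inf => //; exists t0.
  exists (exist (fun q => sublin q /\ forall x, q x <= q0 x) _ (conj sI Iq)) => s As; apply/rP => x /=.
  by apply: ge_inf => //; exists s.
exists m; split=> // q' sq' q'm.
have q'0 x : q' x <= q0 x by exact: le_trans (q'm x) (m0 x).
have Q : rl (exist _ m (conj sm m0)) (exist _ q' (conj sq' q'0)) by apply/rP.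
exact: (congr1 sval (Hm _ Q)).
Qed.

Lemma nrm_sublin : sublin (@nrm R V).
Proof.
split=> [x y|c x c0]; first exact: nrmD.
by rewrite nrmZ nrm_real ger0_norm.
Qed.

(** A minimal sublinear functional below q is additive, since [sublin_step] in any
    direction y returns a smaller one. Starting from the norm, lowered in the
    direction a, forces u a >= |a|. *)
Lemma real_hahn_banach a : exists u : V -> R, [/\ forall x y, u (x + y) = u x + u y,
  forall t x, u (t%:C *: x) = t * u x, forall x, `|u x| <= nrm x & nrm a <= u a].
Proof.
have [p0 [sp0 p0n p0a]] := sublin_step a nrm_sublin.
have [u [su up0 umin]] := minimal_sublin sp0.
have uD x y : u (x + y) = u x + u y.
  have [q' [sq' q'u q'y]] := sublin_step y su.
  have E := umin q' sq' q'u; subst q'.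
  by apply/eqP; rewrite eq_le su.1 q'y.
have uN x : u (- x) = - u x.
  by have := uD x (- x); rewrite subrr sublin0 //; lra.
exists u; split=> //.
- move=> t x; have [t0|t0] := leP 0 t; first exact: sublinZ.
  have t0' : 0 <= - t by lra.
  have := sublinZ x su t0'; rewrite rmorphN /= scaleNr uN; lra.
- move=> x; have h1 := le_trans (up0 x) (p0n x).
  have h2 := le_trans (up0 (- x)) (p0n (- x)).
  by rewrite uN nrmN in h2; rewrite ler_norml; apply/andP; split; lra.
- have := p0a (- a); rewrite addNr nrm0; have := up0 (- a); rewrite uN; lra.
Qed.

End HahnBanach.

Section DualSeparates.
Context {R : realType} {V : completeNormedModType R[i]}.

(** A real-linear u that is bounded by the norm is the real part of the complex
    functional x -> u x - i u (i x). *)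
Theorem dual_separates (a b : V) : (forall gamma : topdual, gamma a = gamma b :> R[i]) -> a = b.
Proof.
move=> ab; apply/eqP; rewrite -subr_eq0; apply/eqP/nrm_le0.
have [u [uD uZ un ua]] := real_hahn_banach (a - b).
pose i : R[i] := Complex 0 1.
have iE (x : V) : i *: (i *: x) = - x.
  rewrite scalerA (_ : i * i = -1) ?scaleN1r //.
  by apply/eqP; rewrite eq_complex /= !(mul0r, mulr0, mul1r, add0r, subr0, sub0r, oppr0) !eqxx.
have uN x : u (- x) = - u x by have := uZ (-1) x; rewrite rmorphN1 scaleN1r mulN1r.
pose f (x : V) : R[i] := Complex (u x) (- u (i *: x)).
have fD x y : f (x + y) = f x + f y.
  by rewrite /f scalerDr !uD opprD; apply/eqP; rewrite eq_complex /= !eqxx.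
have fZ c x : f (c *: x) = c * f x.
  case: c => s t.
  have cE (y : V) : (Complex s t) *: y = s%:C *: y + t%:C *: (i *: y).
    rewrite scalerA -scalerDl; congr (_ *: _); apply/eqP; rewrite eq_complex /=.
    by apply/andP; split; apply/eqP; ring.
  rewrite /f cE scalerDr !uD.
  have -> : i *: (s%:C *: x) = s%:C *: (i *: x) by rewrite !scalerA mulrC.
  have -> : i *: (t%:C *: (i *: x)) = t%:C *: (i *: (i *: x)).
    by rewrite !scalerA; congr (_ *: _); ring.
  rewrite iE !uZ uN; apply/eqP; rewrite eq_complex /=; apply/andP; split; apply/eqP; ring.
have fL : linear f by move=> c x y; rewrite fD fZ.
pose F : {linear V -> R[i]} := HB.pack f (GRing.isLinear.Build _ _ _ _ f fL).
have Fc : continuous F.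
  apply/bounded_linear_continuous/linear_boundedP.
  exists 2; split; first exact: realn.
  move=> r Cr x; apply: le_trans (_ : _ <= 2 * `|x|) _.
    have -> : 2 = (2 : R)%:C :> R[i] by rewrite rmorph_nat.
    rewrite !nrmE -rmorphM lecR.
    apply: (le_trans (nrm_ReIm _)) => /=; rewrite normrN.
    have := un x; have := un (i *: x); rewrite nrmZ.
    have -> : nrm i = 1 by have := nrmI (1 : R[i]); rewrite mul1r nrm1.
    rewrite mul1r; lra.
  by apply: ler_wpM2r => //; exact: ltW.
have := ab (MkDual Fc) => /= /(congr1 (@complex.Re R)) /= E.
by apply: (le_trans ua); rewrite uD uN E subrr.
Qed.

End DualSeparates.

(** * The spectrum as a Riemann domain *)

Section ChartFromSection.
Context {R : realType} {E : completeNormedModType R[i]} {Y : topologicalType}.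
Variable q : Y -> E.

(** The form in which charts are produced from translations. *)
Lemma chart_of_section (y : Y) (s : E -> Y) (U : set Y) (r : R) : 0 < r ->
  open U -> U y ->
  (forall z, U z -> [/\ nrm (q z - q y) < r, s (q z) = z & {for z, continuous q}]) ->
  (forall b, nrm (b - q y) < r -> [/\ U (s b), q (s b) = b & {for b, continuous s}]) ->
  is_chart q y U.
Proof.
move=> r0 oU Uy HU Hs.
have qU : q @` U = ball (q y) r%:C.
  apply/seteqP; split=> [_ [z Uz <-]|b /ball_nrm br].
    by apply/ball_nrm; have [] := HU z Uz.
  by have [Us qs _] := Hs b br; exists (s b).
have inj : {in U &, injective q}.
  move=> z w; rewrite !inE => Uz Uw zw.
  have [_ sz _] := HU z Uz; have [_ sw _] := HU w Uw.
  by rewrite -sz -sw zw.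
split=> //; first by rewrite qU; exact: ball_open.
split; first by split.
- by apply: continuous_in_subspaceT => z; rewrite inE => Uz; have [] := HU z Uz.
- rewrite qU; apply: (@subspace_eq_continuous _ _ _ s).
    move=> b; rewrite inE => /ball_nrm br; have [Us qs _] := Hs b br.
    by rewrite -{2}qs; apply/esym/(pinvKV _ inj); rewrite inE.
  by apply: continuous_in_subspaceT => b; rewrite inE => /ball_nrm br; have [] := Hs b br.
Qed.

End ChartFromSection.

Section Spectrum.
Context {R : realType} {E : completeNormedModType R[i]} {X : topologicalType}.
Variable p : X -> E.
Hypothesis rdp : riemann_domain p.
Implicit Types (x y : X) (v w a b : E) (t e M rho r : R) (B : set X) (f g : Hb p).
Implicit Types (phi psi : spectrum_E rdp) (F : Hb p -> R[i]).

(** Nonzero is the same as unital for a multiplicative functional, and continuity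
    is the same as domination by an X-bounded set. *)
Lemma MbP F : Mb F <-> [/\ linear F, {morph F : f g / f * g}, F 1 = 1 &
  exists B, Xbounded p B /\ dom F B].
Proof.
split=> [[lin mul F0 cF]|[lin mul one [B [XB dB]]]].
  have one : F 1 = 1.
    have [f Ff] : exists f, F f <> 0.
      by apply/existsNP => H; apply: F0; apply/funext => f; exact: H.
    have := mul 1 f; rewrite mul1r => /eqP; rewrite -subr_eq0 -{1}(mul1r (F f)) -mulrBl.
    by rewrite mulf_eq0 => /orP[|/eqP //]; rewrite subr_eq0 => /eqP.
  have [C [B [XB C0 H]]] := continuous_le_on lin cF.
  split=> //; exists B; split=> //.
  exact: (le_on_dom mul one C0 H).
split=> //.
- by move=> F0; have := one; rewrite F0 => /eqP; rewrite eq_sym oner_eq0.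
- exact: (le_on_continuous lin XB dB).
Qed.

Lemma spec_pre phi : pi_preim rdp (\val phi).
Proof. exact: set_mem (valP phi). Qed.

Lemma spec_Mb phi : [/\ linear (\val phi), {morph (\val phi) : f g / f * g},
  \val phi 1 = 1 & exists B, Xbounded p B /\ dom (\val phi) B].
Proof. by apply/MbP; have [] := spec_pre phi. Qed.

Lemma dist_spectrum_gt phi t : (t%:E < dist_spectrum phi)%E ->
  exists B, [/\ Xbounded p B, (t%:E < dist_set p B)%E & dom (\val phi) B].
Proof.
move=> /ereal_sup_gt[_ [B [XB dB] <-] tB]; exists B; split=> //.
exact: dominated_dom.
Qed.

Lemma dist_spectrum_ge phi B : Xbounded p B -> dom (\val phi) B ->
  (dist_set p B <= dist_spectrum phi)%E.
Proof.
move=> XB dB; apply: ereal_sup_ubound; exists B => //; split=> //.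
by have [_ _ one _] := spec_Mb phi; exact: dom_dominated.
Qed.

Lemma dist_spectrum_gt0 phi : (0 < dist_spectrum phi)%E.
Proof.
have [_ _ _ [B [XB dB]]] := spec_Mb phi.
exact: lt_le_trans XB.2 (dist_spectrum_ge XB dB).
Qed.

Lemma spec_char phi rho : (rho%:E <= dist_spectrum phi)%E -> character (\val phi) rho.
Proof.
move=> rd; have [lin mul one _] := spec_Mb phi; split=> // t tr'.
by apply: dist_spectrum_gt; apply: lt_le_trans rd; rewrite lte_fin.
Qed.

Lemma char_dist phi rho t : character (\val phi) rho -> t < rho ->
  (t%:E < dist_spectrum phi)%E.
Proof.
move=> [_ _ _ H] /H[B [XB tB dB]].
exact: lt_le_trans tB (dist_spectrum_ge XB dB).
Qed.

Lemma proj_spec phi gamma : \val phi (dual_comp rdp gamma) = gamma (proj_E phi).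
Proof.
have [_ [a Ha]] := spec_pre phi.
have H := @xgetPex _ (0 : E) [set a | pi_bidual rdp (\val phi) = bidual_embed a]
  (ex_intro _ a Ha).
exact: (congr1 (@^~ gamma) H).
Qed.

(** A point of E is determined by the functionals on E. *)
Lemma proj_eq phi a : (forall gamma, \val phi (dual_comp rdp gamma) = gamma a) ->
  proj_E phi = a.
Proof. by move=> H; apply: dual_separates => gamma; rewrite -proj_spec H. Qed.

(** The vector a is where the functional projects to; it puts F in pi^-1(E). *)
Lemma spec_mk F rho a : character F rho -> 0 < rho ->
  (forall gamma, F (dual_comp rdp gamma) = gamma a) -> exists phi, \val phi = F.
Proof.
move=> [lin mul one H] rho0 Fa.
have FP : pi_preim rdp F.
  split; last by exists a; apply/funext => gamma; exact: Fa.
  apply/MbP; split=> //; have [B [XB _ dB]] := H (rho / 2) ltac:(lra).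
  by exists B.
by exists (SigSub (mem_set FP)).
Qed.

(** The translate as an element of the spectrum; the junk value is phi. *)
Definition spec_tr phi v : spectrum_E rdp := xget phi [set psi | \val psi = tr rdp (\val phi) v].

Lemma dist_lt_char phi t : (t%:E < dist_spectrum phi)%E ->
  exists2 rho, t < rho & character (\val phi) rho.
Proof.
move=> /ereal_dense[rho tr' /ltW rd]; exists rho => //; exact: spec_char.
Qed.

Lemma spec_trE phi v : ((nrm v)%:E < dist_spectrum phi)%E ->
  \val (spec_tr phi v) = tr rdp (\val phi) v.
Proof.
move=> /dist_lt_char[rho vr cphi]; rewrite /spec_tr; case: xgetP => [psi _ //|H].
have r0 : 0 < rho - nrm v by lra.
have [|psi Hpsi] := @spec_mk (tr rdp (\val phi) v) (rho - nrm v) (proj_E phi + v)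
  (tr_character rdp cphi vr) r0.
  by move=> gamma; rewrite (char_dual rdp cphi gamma vr) proj_spec linearD.
by case: (H psi).
Qed.

Lemma proj_spec_tr phi v : ((nrm v)%:E < dist_spectrum phi)%E ->
  proj_E (spec_tr phi v) = proj_E phi + v.
Proof.
move=> vd; apply: proj_eq => gamma; rewrite spec_trE //.
have [rho vr cphi] := dist_lt_char vd.
by rewrite (char_dual rdp cphi gamma vr) proj_spec linearD.
Qed.

Lemma spec_tr_dist phi v t : ((t + nrm v)%:E < dist_spectrum phi)%E -> 0 <= t ->
  (t%:E < dist_spectrum (spec_tr phi v))%E.
Proof.
move=> /dist_lt_char[rho vr cphi] t0; have nv := nrm_ge0 v.
have vr' : nrm v < rho by lra.
have vd : ((nrm v)%:E < dist_spectrum phi)%E by exact: char_dist cphi vr'.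
have := tr_character rdp cphi vr'; rewrite -(spec_trE vd) => /char_dist; apply; lra.
Qed.

(** The local group law [tr_tr]; openness of the balls, the Hausdorff property and
    the charts all follow from it. *)
Lemma spec_tr_tr phi v w : ((nrm v + nrm w)%:E < dist_spectrum phi)%E ->
  spec_tr (spec_tr phi v) w = spec_tr phi (v + w).
Proof.
move=> vwd; have nv := nrm_ge0 v; have nw := nrm_ge0 w.
have [rho vwr cphi] := dist_lt_char vwd.
have vr : nrm v < rho by lra.
have vd := char_dist cphi vr.
have vwr' : nrm (v + w) < rho by have := nrmD v w; lra.
have wd : ((nrm w)%:E < dist_spectrum (spec_tr phi v))%E.
  by apply: spec_tr_dist => //; rewrite addrC.
apply: val_inj; rewrite (spec_trE wd) (spec_trE vd) (spec_trE (char_dist cphi vwr')).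
exact: (tr_tr rdp cphi).
Qed.

(** The Taylor polynomials converge to f (x + 0) = f x on a dominating set. *)
Lemma spec_tr0 phi : spec_tr phi 0 = phi.
Proof.
have d0 : ((nrm (0 : E))%:E < dist_spectrum phi)%E.
  by rewrite nrm0; exact: dist_spectrum_gt0.
apply: val_inj; rewrite spec_trE //; apply/funext => f.
have [lin mul one [B [XB dB]]] := spec_Mb phi.
have nB : ((nrm (0 : E))%:E < dist_set p B)%E by rewrite nrm0; exact: XB.2.
apply/eqP; rewrite -subr_eq0; apply/eqP.
apply: (dom_limit0 dB (u := fun N => taysum rdp N 0 f - f)).
  have := tendsB (tr_tends rdp lin XB dB f nB) (tends_cst (\val phi f)).
  by apply: eq_tends => N; rewrite (linB lin).
move=> e e0; have [K HK] := taylor_unif rdp f XB nB e0.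
by exists K => N KN x Bx; rewrite HbB; have := HK N KN x Bx; rewrite sh0.
Qed.

Lemma is_translateP phi v psi : ((nrm v)%:E < dist_spectrum phi)%E ->
  is_translate phi v psi <-> psi = spec_tr phi v.
Proof.
move=> vd; have [rho vr cphi] := dist_lt_char vd; have [lin _ _ _] := spec_Mb phi.
have sumE f N : series (fun n => \val phi (tayHb rdp n v f)) N = \val phi (taysum rdp N v f).
  by rewrite /series /= big_mkord -(lin_sum lin N (fun n => tayHb rdp n v f)).
split=> [H|-> f].
  apply: val_inj; apply/funext => f; rewrite spec_trE //.
  have [g [gE /tends_cvg gl]] := H f.
  apply: (tends_unique gl); apply: eq_tends (char_tends rdp cphi f vr) => N.
  rewrite -sumE /series /=; apply: eq_bigr => n _; congr (\val phi _).
  by apply: val_inj; rewrite /= gE.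
exists (fun n => tayHb rdp n v f); split=> //.
apply/tends_cvg; rewrite spec_trE //; apply: eq_tends (char_tends rdp cphi f vr) => N.
by rewrite sumE.
Qed.

Lemma spectrum_ballP phi e : (e%:E < dist_spectrum phi)%E -> 
  spectrum_ball phi e = [set psi | exists2 v, nrm v < e & psi = spec_tr phi v].
Proof.
move=> ed; apply/seteqP; split=> psi [v].
  rewrite nrmE ltcR => ve; have vd : ((nrm v)%:E < dist_spectrum phi)%E.
    by apply: lt_trans ed; rewrite lte_fin.
  by move=> /(is_translateP _ vd) ->; exists v.
move=> ve ->; exists v; first by rewrite nrmE ltcR.
apply/is_translateP => //; by apply: lt_trans ed; rewrite lte_fin.
Qed.

Lemma spec_ball_sub phi e v : (e%:E < dist_spectrum phi)%E -> nrm v < e ->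
  exists e', [/\ 0 < e', (e'%:E < dist_spectrum (spec_tr phi v))%E &
    spectrum_ball (spec_tr phi v) e' `<=` spectrum_ball phi e].
Proof.
move=> ed ve; have nv := nrm_ge0 v.
have e'0 : 0 < (e - nrm v) by lra.
have e'd : ((e - nrm v)%:E < dist_spectrum (spec_tr phi v))%E.
  by apply: spec_tr_dist; [rewrite subrK | exact: ltW].
exists (e - nrm v); split=> //.
rewrite (spectrum_ballP e'd) (spectrum_ballP ed) => psi [w we ->].
exists (v + w); first by have := nrmD v w; lra.
by apply: spec_tr_tr; apply: le_lt_trans ed; rewrite lee_fin; lra.
Qed.

Lemma spec_ball_open phi e : 0 < e -> (e%:E < dist_spectrum phi)%E -> 
  open (spectrum_ball phi e).
Proof.
move=> e0 ed; exists [set spectrum_ball phi e].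
  move=> _ ->; apply: (@finI_from1 _ _ _ id); by exists phi, e.
by rewrite bigcup_set1.
Qed.

(** The balls are given as a subbasis. Every ball contains a ball about each of its
    points ([spec_ball_sub]), so they form a basis. *)
Lemma spec_nbhsP psi (W : set (spectrum_E rdp)) : nbhs psi W <->
  exists e, [/\ 0 < e, (e%:E < dist_spectrum psi)%E & spectrum_ball psi e `<=` W].
Proof.
split=> [|[e [e0 ed eW]]]; last first.
  apply: filterS eW _; apply: open_nbhs_nbhs; split; first exact: spec_ball_open.
  by rewrite (spectrum_ballP ed); exists 0; rewrite ?nrm0 // spec_tr0.
pose G : set_system (spectrum_E rdp) := [set W | exists e,
  [/\ 0 < e, (e%:E < dist_spectrum psi)%E & spectrum_ball psi e `<=` W]].
have mono e e' : 0 < e -> e <= e' -> spectrum_ball psi e `<=` spectrum_ball psi e'.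
  move=> _ ee chi [v ve H]; exists v => //; apply: lt_le_trans ve _; by rewrite lecR.
have FG : Filter G.
  split.
  - have [e e0 ed] := ereal_dense (dist_spectrum_gt0 psi); by exists e.
  - move=> P Q [e [e0 ed eP]] [e' [e'0 e'd eQ]]; exists (Num.min e e'); split.
    + by rewrite lt_min e0.
    + by apply: le_lt_trans ed; rewrite lee_fin ge_min lexx.
    + move=> chi H; split; [apply: eP|apply: eQ]; apply: mono H;
        by rewrite ?lt_min ?e0 // ge_min lexx ?orbT.
  - by move=> P Q PQ [e [e0 ed eP]]; exists e; split=> //; exact: subset_trans PQ.
move=> [V [[D' sD' <-] [A D'A Apsi]] VW].
suff : G A.
  apply: filterS => chi Achi; apply: VW; by exists A.
have [F' sF' AE] := sD' A D'A; rewrite -AE.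
apply: filter_bigI => /= V' V'F; have /set_mem[phi [e [e0 ed V'E]]] := sF' V' V'F.
have : V' psi by rewrite -AE in Apsi; exact: Apsi.
rewrite V'E {1}(spectrum_ballP ed) => -[v ve E1].
by have := spec_ball_sub ed ve; rewrite -E1.
Qed.

Lemma spec_ball_nbhs phi e : 0 < e -> (e%:E < dist_spectrum phi)%E ->
  nbhs phi (spectrum_ball phi e).
Proof. by move=> e0 ed; apply/spec_nbhsP; exists e; split. Qed.

Lemma proj_continuous : continuous (@proj_E R E X p rdp).
Proof.
move=> psi A /nbhs_nrm[r r0 rA].
have [e e0 ed] := ereal_dense (dist_spectrum_gt0 psi).
have md : ((Num.min e r)%:E < dist_spectrum psi)%E.
  by apply: le_lt_trans ed; rewrite lee_fin ge_min lexx.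
apply/spec_nbhsP; exists (Num.min e r); split=> //; first by rewrite lt_min e0.
rewrite (spectrum_ballP md) => _ [v vm ->]; apply: rA.
rewrite proj_spec_tr; last by apply: lt_trans md; rewrite lte_fin.
by rewrite addrC addKr; apply: lt_le_trans vm _; rewrite ge_min lexx orbT.
Qed.

Lemma spec_tr_continuous phi v : ((nrm v)%:E < dist_spectrum phi)%E ->
  {for v, continuous (spec_tr phi)}.
Proof.
move=> vd A /spec_nbhsP[e [e0 ed eA]].
have [rho vr rd] := ereal_dense vd.
apply/nbhs_nrm; exists (Num.min e (rho - nrm v)).
  by rewrite lt_min e0; lra.
move=> w; rewrite lt_min => /andP[we wr].
apply: eA; rewrite (spectrum_ballP ed); exists (w - v) => //.
rewrite spec_tr_tr ?subrKC //.
by apply: le_lt_trans rd; rewrite lee_fin; lra.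
Qed.

(** Two inseparable points have the same projection, and a common translate by
    small vectors, which then are equal; translating back identifies the points. *)
Lemma spec_hausdorff : hausdorff_space (spectrum_E rdp).
Proof.
move=> phi psi clu.
have [d1 d10 D1] := ereal_dense (dist_spectrum_gt0 phi).
have [d2 d20 D2] := ereal_dense (dist_spectrum_gt0 psi).
pose d := Num.min d1 d2.
have dd1 : d <= d1 by rewrite ge_min lexx.
have dd2 : d <= d2 by rewrite ge_min lexx orbT.
have d0 : 0 < d by rewrite lt_min d10.
clearbody d.
(* Radius d / 2 leaves room to translate twice. *)
have meet e : 0 < e -> e <= d / 2 -> exists v w, [/\ nrm v < e, nrm w < e &
    spec_tr phi v = spec_tr psi w].
  move=> e0 ed.
  have e1 : (e%:E < dist_spectrum phi)%E by apply: lt_trans D1; rewrite lte_fin; lra.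
  have e2 : (e%:E < dist_spectrum psi)%E by apply: lt_trans D2; rewrite lte_fin; lra.
  have n1 : nbhs phi (spectrum_ball phi e) by exact: spec_ball_nbhs.
  have n2 : nbhs psi (spectrum_ball psi e) by exact: spec_ball_nbhs.
  have [chi []] := clu _ _ n1 n2.
  rewrite (spectrum_ballP e1) (spectrum_ballP e2) => -[v ve ->] [w we E1].
  by exists v, w.
have lt1 v e : nrm v < e -> e <= d / 2 -> ((nrm v)%:E < dist_spectrum phi)%E.
  by move=> ve ed; apply: lt_trans D1; rewrite lte_fin; lra.
have lt2 v e : nrm v < e -> e <= d / 2 -> ((nrm v)%:E < dist_spectrum psi)%E.
  by move=> ve ed; apply: lt_trans D2; rewrite lte_fin; lra.
have pp : proj_E phi = proj_E psi.
  apply/eqP; rewrite -subr_eq0; apply/eqP/nrm_le0; apply: (@le_eps R _ 2) => e e0.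
  pose e' := Num.min e (d / 2).
  have e'0 : 0 < e' by rewrite lt_min e0 divr_gt0.
  have e'd : e' <= d / 2 by rewrite ge_min lexx orbT.
  have e'e : e' <= e by rewrite ge_min lexx.
  have [v [w [ve we E1]]] := meet e' e'0 e'd.
  have := congr1 (@proj_E R E X p rdp) E1.
  rewrite (proj_spec_tr (lt1 v e' ve e'd)) (proj_spec_tr (lt2 w e' we e'd)) => E2.
  have -> : proj_E phi - proj_E psi = w - v.
    by apply/eqP; rewrite subr_eq addrAC eq_sym subr_eq addrC -E2 addrC.
  by have := nrmB w v; lra.
have [v [w [ve we E1]]] := meet (d / 2) ltac:(lra) (lexx _).
have := congr1 (@proj_E R E X p rdp) E1.
rewrite (proj_spec_tr (lt1 v _ ve (lexx _))) (proj_spec_tr (lt2 w _ we (lexx _))) pp.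
move=> /addrI vw; subst w.
have vv1 : ((nrm v + nrm (- v))%:E < dist_spectrum phi)%E.
  by rewrite nrmN; apply: le_lt_trans D1; rewrite lee_fin; lra.
have vv2 : ((nrm v + nrm (- v))%:E < dist_spectrum psi)%E.
  by rewrite nrmN; apply: le_lt_trans D2; rewrite lee_fin; lra.
by rewrite -(spec_tr0 phi) -(spec_tr0 psi) -(subrr v) -(spec_tr_tr vv1) -(spec_tr_tr vv2) E1.
Qed.

(** Translations are local inverses of the projection. *)
Lemma spec_lift phi r : (r%:E <= dist_spectrum phi)%E ->
  is_lift (@proj_E R E X p rdp) phi r (fun b => spec_tr phi (b - proj_E phi)).
Proof.
move=> rd; split; first by rewrite subrr spec_tr0.
move=> b br; have bd : ((nrm (b - proj_E phi))%:E < dist_spectrum phi)%E.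
  by apply: lt_le_trans rd; rewrite lte_fin.
split; first by rewrite proj_spec_tr // subrKC.
apply: (@continuous_comp _ _ _ (fun b => b - proj_E phi) (spec_tr phi)).
  by apply: (@continuousB _ E E id (fun=> proj_E phi)); [exact: cvg_id | exact: cvg_cst].
exact: spec_tr_continuous.
Qed.

Lemma spec_riemann_domain : riemann_domain (@proj_E R E X p rdp).
Proof.
split; first exact: spec_hausdorff.
move=> phi; have [e e0 ed] := ereal_dense (dist_spectrum_gt0 phi).
have L := spec_lift (ltW ed); have [Lx LH] := L.
exists (spectrum_ball phi e).
apply: (chart_of_section (s := fun b => spec_tr phi (b - proj_E phi)) e0).
- exact: spec_ball_open.
- by rewrite (spectrum_ballP ed); exists 0; rewrite ?nrm0 // spec_tr0.
- rewrite (spectrum_ballP ed) => _ [v ve ->].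
  have vd : ((nrm v)%:E < dist_spectrum phi)%E by apply: lt_trans ed; rewrite lte_fin.
  rewrite (proj_spec_tr vd) (addrC (proj_E phi)) addrK; split=> //.
  exact: proj_continuous.
- move=> b be; have [pb cb] := LH b be; split=> //.
  by rewrite (spectrum_ballP ed); exists (b - proj_E phi).
Qed.

(** Near phi the function is v -> phi^v (f), holomorphic by [char_diff]. These are
    the extensions of the functions of bounded type. *)
Lemma spec_eval_holomorphic f : holomorphic (@proj_E R E X p rdp) (fun phi => \val phi f).
Proof.
apply: (holomorphicP spec_riemann_domain) => phi.
have [rho r0 cphi] := dist_lt_char (dist_spectrum_gt0 phi).
have [e e0 ed] := ereal_dense (dist_spectrum_gt0 phi).
pose r := Num.min rho e.
have r'0 : 0 < r by rewrite lt_min r0.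
have re : r <= e by rewrite ge_min lexx orbT.
have rr : r <= rho by rewrite ge_min lexx.
have rd : (r%:E <= dist_spectrum phi)%E by apply: le_trans (ltW ed); rewrite lee_fin.
exists r, (fun b => spec_tr phi (b - proj_E phi)); split; [exact: r'0 | exact: spec_lift |].
have H0 : differentiable (fun v => tr rdp (\val phi) v f) (proj_E phi - proj_E phi).
  by apply: (char_diff rdp cphi f _).1; rewrite subrr nrm0; lra.
have H1 := (@shift_differentiable R E (fun v => tr rdp (\val phi) v f) (proj_E phi) (- proj_E phi) H0).1.
apply: (near_eq_diff _ H1).1.
have : nrm (proj_E phi - proj_E phi) < r by rewrite subrr nrm0.
move=> /near_nrm_ball; apply: filterS => b br.
rewrite /= spec_trE //; apply: lt_le_trans rd; by rewrite lte_fin.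
Qed.

End Spectrum.

(** * Open subsets, connectedness and morphisms of Riemann domains *)

Section OpenSubset.
Context {Y : topologicalType}.
Variable A : set Y.
Implicit Types (z : set_type A) (V : set Y).

Lemma sub_openP (C : set (set_type A)) :
  open C <-> exists2 G : set Y, open G & C = [set z | G (\val z)].
Proof. by split=> -[G oG]; [move=> <- | move=> ->]; exists G. Qed.

Lemma sub_nbhsP z (W : set (set_type A)) :
  nbhs z W <-> exists2 V, nbhs (\val z) V & [set z' | V (\val z')] `<=` W.
Proof.
split=> [|[V]].
  rewrite nbhsE => -[C [/sub_openP[G oG ->] Gz] CW]; exists G => //.
  by exists G.
rewrite nbhsE => -[ G [oG Gz] GV] VW.
apply: (filterS (P := [set z' | G (\val z')])) => [z' /GV/VW //|].
by apply: open_nbhs_nbhs; split=> //; apply/sub_openP; exists G.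
Qed.

Lemma sub_connected : connected A -> connected [set: set_type A].
Proof.
move=> cA B [z0 Bz0] [C oC]; rewrite setTI => BC [D cD]; rewrite setTI => BD.
have /sub_openP[G oG CG] := oC.
have /sub_openP[G' oG' CG'] : open (~` D) by exact: closed_openC.
have inO (y : Y) (Ay : A y) : G y <-> ~ G' y.
  pose z : set_type A := SigSub (mem_set Ay).
  have -> : G y = B z by rewrite BC CG.
  have -> : G' y = (~` D) z by rewrite CG'.
  by rewrite BD /=; split=> [Dz|/contrapT].
have AO : A `&` G = A.
  apply: cA.
  - exists (\val z0); split; first exact: set_mem (valP z0).
    by move: Bz0; rewrite BC CG.
  - by exists G.
  - exists (~` G'); first exact: open_closedC.
    by apply/seteqP; split=> y [Ay] /(inO y Ay).
apply/seteqP; split=> // z _; rewrite BC CG /=.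
have : (A `&` G) (\val z) by rewrite AO; exact: set_mem (valP z).
by case.
Qed.

Lemma sub_val_continuous : continuous (fun z => \val z).
Proof. by move=> z V nV; apply/sub_nbhsP; exists V. Qed.

Lemma corestrict_continuous (T : topologicalType) (g : T -> set_type A) (t : T) :
  {for t, continuous (fun t' => \val (g t'))} -> {for t, continuous g}.
Proof.
move=> cg W /sub_nbhsP[V nV VW].
have : nbhs t [set t' | V (\val (g t'))] := cg V nV.
by rewrite /nbhs /=; apply: filterS => t' /= Vt; exact: VW.
Qed.

End OpenSubset.

(** Open-and-closed arguments in terms of neighbourhoods. *)
Lemma clopen_setT (T : topologicalType) (A : set T) t : connected [set: T] ->
  (forall s, A s -> nbhs s A) -> (forall s, ~ A s -> nbhs s (~` A)) -> A t -> forall s, A s.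
Proof.
move=> cT oA cA At s.
suff AT : A = [set: T] by rewrite AT.
apply: cT; first by exists t.
- by exists A; rewrite ?setTI // openE => u Au; apply: oA.
- exists (~` ~` A); last by rewrite setCK setTI.
  by apply: open_closedC; rewrite openE => u Au; apply: cA.
Qed.

Section Domains.
Context {R : realType} {E : completeNormedModType R[i]} {Y : topologicalType}.
Variable q : Y -> E.
Hypothesis rdq : riemann_domain q.
Implicit Types (y z : Y) (r : R) (s : E -> Y) (f : Y -> R[i]).

(** Balls in a Riemann domain are connected. *)
Lemma component_nbhs y z : connected_component [set: Y] y z ->
  nbhs z (connected_component [set: Y] y).
Proof.
move=> yz; have [r [s [r0 L]]] := lift_exists rdq z.
have zz : nrm (q z - q z) < r by rewrite subrr nrm0.
have := lift_near rdq L zz; rewrite L.1; apply: filterS => w [wr sw].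
by apply: connected_component_trans yz _; rewrite -sw; exact: lift_component L wr.
Qed.

Section Sub.
Variable A : set Y.
Hypothesis oA : open A.
Implicit Types (u : set_type A).

Definition sub_proj u : E := q (\val u).

(** A local inverse whose values stay in A is a local inverse for A. *)
Lemma sub_lift u r s : is_lift q (\val u) r s ->
  (forall b, nrm (b - q (\val u)) < r -> A (s b)) ->
  exists2 s', is_lift sub_proj u r s' &
    forall b, nrm (b - q (\val u)) < r -> \val (s' b) = s b.
Proof.
move=> [su H] sA; pose s' b := insubd u (s b).
have s'E b : nrm (b - q (\val u)) < r -> \val (s' b) = s b.
  by move=> br; rewrite /s' insubdK //; apply/mem_set/sA.
exists s' => //; split; first by apply: val_inj; rewrite /s' /sub_proj su valKd.
move=> b br; have [qs cs] := H b br; split; first by rewrite /sub_proj s'E.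
apply: corestrict_continuous => V; rewrite s'E // => /cs nV.
have : \forall c \near b, V (s c) /\ nrm (c - q (\val u)) < r.
  by apply: filterI; [exact: nV | exact: near_nrm_ball].
by rewrite /nbhs /=; apply: filterS => c [Vc /s'E cE]; rewrite /= cE.
Qed.

Lemma sub_lift_exists u : exists r s (s' : E -> set_type A), [/\ 0 < r, is_lift q (\val u) r s,
  is_lift sub_proj u r s' & forall b, nrm (b - q (\val u)) < r -> \val (s' b) = s b].
Proof.
have [r [s [r0 L]]] := lift_exists rdq (\val u).
have qu : nrm (q (\val u) - q (\val u)) < r by rewrite subrr nrm0.
have : \forall b \near q (\val u), A (s b).
  apply: (L.2 _ qu).2; rewrite L.1; apply: open_nbhs_nbhs; split=> //.
  exact: set_mem (valP u).
move=> /nbhs_nrm[e e0 eA].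
have re : Num.min r e <= e by rewrite ge_min lexx orbT.
have rr : Num.min r e <= r by rewrite ge_min lexx.
have L' := lift_shrink L rr.
have [s' Ls' s'E] := sub_lift L' (fun b br => eA b (lt_le_trans br re)).
by exists (Num.min r e), s, s'; split=> //; rewrite lt_min r0.
Qed.

Lemma sub_riemann_domain : riemann_domain sub_proj.
Proof.
split.
  move=> u w clu; apply: val_inj; apply: rdq.1 => P Q nP nQ.
  have nu : nbhs u [set z | P (\val z)] by apply/sub_nbhsP; exists P.
  have nw : nbhs w [set z | Q (\val z)] by apply/sub_nbhsP; exists Q.
  by have [z [Pz Qz]] := clu _ _ nu nw; exists (\val z).
move=> u; have [r [s [s' [r0 L L' s'E]]]] := sub_lift_exists u.
have sub_cont : continuous sub_proj.
  move=> z; apply: continuous_comp; first exact: sub_val_continuous.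
  exact: (p_continuous rdq).
pose U0 := [set z | nrm (sub_proj z - sub_proj u) < r /\ s' (sub_proj z) = z].
have inU b : nrm (b - sub_proj u) < r -> U0 (s' b).
  by move=> br; rewrite /U0 /= (L'.2 b br).1.
exists U0; apply: (chart_of_section (s := s') r0).
- rewrite openE => z [zr sz].
  have sz' : s (sub_proj z) = \val z by rewrite -s'E // sz.
  have := lift_near rdq L zr; rewrite sz' => n1.
  apply/sub_nbhsP; exists [set y | nrm (q y - q (\val u)) < r /\ s (q y) = y] => //.
  move=> z' [/= z'r sz'']; split=> //.
  by apply: val_inj; rewrite s'E.
- by rewrite /U0 /= subrr nrm0 L'.1.
- by move=> z [zr sz]; split=> //; exact: sub_cont.
- by move=> b br; have [? ?] := L'.2 b br; split=> //; exact: inU.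
Qed.

Lemma sub_holomorphic f : holomorphic q f -> holomorphic sub_proj (fun u => f (\val u)).
Proof.
move=> hf; apply: (holomorphicP sub_riemann_domain) => u.
have [r [s [s' [r0 L L' s'E]]]] := sub_lift_exists u.
exists r, s'; split=> //.
have uu : nrm (q (\val u) - q (\val u)) < r by rewrite subrr nrm0.
have d := hol_lift rdq hf L uu.
apply: (near_eq_diff _ d).1.
by apply: filterS (near_nrm_ball uu) => b br; rewrite /= s'E.
Qed.

End Sub.
End Domains.

Section Morphism.
Context {R : realType} {E : completeNormedModType R[i]} {X Y : topologicalType}.
Variables (p : X -> E) (q : Y -> E) (tau : X -> Y).
Hypothesis mor : rd_morphism p q tau.

Lemma mor_proj x : q (tau x) = p x.
Proof. by have [_ _ _ <-] := mor. Qed.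

Lemma mor_lift x r s : is_lift p x r s -> is_lift q (tau x) r (tau \o s).
Proof.
move=> [sx H]; split; first by rewrite mor_proj /= sx.
move=> b; rewrite mor_proj => br; have [ps cs] := H b br.
split; first by rewrite /= mor_proj.
by apply: continuous_comp => //; have [_ _ c _] := mor; exact: c.
Qed.

(** A morphism is a local homeomorphism, because it maps local inverses of p to
    local inverses of q. *)
Lemma mor_open x : \forall y \near tau x, exists x', tau x' = y.
Proof.
have [rdp rdq _ _] := mor; have [r [s [r0 L]]] := lift_exists rdp x.
have xx : nrm (p x - q (tau x)) < r by rewrite mor_proj subrr nrm0.
have := lift_near rdq (mor_lift L) xx; rewrite /= L.1.
by apply: filterS => y [_ sy]; exists (s (q y)).
Qed.

(** Two extensions agree on the image of tau, which contains an open set; the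
    identity theorem applies. *)
Lemma extension_unique (x0 : X) (g h : Y -> R[i]) : connected [set: Y] ->
  holomorphic q g -> holomorphic q h -> g \o tau = h \o tau -> g = h.
Proof.
move=> cY hg hh gh; have [_ rdq _ _] := mor.
apply: (identity_theorem rdq cY hg hh (x0 := tau x0)).
by apply: filterS (mor_open x0) => y [x <-]; exact: (congr1 (@^~ x) gh).
Qed.

End Morphism.

(** * Evaluations at points and the extension property *)

Section Delta.
Context {R : realType} {E : completeNormedModType R[i]} {X : topologicalType}.
Variable p : X -> E.
Hypothesis rdp : riemann_domain p.
Implicit Types (x y : X) (v : E) (f : Hb p).

Lemma delta_dom x : dom (\val (delta rdp x)) [set x].
Proof. by move=> f M M0 fM; rewrite mul1r; exact: fM. Qed.

(** An evaluation is dominated by a single point. *)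
Lemma delta_dist x : (dist_pt p x <= dist_spectrum (delta rdp x))%E.
Proof.
have := dist_spectrum_ge (Xbounded1 rdp x) (@delta_dom x).
by rewrite /dist_set image_set1 ereal_inf1.
Qed.

(** The Taylor series of f at x converges to f (x + v). *)
Lemma spec_tr_delta x v : ((nrm v)%:E < dist_pt p x)%E ->
  spec_tr (delta rdp x) v = delta rdp (sh p x v).
Proof.
move=> vx; have vB : ((nrm v)%:E < dist_set p [set x])%E.
  by rewrite /dist_set image_set1 ereal_inf1.
apply: val_inj; apply/funext => f; rewrite spec_trE; last first.
  exact: lt_le_trans vx (delta_dist x).
have [lin _ _ _] := spec_Mb (delta rdp x).
apply: tends_unique (tr_tends rdp lin (Xbounded1 rdp x) (@delta_dom x) f vB) _ => e e0.
have [K HK] := taylor_unif rdp f (Xbounded1 rdp x) vB e0.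
by exists K => N KN; exact: HK.
Qed.

Lemma delta_cont : continuous (delta rdp).
Proof.
move=> x W /spec_nbhsP[e [e0 ed eW]].
have [r [s [r0 L]]] := lift_exists rdp x.
have xx : nrm (p x - p x) < r by rewrite subrr nrm0.
have n1 := lift_near rdp L xx; rewrite L.1 in n1.
have n2 : \forall y \near x, nrm (p y - p x) < e.
  have := @p_continuous _ _ _ p rdp x [set c | nrm (c - p x) < e]; apply.
  by apply: near_nrm_ball; rewrite subrr nrm0.
suff : \forall y \near x, W (delta rdp y) by [].
apply: filterS (filterI n1 n2) => y [[yr sy] ye].
apply: eW; rewrite (spectrum_ballP ed); exists (p y - p x) => //.
rewrite spec_tr_delta; last first.
  by apply: lt_le_trans (lift_dist_ge rdp r0 L); rewrite lte_fin.
by rewrite (sh_lift rdp L yr) subrKC sy.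
Qed.

Lemma proj_delta x : proj_E (delta rdp x) = p x.
Proof. exact: proj_eq. Qed.

Hypothesis cX : connected [set: X].
Variable Z : set (spectrum_E rdp).
Hypothesis Z_component : exists phi, Z = connected_component [set: spectrum_E rdp] phi.
Hypothesis Z_delta : Z `&` range (delta rdp) !=set0.

(** A connected set that meets Z lies in Z. *)
Lemma Z_absorbs (T : topologicalType) (g : T -> spectrum_E rdp) t0 :
  connected [set: T] -> continuous g -> Z (g t0) -> forall t, Z (g t).
Proof.
move=> cT cg; have [phi ->] := Z_component => Zt0 t.
apply: connected_component_trans Zt0 _.
apply: (@connected_component_max _ _ (range g)) => //.
by apply: connected_continuous_connected => //; exact: continuous_subspaceT.
Qed.

Lemma Z_open : open Z.
Proof.
have [phi ->] := Z_component; rewrite openE => psi H; apply: (component_nbhs (spec_riemann_domain rdp) H).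
Qed.

Lemma Z_connected : connected [set: set_type Z].
Proof.
by apply: sub_connected; have [phi ->] := Z_component; exact: component_connected.
Qed.

Lemma delta_in_Z x : Z (delta rdp x).
Proof.
have [phi [Zx0 [x0 _ E0]]] := Z_delta; rewrite -E0 in Zx0.
exact: Z_absorbs cX delta_cont Zx0 x.
Qed.

Definition delta_Z x : set_type Z := SigSub (mem_set (delta_in_Z x)).

Notation projZ := (fun z : set_type Z => proj_E (\val z)).

Lemma Z_morphism (T : topologicalType) (r : T -> E) (g : T -> spectrum_E rdp)
    (Zg : forall t, Z (g t)) :
  riemann_domain r -> continuous g -> (forall t, proj_E (g t) = r t) ->
  rd_morphism r projZ (fun t => SigSub (mem_set (Zg t)) : set_type Z).
Proof.
move=> rdr cg gr; split=> //.
- exact: (sub_riemann_domain (spec_riemann_domain rdp) Z_open).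
- move=> t; apply: (@corestrict_continuous _ Z _ (fun t => SigSub (mem_set (Zg t))) t).
  exact: cg.
- by apply/funext => t; exact: gr.
Qed.

Lemma delta_Z_morphism : rd_morphism p projZ delta_Z.
Proof. exact: Z_morphism rdp delta_cont proj_delta. Qed.

(** Evaluation at f extends f, and Z is connected. *)
Lemma delta_Z_extension : Hb_extension p projZ delta_Z.
Proof.
split=> [|f]; first exact: delta_Z_morphism.
have hf : holomorphic projZ (fun z => \val (\val z) f).
  exact: (sub_holomorphic (spec_riemann_domain rdp) Z_open (@spec_eval_holomorphic _ _ _ _ rdp f)).
have [phi [_ [x0 _ _]]] := Z_delta.
exists (fun z => \val (\val z) f); split; first by split.
move=> g [hg gf]; apply: (extension_unique delta_Z_morphism x0 Z_connected) => //.
Qed.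

End Delta.

(** * Uniform boundedness on the algebra of functions of bounded type *)

Section BanachSteinhaus.
Context {R : realType} {E : completeNormedModType R[i]} {X : topologicalType}.
Variable p : X -> E.
Hypothesis rdp : riemann_domain p.
Implicit Types (f g s : Hb p) (B : set X) (C M d : R) (x : X).

Definition exhaustion (k : nat) : set X :=
  [set x | nrm (p x) <= k%:R /\ ((k.+1%:R^-1)%:E <= dist_pt p x)%E].

Lemma exhaustion_Xbounded k : Xbounded p (exhaustion k).
Proof.
apply: (@nrm_Xbounded _ _ _ p _ k%:R (k.+1%:R^-1)) => [|x []|x []] //.
Qed.

Lemma exhaustion_mono k j : (k <= j)%N -> exhaustion k `<=` exhaustion j.
Proof.
move=> kj x [h1 h2]; split; first by apply: le_trans h1 _; rewrite ler_nat.
by apply: le_trans h2; rewrite lee_fin lef_pV2 ?posrE // ler_nat.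
Qed.

Lemma exhaustion_absorbs B : Xbounded p B -> exists k, B `<=` exhaustion k.
Proof.
move=> XB; have [M BM] := Xbounded_nrm XB; have [t t0 tB] := ereal_dense XB.2.
have tV : 0 < t^-1 by rewrite invr_gt0.
pose c := Num.max `|M| t^-1.
have c0 : 0 <= c by rewrite le_max normr_ge0.
have cb := archi_boundP c0.
exists (Num.bound c) => x Bx; split.
  apply: (le_trans (BM x Bx)); apply: (le_trans (ler_norm _)).
  by apply: le_trans (ltW cb); rewrite le_max lexx.
apply: le_trans (ltW (dist_setP tB Bx)); rewrite lee_fin -[leRHS]invrK.
rewrite lef_pV2 ?posrE //; apply: (@le_trans _ _ c); first by rewrite le_max lexx orbT.
by apply: le_trans (ltW cb) _; rewrite ler_nat.
Qed.

Variable T : nat -> Hb p -> R[i].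
Hypothesis lin_T : forall N, linear (T N).
Hypothesis cont_T : forall N, exists C B, [/\ Xbounded p B, 0 <= C & le_on (T N) C B].
Hypothesis bdd_T : forall f, exists M, forall N, nrm (T N f) <= M.

(** A function that violates the estimate with the constant (M + 1) / d, rescaled to
    size d. *)
Lemma hump k d M : 0 < d -> 0 <= M ->
  ~ (exists2 C, 0 <= C & forall N, le_on (T N) C (exhaustion k)) ->
  exists N g, (forall x, exhaustion k x -> nrm (g x) <= d) /\ M < nrm (T N g).
Proof.
move=> d0 M0 H.
pose C := (M + 1) / d.
have C0 : 0 < C by apply: divr_gt0 => //; lra.
have [N HN] : exists N, ~ le_on (T N) C (exhaustion k).
  apply/existsNP => HC; apply: H; exists C => //; exact: ltW.
have [f [b [b0 fb /negP]]] : exists f b, [/\ 0 <= b,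
    forall x, exhaustion k x -> nrm (f x) <= b & ~ nrm (T N f) <= C * b].
  apply: contrapT => HC; apply: HN => f b b0 fb; apply: contrapT => fbN.
  by apply: HC; exists f, b.
rewrite -ltNge => big.
(* b may be 0; b' > b is a positive bound of f that still violates the estimate. *)
pose b' := (b + nrm (T N f) / C) / 2.
have bb : b < nrm (T N f) / C by rewrite ltr_pdivlMr // mulrC.
have b'b : b < b' by rewrite /b'; lra.
have b'0 : 0 < b' by exact: le_lt_trans b'b.
have big' : C * b' < nrm (T N f).
  by rewrite mulrC -ltr_pdivlMr // /b'; lra.
exists N, ((d / b')%:C *: f); split=> [x Bx|].
  rewrite HbZ nrmM nrm_real ger0_norm; last by rewrite divr_ge0 // ltW.
  rewrite mulrAC ler_pdivrMr // ler_pM2l //.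
  exact: (le_trans (fb x Bx) (ltW b'b)).
rewrite (linZ (lin_T N)) nrmM nrm_real ger0_norm; last by rewrite divr_ge0 // ltW.
rewrite mulrAC ltr_pdivlMr //.
have E1 : d * (C * b') = (M + 1) * b' by rewrite /C; field; rewrite gt_eqF.
have : d * (C * b') < d * nrm (T N f) by rewrite ltr_pM2l.
rewrite E1; apply: le_lt_trans; nra.
Qed.

(** The state is (partial sum, index of the exhaustion, size of the next hump). In
    the step a hump of size at most u.2 on the current set is added, which makes
    some T N large; the next set and the next size are then chosen so that no later
    humps can change that value of T N by more than 1. *)
Definition hump_step (j : nat) (u u' : Hb p * nat * R) :=
  [/\ (u.1.2 < u'.1.2)%N, 0 < u'.2, u'.2 <= u.2 / 2, u'.2 <= j.+1%:R^-1 &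
    (forall x, exhaustion u.1.2 x -> nrm (u'.1.1 x - u.1.1 x) <= u.2) /\
    exists N, j.+1%:R <= nrm (T N u'.1.1) /\
      forall h : Hb p, (forall x, exhaustion u'.1.2 x -> nrm (h x) <= 2 * u'.2) -> nrm (T N h) <= 1].

(** The functionals are bounded on the current partial sum, so a hump with a
    sufficiently large value under T N dominates it. *)
Lemma hump_step_exists j u : 0 < u.2 ->
  (forall k, ~ (exists2 C, 0 <= C & forall N, le_on (T N) C (exhaustion k))) ->
  exists u', hump_step j u u'.
Proof.
case: u => -[s k] d /= d0 H; have [Ms HMs] := bdd_T s.
have Ms0 : 0 <= Ms by apply: le_trans (HMs 0%N); exact: nrm_ge0.
have j0 : 0 <= j.+1%:R :> R by [].
have MM : 0 <= Ms + j.+1%:R by lra.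
have [N [g [gd gN]]] := hump d0 MM (H k).
have [C [B [XB C0 HC]]] := cont_T N.
have [k0 Bk0] := exhaustion_absorbs XB.
have jV : 0 < j.+1%:R^-1 :> R by rewrite invr_gt0.
have c0 : 0 < (2 * (C + 1))^-1 by rewrite invr_gt0; lra.
(* The last bound gives C (2 d') <= 1. *)
pose d' := Num.min (d / 2) (Num.min (j.+1%:R^-1) (2 * (C + 1))^-1).
have d'0 : 0 < d' by rewrite !lt_min c0 jV divr_gt0.
have d'd : d' <= d / 2 by rewrite ge_min lexx.
have d'j : d' <= j.+1%:R^-1 by rewrite /d' !ge_min lexx orbT.
have d'c : d' <= (2 * (C + 1))^-1 by rewrite /d' !ge_min lexx !orbT.
exists (s + g, maxn k.+1 k0, d'); split=> //=; first exact: leq_maxl.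
split=> [x Bx|].
  have := gd x Bx; suff -> : g x = (s + g) x - s x by [].
  by rewrite HbD addrC addKr.
exists N; split.
  rewrite (linD (lin_T N)); have := HMs N; have := nrmB (T N s + T N g) (T N s).
  rewrite addrC addKr; lra.
move=> h hb; have h2 : 0 <= 2 * d' by lra.
apply: (le_trans (HC h (2 * d') h2 _)).
  by move=> x /Bk0 Bx; apply: hb; apply: exhaustion_mono Bx; exact: leq_maxr.
have C2 : 0 < 2 * (C + 1) by lra.
have : d' * (2 * (C + 1)) <= 1 by rewrite -ler_pdivlMr // div1r.
nra.
Qed.

(** The sizes of the humps decrease geometrically and the sets exhaust the
    X-bounded sets, so the partial sums converge uniformly on each X-bounded set;
    the limit is holomorphic by [weierstrass]. *)
Lemma hump_limit (u : nat -> Hb p * nat * R) : 0 < (u 0%N).2 ->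
  (forall j, hump_step j (u j) (u j.+1)) ->
  exists f, forall j x, exhaustion (u j).1.2 x -> nrm ((f - (u j).1.1) x) <= 2 * (u j).2.
Proof.
move=> u0 H.
pose s j := (u j).1.1; pose k j := (u j).1.2; pose d j := (u j).2.
have d0 j : 0 < d j by case: j => // j; have [] := H j.
have dS j : d j.+1 <= d j / 2 by have [] := H j.
have dV j : d j.+1 <= j.+1%:R^-1 by have [] := H j.
have kS j : (k j < k j.+1)%N by have [] := H j.
have kj j : (j <= k j)%N by elim: j => // j IH; exact: leq_ltn_trans IH (kS j).
have kmono i j : (i <= j)%N -> (k i <= k j)%N.
  by move=> ij; apply: (homo_leq (fun=> leqnn _) (fun a b c => @leq_trans a b c)
    (fun n => ltnW (kS n)) ij).
have sS j x : exhaustion (k j) x -> nrm (s j.+1 x - s j x) <= d j.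
  by have [_ _ _ _ [Hs _]] := H j; exact: Hs.
have sD n m x : exhaustion (k n) x -> nrm (s (n + m)%N x - s n x) <= 2 * d n - 2 * d (n + m)%N.
  move=> Bx; elim: m => [|m IH]; first by rewrite addn0 subrr nrm0; lra.
  rewrite addnS; have := nrm_tri (s (n + m)%N x) (s (n + m).+1 x) (s n x).
  have : nrm (s (n + m).+1 x - s (n + m)%N x) <= d (n + m)%N.
    by apply: sS; apply: exhaustion_mono Bx; apply: kmono; exact: leq_addr.
  have := dS (n + m)%N; lra.
have sC n m x : (n <= m)%N -> exhaustion (k n) x -> nrm (s m x - s n x) <= 2 * d n.
  by move=> nm Bx; have := sD n (m - n)%N x Bx; rewrite subnKC //; have := d0 m; lra.
have d_small e : 0 < e -> exists n, d n <= e / 4.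
  move=> e0; have e4 : 0 < e / 4 by lra.
  have := archi_boundP (ltW (divr_gt0 ltr01 e4)); set n := Num.bound _ => Hn.
  exists n.+1; apply: (le_trans (dV n)); rewrite invf_ple ?posrE // -div1r.
  by apply: (le_trans (ltW Hn)); rewrite ler_nat.
have d_mono n m : (n <= m)%N -> d m <= d n.
  elim: m => [|m IH]; first by rewrite leqn0 => /eqP ->.
  rewrite leq_eqVlt => /orP[/eqP -> //|]; rewrite ltnS => /IH h.
  by have := dS m; have := d0 m; lra.
have /choice[f Hf] : forall x, exists l, tends (fun j => s j x) l.
  move=> x; apply: cauchy_tends => e e0.
  have [k0 /(_ x erefl) Bk0] := exhaustion_absorbs (Xbounded1 rdp x).
  have [n0 Hn0] := d_small e e0; pose n := maxn k0 n0.
  have Bx : exhaustion (k n) x.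
    by apply: exhaustion_mono Bk0; apply: leq_trans (kj n); exact: leq_maxl.
  have dn : d n <= e / 4 by apply: le_trans Hn0; apply: d_mono; exact: leq_maxr.
  exists n => a b na nb.
  have := sC n a x na Bx; have := sC n b x nb Bx.
  have := nrm_tri (s n x) (s a x) (s b x); rewrite (nrmC (s n x)); lra.
have fs n x : exhaustion (k n) x -> nrm (f x - s n x) <= 2 * d n.
  by move=> Bx; apply: (tends_le (K := n) (Hf x)) => m nm; exact: sC.
have funif B e : Xbounded p B -> 0 < e -> exists K, forall j, (K <= j)%N ->
    forall x, B x -> nrm (s j x - f x) <= e.
  move=> XB e0; have [k0 Bk0] := exhaustion_absorbs XB.
  have [n0 Hn0] := d_small e e0; exists (maxn k0 n0) => j; rewrite geq_max => /andP[kj0 nj] x Bx.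
  have Bj : exhaustion (k j) x.
    by apply: exhaustion_mono (Bk0 x Bx); apply: leq_trans (kj j).
  have := fs j x Bj; have := d_mono n0 j nj; rewrite nrmC; lra.
have Pf : f \in Hb_pred p.
  apply: Hb_memP.
    apply: (holomorphicP rdp) => x; have [r [l [r0 L]]] := lift_exists rdp x.
    exists r, l; split=> //.
    have r2 : 0 < r / 2 by lra.
    pose B := [set l b | b in [set b | nrm (b - p x) <= r / 2]].
    have XB : Xbounded p B.
      apply: (@nrm_Xbounded _ _ _ p _ (nrm (p x) + r / 2) (r / 2) r2) => _ [b /= br <-].
        have br' : nrm (b - p x) < r by lra.
        by rewrite (L.2 b br').1; have := nrmD (b - p x) (p x); rewrite subrK; lra.
      by apply: (lift_dist_ge rdp r2 (s := l)); apply: lift_sub L r2 _; lra.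
    apply: (weierstrass (gk := fun j => s j \o l) r2 _ _).1 => [j b br|e e0].
      by apply: (hol_lift rdp (Hb_holomorphic (s j)) L); lra.
    have [K HK] := funif B e XB e0; exists K => j Kj b br.
    by apply: HK => //; exists b.
  move=> B XB; have [K HK] := funif B 1 XB ltr01.
  have [M HM] := Hb_bounded (s K) XB; exists (M + 1) => x Bx.
  have := HK K (leqnn K) x Bx; have := HM x Bx; have := nrmB (s K x) (s K x - f x).
  by rewrite opprB addrC subrK; lra.
by exists (MkHb Pf) => j x Bx; rewrite HbB; exact: fs.
Qed.

(** Otherwise the sum of the humps would be an element of H_b on which the T N are
    unbounded. *)
Lemma banach_steinhaus : exists C B, [/\ Xbounded p B, 0 <= C & forall N, le_on (T N) C B].
Proof.
apply: contrapT => nBS.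
have H k : ~ (exists2 C, 0 <= C & forall N, le_on (T N) C (exhaustion k)).
  move=> [C C0 HC]; apply: nBS; exists C, (exhaustion k); split=> //.
  exact: exhaustion_Xbounded.
have /choice[next Hnext] : forall a : nat * (Hb p * nat * R),
    exists u', 0 < a.2.2 -> hump_step a.1 a.2 u'.
  move=> [j v] /=; have [v0|v0] := ltP 0 v.2.
    by have [u' Hu'] := @hump_step_exists j v v0 H; exists u'.
  by exists v.
pose u := fix u j := if j is i.+1 then next (i, u i) else ((0 : Hb p), 0%N, (1 : R)).
have u_pos j : 0 < (u j).2.
  elim: j => [|j IH]; first exact: ltr01.
  by have [_ ? _ _ _] := Hnext (j, u j) IH.
have Hu j : hump_step j (u j) (u j.+1) by exact: (Hnext (j, u j) (u_pos j)).
have [f Hf] := hump_limit (u_pos 0%N) Hu.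
have [M HM] := bdd_T f.
have M0 : 0 <= M by apply: le_trans (HM 0%N); exact: nrm_ge0.
have := archi_boundP M0; set j := Num.bound M => Mj.
have [_ _ _ _ [_ [N [big small]]]] := Hu j.
have := small (f - (u j.+1).1.1) (Hf j.+1).
rewrite (linB (lin_T N)) => h1.
have := HM N; have := nrmB (T N f) (T N f - T N (u j.+1).1.1).
rewrite opprB addrC subrK -natr1 in big * => h2 h3; lra.
Qed.

End BanachSteinhaus.

Lemma le_on_limit {R : realType} {E : completeNormedModType R[i]} {X : topologicalType}
    (p : X -> E) (T : nat -> Hb p -> R[i]) (F : Hb p -> R[i]) (C : R) (B : set X) :
  (forall N, le_on (T N) C B) -> (forall f, tends (fun N => T N f) (F f)) -> le_on F C B.
Proof.
move=> HT TF f M M0 fM; rewrite -[F f]subr0; apply: (tends_le (K := 0%N) (TF f)) => N _.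
by rewrite subr0; exact: HT.
Qed.

Lemma tends_bounded {R : realType} (u : nat -> R[i]) (l : R[i]) :
  tends u l -> exists M, forall n, nrm (u n) <= M.
Proof.
move=> ul; have [K HK] := ul 1 ltr01.
have [M HM] : exists M, forall n, (n < K)%N -> nrm (u n) <= M.
  elim: K {HK} => [|K [M HM]]; first by exists 0.
  exists (Num.max M (nrm (u K))) => n; rewrite ltnS leq_eqVlt le_max => /orP[/eqP ->|/HM ->//].
  by rewrite lexx orbT.
exists (Num.max M (nrm l + 1)) => n; rewrite le_max; case: (ltnP n K) => [/HM -> //|nK].
have h1 := HK n nK; have h2 := nrmD (u n - l) l; rewrite subrK in h2.
by apply/orP; right; lra.
Qed.

(** * The universal property *)

Section TaylorLinear.
Context {R : realType} {E : completeNormedModType R[i]} {X : topologicalType}.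
Variable p : X -> E.
Hypothesis rdp : riemann_domain p.
Implicit Types (v w : E) (f g : Hb p) (x : X) (c : R[i]).

Lemma tayHb1_linear w : linear (tayHb rdp 1 w).
Proof.
have B f g : tayHb rdp 1 w (f - g) = tayHb rdp 1 w f - tayHb rdp 1 w g.
  apply: HbP => x; rewrite HbB /= /taylor_term /dn /= -mulrBl; congr (_ / _).
  exact: (dB (Hb_holomorphic f x) (Hb_holomorphic g x)).2.
have Z c f : tayHb rdp 1 w (c *: f) = c *: tayHb rdp 1 w f.
  apply: HbP => x; rewrite HbZ /= /taylor_term /dn /= mulrA; congr (_ / _).
  exact: (dZ c (Hb_holomorphic f x)).2.
move=> c f g; have -> : c *: f + g = c *: f - (-1) *: g by rewrite scaleN1r opprK.
by rewrite B !Z scaleN1r opprK.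
Qed.

(** By [iter_tayHb] it suffices that the first differential is linear in f. *)
Lemma taysum_linear N v : linear (taysum rdp N v).
Proof.
have H n : linear (tayHb rdp n v).
  move=> c f g; apply: HbP => x.
  have n0 : n`!%:R != 0 :> R[i] by rewrite pnatr_eq0 -lt0n fact_gt0.
  apply: (mulfI n0); rewrite HbD HbZ mulrDr [X in _ = X + _]mulrCA -!iter_tayHb.
  have -> : iter n (tayHb rdp 1 v) (c *: f + g) =
      c *: iter n (tayHb rdp 1 v) f + iter n (tayHb rdp 1 v) g.
    by elim: n {n0} => // n IH; rewrite !iterS IH tayHb1_linear.
  by rewrite HbD HbZ.
move=> c f g; rewrite /taysum scaler_sumr -big_split /=.
by apply: eq_bigr => n _; exact: H.
Qed.

Lemma taysum_bound B v N : Xbounded p B -> exists C B', [/\ Xbounded p B', 0 <= C &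
  forall f (M : R), 0 <= M -> (forall y, B' y -> nrm (f y) <= M) ->
    forall x, B x -> nrm (taysum rdp N v f x) <= C * M].
Proof.
move=> XB; have [B' [q [XB' q0 H]]] := taylor_bound rdp v XB.
exists (\sum_(n < N) 2 / q ^+ n), B'; split=> //.
  by apply: sumr_ge0 => n _; rewrite divr_ge0 // exprn_ge0 // ltW.
move=> f M M0 fM x Bx; elim: N => [|N IH].
  by rewrite /taysum !big_ord0 mul0r [nrm _](_ : _ = 0) // -[RHS](@nrm0 _ R[i]).
have -> : taysum rdp N.+1 v f x = taysum rdp N v f x + tayHb rdp N v f x.
  by rewrite /taysum big_ord_recr HbD.
rewrite big_ord_recr /= mulrDl; apply: (le_trans (nrmD _ _)); apply: lerD => //.
by have := H N f M fM x Bx; rewrite mulrAC.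
Qed.

End TaylorLinear.

Section Universal.
Context {R : realType} {E : completeNormedModType R[i]} {X W : topologicalType}.
Variables (p : X -> E) (r : W -> E) (nu : X -> W).
Hypothesis rdp : riemann_domain p.
Hypothesis cX : connected [set: X].
Variable x0 : X.
Hypothesis ext : Hb_extension p r nu.
Implicit Types (f g : Hb p) (w : W) (v : E) (rho t : R) (s : E -> W).

Let rdr : riemann_domain r. Proof. by have [[]] := ext. Qed.

Definition extend f : W -> R[i] :=
  xget (fun=> 0) [set g | holomorphic r g /\ g \o nu = f].

Lemma extendP f : holomorphic r (extend f) /\ (forall x, extend f (nu x) = f x).
Proof.
have [g [[hg gf] _]] := ext.2 f.
have : [set g | holomorphic r g /\ g \o nu = f] (extend f) by apply: xgetPex; exists g.
by move=> [H1 H2]; split=> // x; exact: (congr1 (@^~ x) H2).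
Qed.

Lemma extend_unique f (g : W -> R[i]) : holomorphic r g ->
  (forall x, g (nu x) = f x) -> g = extend f.
Proof.
move=> hg gf; have [h [_ hu]] := ext.2 f; have [H1 H2] := extendP f.
have <- : h = g by apply: hu; split=> //; apply/funext.
by apply: hu; split=> //; apply/funext.
Qed.

(** The indicator function of the component that contains the image of X is
    holomorphic and extends 1, as the constant 1 does; uniqueness of extensions
    makes them equal. *)
Lemma extension_connected : connected [set: W].
Proof.
pose A := connected_component [set: W] (nu x0).
have nuA x : A (nu x).
  apply: (@connected_component_max _ _ (range nu)) => //.
  apply: connected_continuous_connected => //; apply: continuous_subspaceT.
  by have [[]] := ext.
pose g w : R[i] := if pselect (A w) then 1 else 0.
have hg : holomorphic r g.
  apply: (holomorphicP rdr) => w; have [rho [s [rho0 L]]] := lift_exists rdr w.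
  exists rho, s; split=> //.
  apply: (near_eq_diff (f := fun=> g w) _ (differentiable_cst _ _)).1.
  have : nrm (r w - r w) < rho by rewrite subrr nrm0.
  move=> /near_nrm_ball; apply: filterS => b br /=.
  have ws := lift_component L br.
  rewrite /g; case: pselect => [Asb|nAsb]; case: pselect => [Aw|nAw] //.
    by case: nAw; apply: connected_component_trans Asb (connected_component_sym ws).
  by case: nAsb; apply: connected_component_trans Aw ws.
have h1 : holomorphic r (fun=> 1 : R[i]).
  by move=> w; exact: (@differentiable_cst _ _ _ (1 : R[i])).
have g1 : g = fun=> 1.
  rewrite (@extend_unique 1 _ h1) //; apply: extend_unique => // x.
  by rewrite /g; case: pselect => // /(_ (nuA x)).
suff -> : [set: W] = A by exact: component_connected.
apply/seteqP; split=> // w _; have := congr1 (@^~ w) g1.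
by rewrite /g; case: pselect => // _ /eqP; rewrite eq_sym oner_eq0.
Qed.

Definition ext_eval w : Hb p -> R[i] := fun f => extend f w.

(** Sums, products and scalar multiples of extensions are extensions; uniqueness
    makes every evaluation of extensions a unital algebra homomorphism. *)
Lemma ext_eval_linear w : linear (ext_eval w).
Proof.
move=> c f g; have [hf ff] := extendP f; have [hg gg] := extendP g.
have h : holomorphic r (c *: extend f + extend g).
  by move=> y; exact: (differentiableD (differentiableZ c (hf y)) (hg y)).
rewrite /ext_eval -(@extend_unique (c *: f + g) _ h) // => x.
by rewrite HbD HbZ -ff -gg.
Qed.

Lemma ext_eval_mul w : {morph ext_eval w : f g / f * g}.
Proof.
move=> f g; have [hf ff] := extendP f; have [hg gg] := extendP g.
have h : holomorphic r (extend f * extend g).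
  by move=> y; exact: (differentiableM (hf y) (hg y)).
rewrite /ext_eval -(@extend_unique (f * g) _ h) // => x.
by rewrite HbM -ff -gg.
Qed.

Lemma ext_eval_one w : ext_eval w 1 = 1.
Proof.
have h1 : holomorphic r (fun=> 1 : R[i]).
  by move=> y; exact: (@differentiable_cst _ _ _ (1 : R[i])).
by rewrite /ext_eval -(@extend_unique 1 _ h1).
Qed.

Lemma ext_eval_nu x : ext_eval (nu x) = \val (delta rdp x).
Proof. by apply/funext => f; exact: (extendP f).2. Qed.

(** gamma o r is an extension of gamma o p, so the functional ext_eval w projects
    to r w. *)
Lemma ext_eval_dual w gamma : ext_eval w (dual_comp rdp gamma) = gamma (r w).
Proof.
have /asboolP[h _] := dual_comp_bounded_type rdr gamma.
rewrite /ext_eval -(@extend_unique (dual_comp rdp gamma) _ h) // => x.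
by rewrite /= (mor_proj ext.1).
Qed.

(** Taylor terms are local, and nu is a local homeomorphism over E; uniqueness does
    the rest. *)
Lemma extend_tayHb n v f : extend (tayHb rdp n v f) = taylor_term r n (extend f) v.
Proof.
have [hf ff] := extendP f.
apply/esym/extend_unique => [|x]; first exact: (taylor_term_holomorphic rdr n v hf).
have [rho [l [rho0 L]]] := lift_exists rdp x.
have L' := mor_lift ext.1 L.
have px : nrm (p x - p x) < rho by rewrite subrr nrm0.
have rx : nrm (p x - r (nu x)) < rho by rewrite (mor_proj ext.1) subrr nrm0.
have E1 := taylor_term_lift rdr n v hf L' rx; have E2 := taylor_term_lift rdp n v (Hb_holomorphic f) L px.
rewrite /= L.1 in E1; rewrite L.1 in E2; apply: (etrans E1); apply/esym; apply: (etrans E2).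
by congr (tay n v _ _); apply/funext => b; rewrite /= ff.
Qed.

Lemma ext_eval_taylor w rho s v f : is_lift r w rho s -> nrm v < rho ->
  tends (fun N => ext_eval w (taysum rdp N v f)) (ext_eval (s (r w + v)) f).
Proof.
move=> L vr; have [hf _] := extendP f.
apply: eq_tends (tay_series (hol_lift rdr hf L) vr) => N.
rewrite [RHS](lin_sum (ext_eval_linear w) N (fun n => tayHb rdp n v f)).
apply: eq_bigr => n _.
have rr : nrm (r w - r w) < rho by rewrite subrr nrm0; apply: le_lt_trans vr; exact: nrm_ge0.
have := taylor_term_lift rdr n v hf L rr; rewrite L.1 => <-.
by rewrite /ext_eval extend_tayHb.
Qed.

(** The evaluation at w is continuous. *)
Definition ext_dom w := exists B, Xbounded p B /\ dom (ext_eval w) B.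

(** At s (r w + v) the extension of f is the sum of its Taylor series at w, whose
    partial sums are continuous functionals of f by [taylor_bound]. Pointwise limits
    of continuous functionals are continuous ([banach_steinhaus]). The length of v is
    restricted by W only, not by the sets that dominate the evaluation at w; this is
    what makes continuity propagate to all of W. *)
Lemma ext_dom_step w rho s v : is_lift r w rho s -> nrm v < rho ->
  ext_dom w -> ext_dom (s (r w + v)).
Proof.
move=> L vr [B [XB dB]].
have lin N : linear (fun f => ext_eval w (taysum rdp N v f)).
  by move=> c f g; rewrite taysum_linear ext_eval_linear.
have cont N : exists C B, [/\ Xbounded p B, 0 <= C &
    le_on (fun f => ext_eval w (taysum rdp N v f)) C B].
  have [C [B' [XB' C0 H]]] := taysum_bound rdp v N XB.
  exists C, B'; split=> // f M M0 fM; rewrite -[X in _ <= X]mul1r.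
  by apply: dB; [exact: mulr_ge0 | exact: H].
have bdd f : exists M, forall N, nrm (ext_eval w (taysum rdp N v f)) <= M.
  exact: tends_bounded (ext_eval_taylor f L vr).
have [C [B' [XB' C0 H]]] := banach_steinhaus rdp lin cont bdd.
exists B'; split=> //.
apply: (le_on_dom (ext_eval_mul _) (ext_eval_one _) C0).
exact: (le_on_limit H (fun f => ext_eval_taylor f L vr)).
Qed.

(** The radius in [ext_dom_step] does not shrink with the point, so the set of good
    points is closed as well as open. *)
Lemma ext_domT w : ext_dom w.
Proof.
apply: (clopen_setT extension_connected (t := nu x0)).
- move=> u Du; have [rho [s [rho0 L]]] := lift_exists rdr u.
  have uu : nrm (r u - r u) < rho by rewrite subrr nrm0.
  have := lift_near rdr L uu; rewrite L.1; apply: filterS => u' [ur su].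
  by rewrite /= -su -[r u'](subrKC (r u)); exact: ext_dom_step L ur Du.
- move=> u Du; have [rho [s [rho0 L]]] := lift_exists rdr u.
  have rho2 : 0 < rho / 2 by lra.
  have uu : nrm (r u - r u) < rho / 2 by rewrite subrr nrm0.
  have L2 := lift_shrink L (_ : rho / 2 <= rho).
  have := lift_near rdr (L2 ltac:(lra)) uu; rewrite L.1; apply: filterS => u' [ur su] /= Du'.
  apply: Du; have L' : is_lift r u' (rho / 2) s by rewrite -su; apply: lift_sub L rho2 _; lra.
  by rewrite -L.1 -[r u](subrKC (r u')); apply: ext_dom_step L' _ Du'; rewrite nrmC.
- by exists [set x0]; split; [exact: Xbounded1 | rewrite ext_eval_nu; exact: delta_dom].
Qed.

Lemma ext_spectrum w : exists phi : spectrum_E rdp, \val phi = ext_eval w.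
Proof.
have [B [XB dB]] := ext_domT w; have [rho rho0 rB] := ereal_dense XB.2.
apply: (@spec_mk _ _ _ _ rdp (ext_eval w) rho (r w)) => //; last exact: ext_eval_dual.
split; [exact: ext_eval_linear | exact: ext_eval_mul | exact: ext_eval_one |].
by move=> t tr; exists B; split=> //; apply: lt_trans rB; rewrite lte_fin.
Qed.

Section Map.
Variable mu : W -> spectrum_E rdp.
Hypothesis muE : forall w, \val (mu w) = ext_eval w.

Lemma proj_mu w : proj_E (mu w) = r w.
Proof. by apply: proj_eq => gamma; rewrite muE ext_eval_dual. Qed.

Lemma mu_nu x : mu (nu x) = delta rdp x.
Proof. by apply: val_inj; rewrite muE ext_eval_nu. Qed.

(** By the Taylor expansion of the extensions at w, mu (w + v) = (mu w)^v for small
    v. *)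
Lemma mu_continuous : continuous mu.
Proof.
move=> w A /spec_nbhsP[e [e0 ed eA]].
have [rho [s [rho0 L]]] := lift_exists rdr w.
have ww : nrm (r w - r w) < rho by rewrite subrr nrm0.
have n1 := lift_near rdr L ww; rewrite L.1 in n1.
have n2 : \forall w' \near w, nrm (r w' - r w) < e.
  have := @p_continuous _ _ _ r rdr w [set c | nrm (c - r w) < e]; apply.
  by apply: near_nrm_ball; rewrite subrr nrm0.
suff : \forall w' \near w, A (mu w') by [].
apply: filterS (filterI n1 n2) => w' [[wr sw] we].
apply: eA; rewrite (spectrum_ballP ed); exists (r w' - r w) => //.
have [d vd cphi] := dist_lt_char ed.
have vd' : nrm (r w' - r w) < d by lra.
apply: val_inj; rewrite spec_trE; last by apply: lt_trans ed; rewrite lte_fin.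
apply/funext => f; apply/esym; apply: (tends_unique (char_tends rdp cphi f vd')).
by have := ext_eval_taylor f L wr; rewrite subrKC sw -!muE.
Qed.

End Map.
End Universal.

Theorem theorem1p2 (R : realType) (E : completeNormedModType R[i])
    (X : topologicalType) (p : X -> E) (rdp : riemann_domain p)
    (X_connected : connected [set: X])
    (Z : set (spectrum_E rdp))
    (Z_component : exists phi : spectrum_E rdp,
       Z = connected_component [set: spectrum_E rdp] phi)
    (Z_delta : Z `&` range (delta rdp) !=set0) :
  exists delta_Z : X -> set_type Z,
    (forall x : X, \val (delta_Z x) = delta rdp x) /\
    Hb_envelope p (fun z : set_type Z => proj_E (\val z)) delta_Z.
Proof.
have [phi [Zphi [x0 _ dx0]]] := Z_delta.
exists (delta_Z X_connected Z_component Z_delta); split=> //.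
split=> [|W r nu ext]; first exact: delta_Z_extension.
have [mu muE] := choice (ext_spectrum rdp X_connected x0 ext).
have [[_ rdr _ _] _] := ext.
have cmu := mu_continuous ext muE.
have Zx0 : Z (mu (nu x0)) by rewrite (mu_nu ext muE) dx0.
have Zmu := Z_absorbs Z_component (extension_connected X_connected x0 ext) cmu Zx0.
exists (fun w => SigSub (mem_set (Zmu w)) : set_type Z).
  exact: (Z_morphism Z_component Zmu rdr cmu (proj_mu ext muE)).
by apply/funext => x; apply: val_inj; exact: (mu_nu ext muE).
Qed.
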